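(* Let $(\Sigma,\nabla)$ be an affine Szabó surface. Then $(\Sigma,\nabla)$ is recurrent if and only if around each point there exists a coordinate system $(U,(u_1,u_2))$ in which the non-zero components of $\nabla$ are $$\Gamma_{11}^{1}=-\partial_1\varphi,\qquad \Gamma_{22}^{2}=\partial_2\varphi$$ for some scalar function $\varphi$ such that $\partial_2\partial_1\varphi\neq 0$. Moreover, $(\Sigma,\nabla)$ is not locally symmetric.
   Context: All manifolds, functions, tensor fields and connections are $C^\infty$. An affine surface $(\Sigma,\nabla)$ is a $2$-dimensional manifold with a torsion-free affine connection; the components $\Gamma_{ij}^k$ are defined by $\nabla_{\partial_i}\partial_j=\sum_k\Gamma_{ij}^k\partial_k$, with $\partial_i=\partial/\partial u_i$ (all components other than the listed ones vanish). Let $\mathcal{R}^\nabla(X,Y)Z=\nabla_X\nabla_YZ-\nabla_Y\nabla_XZ-\nabla_{[X,Y]}Z$ be the curvature operator and $\rho(Y,Z)=\operatorname{trace}\big(X\mapsto \mathcal{R}^\nabla(X,Y)Z\big)$ the Ricci tensor. For $X\in T_p\Sigma$ the affine Szabó operator $\mathcal{S}^\nabla(X):T_p\Sigma\to T_p\Sigma$ is $\mathcal{S}^\nabla(X)Y=(\nabla_X\mathcal{R}^\nabla)(Y,X)X$. $(\Sigma,\nabla)$ is affine Szabó at $p$ if $\mathcal{S}^\nabla(X)$ has the same characteristic polynomial for every $X\in T_p\Sigma$; it is affine Szabó if it is affine Szabó at each point. A tensor field $T$ is recurrent if there exists a $1$-form $\alpha$ such that $\nabla T=\alpha\otimes T$;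 an affine surface is recurrent if its Ricci tensor is recurrent. Locally symmetric means $\nabla\mathcal{R}^\nabla=0$.
   Formalization: The surface is taken nonempty and connected, and ''not locally symmetric'' joins ''recurrent'' on one side of the equivalence: flat or round surfaces are affine Szabó and recurrent (α=0) but admit no such coordinates. *)

(* Defs.v *)
From HB Require Import structures.
From mathcomp Require Import all_boot all_order all_algebra.
From mathcomp Require Import all_classical all_reals all_analysis.

Set Implicit Arguments.
Unset Strict Implicit.
Unset Printing Implicit Defensive.

Import Order.TTheory GRing.Theory Num.Theory.
Import numFieldNormedType.Exports.
Local Open Scope classical_set_scope.
Local Open Scope ring_scope.

Section LocalCalculus.
Variable R : realType.

Definition plane := 'rV[R]_2.

Definition vfield := plane -> plane.

(* The coordinate field of u_(i+1): coordinates are indexed by 0 and 1. *)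
Definition coord_field (i : 'I_2) : vfield := cst (delta_mx 0 i).

Definition pderiv (W : normedModType R) (i : 'I_2) (f : plane -> W) : plane -> W :=
  fun x => 'D_(delta_mx 0 i) f x.

(* C^oo on an open set V; values of f outside V are irrelevant. *)
Definition smooth_on (W : normedModType R) (V : set plane) (f : plane -> W) :=
  forall (s : seq 'I_2) (x : plane), V x ->
    {for x, continuous (foldr (@pderiv W) f s)} /\
    forall i : 'I_2, derivable (foldr (@pderiv W) f s) x (delta_mx 0 i).

(* Componentwise, [X, Y]^k = X (Y^k) - Y (X^k). *)
Definition lie_bracket (X Y : vfield) : vfield :=
  fun x => 'D_(X x) Y x - 'D_(Y x) X x.

(* A torsion-free affine connection on the open set V.  All the axioms only
   constrain the values on V. *)
Record is_connection (V : set plane) (nab : vfield -> vfield -> vfield) : Prop := {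
  connection_smooth : forall X Y, smooth_on V X -> smooth_on V Y ->
    smooth_on V (nab X Y);
  connection_linearl : forall (f : plane -> R) X X' Y,
    smooth_on V f -> smooth_on V X -> smooth_on V X' -> smooth_on V Y ->
    forall x, V x ->
      nab (fun y => f y *: X y + X' y) Y x = f x *: nab X Y x + nab X' Y x;
  connection_addr : forall X Y Y',
    smooth_on V X -> smooth_on V Y -> smooth_on V Y' ->
    forall x, V x -> nab X (fun y => Y y + Y' y) x = nab X Y x + nab X Y' x;
  connection_leibniz : forall (f : plane -> R) X Y,
    smooth_on V f -> smooth_on V X -> smooth_on V Y ->
    forall x, V x ->
      nab X (fun y => f y *: Y y) x = 'D_(X x) f x *: Y x + f x *: nab X Y x;
  connection_torsion_free : forall X Y, smooth_on V X -> smooth_on V Y ->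
    forall x, V x -> nab X Y x - nab Y X x = lie_bracket X Y x }.

Section Tensors.
Variable nab : vfield -> vfield -> vfield.

Definition christoffel (i j k : 'I_2) (x : plane) : R :=
  nab (coord_field i) (coord_field j) x 0 k.

Definition curvature (X Y Z : vfield) : vfield :=
  fun x => nab X (nab Y Z) x - nab Y (nab X Z) x - nab (lie_bracket X Y) Z x.

(* (nabla_W R)(X, Y) Z *)
Definition nabla_curvature (W X Y Z : vfield) : vfield :=
  fun x => nab W (curvature X Y Z) x - curvature (nab W X) Y Z x
           - curvature X (nab W Y) Z x - curvature X Y (nab W Z) x.

(* By tensoriality a tangent vector v at x may be extended to any local field
   taking the value v at x; the extension with constant components is used. *)
Definition ricci (Y Z : vfield) : plane -> R :=
  fun x => \tr (lin1_mx (fun v : plane => curvature (cst v) Y Z x)).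

(* (nabla_W rho)(Y, Z) *)
Definition nabla_ricci (W Y Z : vfield) : plane -> R :=
  fun x => 'D_(W x) (ricci Y Z) x - ricci (nab W Y) Z x - ricci Y (nab W Z) x.

(* The matrix, acting on row vectors, of S(v) : w |-> (nabla_v R)(w, v) v. *)
Definition szabo_mx (x v : plane) : 'M[R]_2 :=
  lin1_mx (fun w : plane => nabla_curvature (cst v) (cst w) (cst v) (cst v) x).

End Tensors.
End LocalCalculus.

Section Surfaces.
Variable R : realType.

(* coord and param are total functions, only meaningful on dom and
   coord @` dom respectively. *)
Record chart (M : topologicalType) := Chart {
  dom : set M;
  coord : M -> plane R;
  param : plane R -> M;
  dom_open : open dom;
  img_open : open (coord @` dom);
  coordK : {in dom, cancel coord param};
  coord_continuous : {within dom, continuous coord};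
  param_continuous : {within coord @` dom, continuous param} }.

Definition img (M : topologicalType) (c : chart M) : set (plane R) :=
  coord c @` dom c.

Definition transition (M : topologicalType) (c c' : chart M) : plane R -> plane R :=
  coord c' \o param c.

Definition compatible (M : topologicalType) (c c' : chart M) :=
  smooth_on (coord c @` (dom c `&` dom c')) (transition c c') /\
  smooth_on (coord c' @` (dom c `&` dom c')) (transition c' c).

(* The atlas is maximal: its members are all the coordinate systems of the
   surface. *)
Record surface := Surface {
  space :> topologicalType;
  atlas : set (chart space);
  space_hausdorff : hausdorff_space space;
  space_second_countable : @second_countable space;
  atlas_cover : forall p : space, exists2 c, atlas c & dom c p;
  atlas_compatible : forall c c', atlas c -> atlas c' -> compatible c c';
  atlas_maximal : forall c, (forall c', atlas c' -> compatible c c') -> atlas c }.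

(* X in the coordinates of c and X' in those of c' are the same vector field
   where the two charts overlap. *)
Definition same_vfield (S : surface) (c c' : chart S) (X X' : vfield R) :=
  forall p : S, dom c p -> dom c' p ->
    X' (coord c' p) = 'D_(X (coord c p)) (transition c c') (coord c p).

(* A connection is given by its restrictions to all coordinate domains. Since
   the atlas is maximal, restrictions of charts to smaller open sets are charts,
   so that compatibility includes locality. *)
Record affine_connection (S : surface) := AffineConnection {
  nabla : chart S -> vfield R -> vfield R -> vfield R;
  nablaP : forall c, atlas c -> is_connection (img c) (nabla c);
  nabla_compatible : forall c c' X X' Y Y', atlas c -> atlas c' ->
    smooth_on (img c) X -> smooth_on (img c') X' ->
    smooth_on (img c) Y -> smooth_on (img c') Y' ->
    same_vfield c c' X X' -> same_vfield c c' Y Y' ->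
    same_vfield c c' (nabla c X Y) (nabla c' X' Y') }.

(* A 1-form is given in each chart by the column of its components. *)
Record one_form (S : surface) := OneForm {
  form : chart S -> plane R -> 'cV[R]_2;
  form_smooth : forall c, atlas c -> smooth_on (img c) (form c);
  form_compatible : forall c c', atlas c -> atlas c' ->
    forall (p : S) (v : plane R), dom c p -> dom c' p ->
      v *m form c (coord c p) =
      ('D_v (transition c c') (coord c p) : plane R) *m form c' (coord c' p) }.

Variables (S : surface) (D : affine_connection S).

Definition affine_szabo_at (p : S) := forall c, atlas c -> dom c p ->
  forall v w : plane R, char_poly (szabo_mx (nabla D c) (coord c p) v) =
                        char_poly (szabo_mx (nabla D c) (coord c p) w).

Definition affine_szabo := forall p : S, affine_szabo_at p.

Definition recurrent := exists alpha : one_form S,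
  forall c, atlas c -> forall W Y Z : vfield R,
    smooth_on (img c) W -> smooth_on (img c) Y -> smooth_on (img c) Z ->
    forall x, img c x ->
      nabla_ricci (nabla D c) W Y Z x =
      (W x *m form alpha c x) 0 0 * ricci (nabla D c) Y Z x.

Definition locally_symmetric := forall c, atlas c -> forall W X Y Z : vfield R,
  smooth_on (img c) W -> smooth_on (img c) X ->
  smooth_on (img c) Y -> smooth_on (img c) Z ->
  forall x, img c x -> nabla_curvature (nabla D c) W X Y Z x = 0.

Definition has_normal_form (c : chart S) (phi : plane R -> R) :=
  forall x, img c x ->
    (forall i j k : 'I_2, christoffel (nabla D c) i j k x =
       if [&& i == 0, j == 0 & k == 0] then - pderiv 0 phi x
       else if [&& i == 1, j == 1 & k == 1] then pderiv 1 phi x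
       else 0) /\
    pderiv 1 (pderiv 0 phi) x != 0.

End Surfaces.

(* Main.v *)
From HB Require Import structures.
Require Import Defs.
From mathcomp Require Import all_boot all_order all_algebra.
From mathcomp Require Import all_classical all_reals all_analysis.
From mathcomp Require Import ring lra.
Import Order.TTheory GRing.Theory Num.Theory.
Import numFieldNormedType.Exports.
Set Implicit Arguments.
Unset Strict Implicit.
Unset Printing Implicit Defensive.
Local Open Scope classical_set_scope.
Local Open Scope ring_scope.

(* The coordinate map of a chart, not the coordinates in a vector basis. *)
Local Notation coord := Defs.coord.

(** In dimension two the curvature is determined by the Ricci tensor rho: one has
    R(X, Y) Z = rho(Y, Z) X - rho(X, Z) Y, and the same identity holds between the
    covariant derivatives ([curvature_ricci], [nabla_curvature_ricci]).  Hence the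
    trace of the Szabo operator S(v) is (nabla_v rho)(v, v), and the Szabo
    condition, which compares S(v) with S(0) = 0, gives (nabla_v rho)(v, v) = 0 for
    all v ([szabo_cyclic]).

    Let nabla rho = alpha (x) rho and let the surface not be locally symmetric.
    Both rho and its symmetric part satisfy linear differential equations along
    curves, so on a connected surface each of them vanishes identically or nowhere
    ([tensor_vanish], [ricci_vanishes_dichotomy]).  If the symmetric part had no
    zero, alpha(v) rho(v, v) = 0 for all v would give alpha = 0, that is, a parallel
    curvature; if rho were zero, so would be the curvature.  So rho is skew and has
    no zero.  Then R(X, Y) is a multiple of the identity and acts trivially on
    directions, so that every direction at a point extends to a parallel line field:
    its slope solves a total differential system whose integrability condition is
    the skewness of rho ([slope_exists]).  Two transverse parallel line fields are
    the coordinate directions of suitable coordinates ([adapted_coordinates]).  In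
    these only the Christoffel symbols G 0 0 0 and G 1 1 1 survive, and skewness of
    rho becomes the closedness of - G 0 0 0 du_0 + G 1 1 1 du_1, whose potential is
    phi ([skew_ricci_normal_form]).

    Conversely, in normal form rho is skew with rho(e_1, e_0) = f := d_1 d_0 phi,
    which has no zero.  Skew forms make up a line bundle, so rho is recurrent
    ([skew_recurrent]).  If the curvature were parallel, then d_0 f = - (d_0 phi) f
    and d_1 f = (d_1 phi) f, and equating the mixed second derivatives of f would
    give 2 f^2 = 0 ([normal_form_not_parallel]).

    The analysis behind the coordinates is the smooth dependence of the solutions of
    w_t = G (s, t, w) on the parameter s ([ode_solution]) and the smoothness of the
    inverse of a map (x, y) |-> (x, F (x, y)) with F_y > 0 ([shear_diffeo]).  In both
    cases the derivatives of the unknown function are expressed by functions as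
    smooth as the unknown itself, which makes it smooth by induction. *)

(** * Functions of class C^k on open subsets of R^n *)

Section Basics.
Variable R : realType.

Lemma coord_le_norm n (v : 'rV[R]_n) i : `|v 0 i| <= `|v|.
Proof.
rewrite [leRHS]/Num.Def.normr/= mx_normrE.
apply: (le_bigmax _ (fun ij : 'I_1 * 'I_n => `|v ij.1 ij.2|) (0, i)).
Qed.

Lemma norm_rV_lt n (v : 'rV[R]_n) e : 0 < e ->
  (`|v| < e) <-> (forall i, `|v 0 i| < e).
Proof.
move=> e0; split=> [ve i|ve]; first exact: le_lt_trans (coord_le_norm _ _) ve.
rewrite /Num.Def.normr/= mx_normrE; apply: bigmax_lt => // -[i j] _ /=.
by rewrite (ord1 i).
Qed.

Lemma norm_rV_le n (v : 'rV[R]_n) e : 0 <= e ->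
  (`|v| <= e) <-> (forall i, `|v 0 i| <= e).
Proof.
move=> e0; split=> [ve i|ve]; first exact: le_trans (coord_le_norm _ _) ve.
rewrite /Num.Def.normr/= mx_normrE; apply: bigmax_le => // -[i j] _ /=.
by rewrite (ord1 i).
Qed.

Lemma segment_le (a b c e rho : R) : 0 <= c <= 1 -> `|a - e| <= rho ->
  `|b - e| <= rho -> `|a + c * (b - a) - e| <= rho.
Proof.
move=> /andP[c0 c1]; rewrite !ler_norml => /andP[? ?] /andP[? ?].
by apply/andP; split; nra.
Qed.

Lemma segment_lt (a b c e rho : R) : 0 <= c <= 1 -> `|a - e| < rho ->
  `|b - e| < rho -> `|a + c * (b - a) - e| < rho.
Proof.
move=> cI ae be; apply: le_lt_trans (@segment_le _ _ _ _ (Num.max `|a - e| `|b - e|) cI _ _) _.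
- by rewrite le_max lexx.
- by rewrite le_max lexx orbT.
- by rewrite gt_max ae.
Qed.

Lemma linear_rVE n (g : {linear 'rV[R]_n -> R}) v :
  g v = \sum_i v 0 i * g (delta_mx 0 i).
Proof.
rewrite {1}(row_sum_delta v) linear_sum; apply: eq_bigr => i _.
by rewrite linearZ.
Qed.

Lemma sum_continuous (T : topologicalType) n (f : 'I_n -> T -> R) x :
  (forall i, {for x, continuous (f i)}) ->
  {for x, continuous (fun y => \sum_i f i y)}.
Proof.
move=> fc; elim: n f fc => [|n IH] f fc.
  rewrite (_ : (fun _ => _) = cst 0); last by apply/funext => y; rewrite big_ord0.
  exact: cst_continuous.
rewrite (_ : (fun _ => _) =
    (fun y => f ord0 y + \sum_i f (lift ord0 i) y)); last first.
  by apply/funext => y; rewrite big_ord_recl.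
by apply: continuousD; [exact: fc|apply: IH => i; exact: fc].
Qed.

Lemma linear_rV_continuous n (g : {linear 'rV[R]_n -> R}) : continuous g.
Proof.
move=> x.
have -> : (g : _ -> _) = fun v => \sum_i v 0 i * g (delta_mx 0 i).
  by apply/funext => v; rewrite linear_rVE.
by apply: sum_continuous => i; apply: (@continuousM _ _ (fun v : 'rV[R]_n => v 0 i) (cst (g (delta_mx 0 i))));
  [exact: coord_continuous|exact: cst_continuous].
Qed.

Lemma diff_epsP n (f : 'rV[R]_n -> R) x : differentiable f x ->
  forall e, 0 < e ->
  \forall y \near x, `|f y - f x - 'd f x (y - x)| <= e * `|y - x|.
Proof.
move=> /diffE fE e e0.
have /eqaddoP /(_ e e0) : f = cst (f x) + ('d f x \o center x) +o_x (center x).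
  by apply: eqaddoE; apply/funext => y; rewrite fE lim_id.
move=> He; near=> y.
have : `|(f - (cst (f x) + ('d f x \o center x))) y| <= e * `|center x y|.
  by near: y.
by rewrite /cst /= -[(_ - _) y]/(f y - (f x + 'd f x (y - x))) opprD addrA.
Unshelve. all: by end_near. Qed.

(** All differentials are identified through this characterization: bounds by e |y -
    x| are easier to produce than little-o statements. *)
Lemma differentiable_epsP n (f : 'rV[R]_n -> R) x (g : {linear 'rV[R]_n -> R}) :
  (forall e, 0 < e ->
    \forall y \near x, `|f y - f x - g (y - x)| <= e * `|y - x|) ->
  differentiable f x /\ ('d f x = g :> (_ -> _)).
Proof.
move=> Hf.
have key e : 0 < e -> \forall h \near (0 : 'rV[R]_n),
    `|f (h + x) - f x - g h| <= e * `|h|.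
  move=> e0; have /nbhs_ballP[r r0 Hr] := Hf e e0.
  apply/nbhs_ballP; exists r => // h; rewrite -ball_normE /= sub0r normrN => hr.
  have := Hr (h + x); rewrite /= addrK; apply.
  by rewrite -ball_normE /= opprD addrCA subrr addr0 normrN.
have sE h : (f \o shift x - (cst (f x) + g)) h = f (h + x) - f x - g h.
  by rewrite -addrA -opprD.
have dE : 'd f x = g :> (_ -> _).
  apply: diff_unique; first exact: linear_rV_continuous.
  by apply/eqaddoP => e /key; apply: filterS => h; rewrite sE.
split=> //; apply/diff_locallyP; rewrite dE; split.
  exact: linear_rV_continuous.
by apply/eqaddoP => e /key; apply: filterS => h; rewrite sE.
Qed.

Lemma near_eq_differentiable n (f g : 'rV[R]_n -> R) x :
  (\near x, f x = g x) -> differentiable f x -> differentiable g x.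
Proof.
move=> fg df; apply: (proj1 (@differentiable_epsP _ g x ('d f x) _)) => e e0.
have := diff_epsP df e0; apply: filterS2 (fg) => y fgy.
by rewrite -fgy (nbhs_singleton fg).
Qed.

Lemma derive_lineE (V W : normedModType R) (f : V -> W) a v t :
  derivable f (a + t *: v) v ->
  is_derive t 1 (fun t => f (a + t *: v)) ('D_v f (a + t *: v)).
Proof.
move=> df.
have E : (fun h : R => h^-1 *: (((fun t => f (a + t *: v)) \o shift t) (h *: 1)
     - f (a + t *: v))) =
   (fun h => h^-1 *: ((f \o shift (a + t *: v)) (h *: v) - f (a + t *: v))).
  apply/funext => h /=; congr (_ *: (f _ - _)).
  by rewrite [h *: 1]mulr1 scalerDl addrCA addrA.
by split; rewrite /derivable /derive E.
Qed.

Lemma MVT_line n (f : 'rV[R]_n -> R) a v :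
  (forall t, 0 <= t <= 1 -> derivable f (a + t *: v) v) ->
  exists2 c, 0 <= c <= 1 & f (a + v) - f a = 'D_v f (a + c *: v).
Proof.
move=> df.
have := @MVT_segment R (fun t => f (a + t *: v)) (fun t => 'D_v f (a + t *: v))
  0 1 ler01.
case.
- move=> t; rewrite in_itv /= => /andP[t0 t1]; apply: derive_lineE.
  by apply: df; rewrite !ltW.
- apply: derivable_within_continuous => t; rewrite in_itv /= => /df /derive_lineE.
  by case.
move=> c; rewrite in_itv /= => cI; rewrite scale1r scale0r addr0 subr0 mulr1 => E.
by exists c.
Qed.

Lemma row_continuous (T : topologicalType) m (g : 'I_m -> T -> R) x :
  (forall j, {for x, continuous (g j)}) ->
  {for x, continuous (fun y => \row_j g j y)}.
Proof.
move=> gc; apply/cvgrPdist_lt => e e0.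
near=> y; apply/norm_rV_lt => // j; rewrite !mxE.
by move: j; near: y; apply: filter_forall => j; move/cvgrPdist_lt: (gc j); exact.
Unshelve. all: by end_near. Qed.

Lemma differentiable_row n m (G : 'rV[R]_n -> 'rV[R]_m) x :
  (forall j, differentiable (fun y => G y 0 j) x) -> differentiable G x.
Proof.
move=> dG.
have -> : G = \sum_(j < m) (fun y => G y 0 j *: (delta_mx 0 j : 'rV[R]_m)).
  by apply/funext => y; rewrite fct_sumE -row_sum_delta.
by apply: differentiable_sum => j; apply: differentiableZl.
Qed.

Lemma deriv_comp n m (f : 'rV[R]_m -> R) (G : 'rV[R]_n -> 'rV[R]_m) x v :
  differentiable f (G x) -> differentiable G x ->
  'D_v (f \o G) x = 'D_('D_v G x) f (G x).
Proof.
move=> df dG; rewrite !deriveE//; last exact: differentiable_comp.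
by rewrite diff_comp.
Qed.

Definition partial n (i : 'I_n) (f : 'rV[R]_n -> R) : 'rV[R]_n -> R :=
  fun x => 'D_(delta_mx 0 i) f x.

Lemma partialE n (i : 'I_n) f x : partial i f x = 'D_(delta_mx 0 i) f x.
Proof. by []. Qed.

Lemma pderivE (i : 'I_2) (f : plane R -> R) : pderiv i f = partial i f.
Proof. by []. Qed.

Lemma deriv_partial n (f : 'rV[R]_n -> R) x v : differentiable f x ->
  'D_v f x = \sum_i v 0 i * partial i f x.
Proof.
move=> df; rewrite deriveE// linear_rVE; apply: eq_bigr => i _.
by rewrite /partial deriveE.
Qed.

Lemma partial_comp n m (f : 'rV[R]_m -> R) (g : 'I_m -> 'rV[R]_n -> R) x i :
  differentiable f (\row_j g j x) -> (forall j, differentiable (g j) x) ->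
  partial i (fun y => f (\row_j g j y)) x =
  \sum_j partial i (g j) x * partial j f (\row_j g j x).
Proof.
move=> df dg; pose G y := \row_j g j y.
have dG : differentiable G x.
  apply: differentiable_row => j.
  by rewrite (_ : (fun _ => _) = g j)//; apply/funext => y; rewrite mxE.
rewrite /partial (@deriv_comp _ _ f G)// deriv_partial//.
apply: eq_bigr => j _; congr (_ * _).
rewrite derive_mx; last exact: diff_derivable.
by rewrite mxE; congr ('D_ _ _ x); apply/funext => y; rewrite mxE.
Qed.

(** For k > 0 total differentiability is required, and not only the existence of
    partial derivatives: this makes the chain rule [Ck_comp] a plain induction on k. *)
Fixpoint Ck n k (V : set 'rV[R]_n) (f : 'rV[R]_n -> R) : Prop :=
  match k with
  | 0 => forall x, V x -> {for x, continuous f}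
  | k'.+1 => (forall x, V x -> differentiable f x) /\
             forall i, Ck k' V (partial i f)
  end.

Lemma open_near_eq n (V : set 'rV[R]_n) (f g : 'rV[R]_n -> R) x : open V ->
  (forall x, V x -> f x = g x) -> V x -> \near x, f x = g x.
Proof.
move=> oV fg Vx; have : nbhs x V by exact: open_nbhs_nbhs.
by apply: filterS => y /fg.
Qed.

Lemma near_eq_partial n (f g : 'rV[R]_n -> R) x i :
  (\near x, f x = g x) -> partial i f x = partial i g x.
Proof. by move=> fg; exact: near_eq_derive. Qed.

Lemma near_eq_continuous n (f g : 'rV[R]_n -> R) x :
  (\near x, f x = g x) -> {for x, continuous f} -> {for x, continuous g}.
Proof.
move=> fg fc; rewrite /prop_for /continuous_at -(nbhs_singleton fg).
exact: (cvg_trans (near_eq_cvg fg) fc).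
Qed.

Lemma Ck_ext n k (V : set 'rV[R]_n) f g : open V ->
  (forall x, V x -> f x = g x) -> Ck k V f -> Ck k V g.
Proof.
move=> oV; elim: k f g => [|k IH] f g fg /=.
  by move=> fc x Vx; apply: near_eq_continuous (fc x Vx); exact: open_near_eq Vx.
move=> [df Hf]; split=> [x Vx|i].
  by apply: near_eq_differentiable (df x Vx); exact: open_near_eq Vx.
apply: IH (Hf i) => x Vx; apply: near_eq_partial; exact: open_near_eq Vx.
Qed.

Lemma Ck_sub n k (V W : set 'rV[R]_n) f : V `<=` W -> Ck k W f -> Ck k V f.
Proof.
move=> VW; elim: k f => [|k IH] f /=; first by move=> H x /VW; exact: H.
by move=> [df H]; split=> [x /VW|i]; [exact: df|exact: IH].
Qed.

Lemma Ck_cont n k (V : set 'rV[R]_n) f x : Ck k V f -> V x ->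
  {for x, continuous f}.
Proof.
case: k => [|k] /=; first by move=> H; exact: H.
by move=> [H _] Vx; apply: differentiable_continuous; exact: H.
Qed.

Lemma CkW n k (V : set 'rV[R]_n) f : Ck k.+1 V f -> Ck k V f.
Proof.
elim: k f => [|k IH] f; first by move=> H x Vx; exact: Ck_cont H Vx.
by move=> [df H]; split=> // i; exact: IH.
Qed.

Lemma Ck_cst n k (V : set 'rV[R]_n) a : Ck k V (cst a).
Proof.
elim: k a => [|k IH] a /=; first by move=> x _; exact: cst_continuous.
split=> [x _|i]; first exact: differentiable_cst.
rewrite (_ : partial i _ = cst 0); first exact: IH.
by apply/funext => x; rewrite /partial derive_cst.
Qed.

Lemma partial_coord n (i j : 'I_n) x :
  partial i (fun y => y 0 j) x = (j == i)%:R.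
Proof.
have /(congr1 (fun v : 'rV[R]_n => v 0 j)) :=
  @derive_mx _ _ 1 n id x (delta_mx 0 i) (@derivable_id _ _ _ _).
by rewrite derive_id !mxE eqxx /= /partial => ->.
Qed.

Lemma Ck_coord n k (V : set 'rV[R]_n) j : Ck k V (fun y => y 0 j).
Proof.
case: k => [|k] /=; first by move=> x _; exact: coord_continuous.
split=> [x _|i]; first exact: differentiable_coord.
rewrite (_ : partial i _ = cst (j == i)%:R); first exact: Ck_cst.
by apply/funext => x; rewrite partial_coord.
Qed.

Lemma partialD n (f g : 'rV[R]_n -> R) x i :
  differentiable f x -> differentiable g x ->
  partial i (fun y => f y + g y) x = partial i f x + partial i g x.
Proof. by move=> df dg; rewrite /partial deriveD//; apply: diff_derivable. Qed.

Lemma partialN n (f : 'rV[R]_n -> R) x i :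
  differentiable f x -> partial i (fun y => - f y) x = - partial i f x.
Proof. by move=> df; rewrite /partial deriveN//; apply: diff_derivable. Qed.

Lemma partialM n (f g : 'rV[R]_n -> R) x i :
  differentiable f x -> differentiable g x ->
  partial i (fun y => f y * g y) x = f x * partial i g x + g x * partial i f x.
Proof. by move=> df dg; rewrite /partial deriveM//; apply: diff_derivable. Qed.

Lemma partialV n (f : 'rV[R]_n -> R) x i : differentiable f x -> f x != 0 ->
  partial i (fun y => (f y)^-1) x = - (f x) ^- 2 * partial i f x.
Proof. by move=> df fx; rewrite /partial deriveV//; apply: diff_derivable. Qed.

Lemma differentiable_expR (x : R) : differentiable (@expR R) x.
Proof. exact/derivable1_diffP. Qed.

Lemma partial_exp n (f : 'rV[R]_n -> R) x i : differentiable f x ->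
  partial i (fun y => expR (f y)) x = expR (f x) * partial i f x.
Proof.
move=> df; have dE := differentiable_expR (f x).
rewrite /partial !deriveE//; last exact: differentiable_comp.
rewrite (diff_comp df dE) /= deriv1E; last exact/derivable1_diffP.
by rewrite /= derive1E derive_val [_ *: _]mulrC.
Qed.

Section OpenSet.
Variables (n : nat) (V : set 'rV[R]_n).
Hypothesis oV : open V.
Implicit Types f g : 'rV[R]_n -> R.

Lemma CkD k f g : Ck k V f -> Ck k V g -> Ck k V (fun x => f x + g x).
Proof.
elim: k f g => [|k IH] f g /=.
  by move=> fc gc x Vx; apply: continuousD; [exact: fc|exact: gc].
move=> [df Hf] [dg Hg]; split=> [x Vx|i].
  by apply: differentiableD; [exact: df|exact: dg].
apply: Ck_ext (IH _ _ (Hf i) (Hg i)) => // x Vx.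
by rewrite partialD//; [exact: df|exact: dg].
Qed.

Lemma CkM k f g : Ck k V f -> Ck k V g -> Ck k V (fun x => f x * g x).
Proof.
elim: k f g => [|k IH] f g /=.
  by move=> fc gc x Vx; apply: (@continuousM _ _ f g); [exact: fc|exact: gc].
move=> Cf Cg; have [df Hf] := Cf; have [dg Hg] := Cg; split=> [x Vx|i].
  by apply: differentiableM; [exact: df|exact: dg].
apply: Ck_ext (CkD (IH _ _ (CkW Cf) (Hg i)) (IH _ _ (CkW Cg) (Hf i))) => // x Vx.
by rewrite partialM//; [exact: df|exact: dg].
Qed.

Lemma CkN k f : Ck k V f -> Ck k V (fun x => - f x).
Proof.
move=> Cf; apply: Ck_ext (CkM (Ck_cst k V (-1)) Cf) => // x _.
by rewrite /cst mulN1r.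
Qed.

Lemma Ck_sum k m (f : 'I_m -> 'rV[R]_n -> R) :
  (forall i, Ck k V (f i)) -> Ck k V (fun x => \sum_i f i x).
Proof.
elim: m f => [|m IH] f Cf.
  by apply: Ck_ext (Ck_cst k V 0) => // x _; rewrite big_ord0.
apply: Ck_ext (CkD (Cf ord0) (IH (fun i => f (lift ord0 i)) _)) => // x _.
by rewrite big_ord_recl.
Qed.

Lemma CkV k f : (forall x, V x -> f x != 0) -> Ck k V f ->
  Ck k V (fun x => (f x)^-1).
Proof.
move=> f0; elim: k => [|k IH] Cf /=.
  by move=> x Vx; apply: (@continuousV _ _ f); [exact: f0|exact: Cf].
have [df Hf] := Cf; have CV := IH (CkW Cf); split=> [x Vx|i].
  by apply: differentiableV; [exact: df|exact: f0].
apply: Ck_ext (CkM (CkN (CkM CV CV)) (Hf i)) => // x Vx.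
by rewrite partialV//; [rewrite expr2 invfM|exact: df|exact: f0].
Qed.

Lemma Ck_exp k f : Ck k V f -> Ck k V (fun x => expR (f x)).
Proof.
elim: k => [|k IH] Cf /=.
  move=> x Vx; apply: continuous_comp; first exact: Cf.
  exact: continuous_expR.
have [df Hf] := Cf; split=> [x Vx|i].
  by apply: differentiable_comp; [exact: df|exact: differentiable_expR].
apply: Ck_ext (CkM (IH (CkW Cf)) (Hf i)) => // x Vx.
by rewrite partial_exp//; exact: df.
Qed.

(** The chain rule expresses the derivatives of the composite by composites with the
    same inner map, to which the induction hypothesis applies. *)
Lemma Ck_comp k m (W : set 'rV[R]_m) (h : 'rV[R]_m -> R)
    (g : 'I_m -> 'rV[R]_n -> R) :
  (forall x, V x -> W (\row_j g j x)) -> Ck k W h ->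
  (forall j, Ck k V (g j)) -> Ck k V (fun x => h (\row_j g j x)).
Proof.
move=> VW; elim: k h => [|k IH] h Ch Cg /=.
  move=> x Vx; apply: (@continuous_comp _ _ _ (fun x => \row_j g j x)).
    by apply: row_continuous => j; exact: Cg.
  exact: Ch (VW x Vx).
have [dh Hh] := Ch; split=> [x Vx|i].
  apply: (@differentiable_comp _ _ _ _ (fun x => \row_j g j x)).
    apply: differentiable_row => j.
    rewrite (_ : (fun _ => _) = g j); last by apply/funext => y; rewrite mxE.
    exact: (Cg j).1.
  exact: dh (VW x Vx).
have H : Ck k V (fun x => \sum_j partial i (g j) x * partial j h (\row_j g j x)).
  apply: Ck_sum => j; apply: CkM; first exact: (Cg j).2.
  by apply: IH => [|l]; [exact: Hh|exact: CkW].
apply: Ck_ext H => // x Vx; rewrite partial_comp//; first exact: dh (VW x Vx).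
by move=> j; exact: (Cg j).1.
Qed.

End OpenSet.

End Basics.
(* Partial derivatives are to be compared by name, not by unfolding limits. *)
Global Opaque partial.

(** * Differential calculus in two variables *)

Definition lin_form (R : realType) n (a : 'I_n -> R) (v : 'rV[R]_n) : R :=
  \sum_i v 0 i * a i.

Lemma lin_form_is_linear (R : realType) n (a : 'I_n -> R) : linear (lin_form a).
Proof.
move=> k u v; rewrite /lin_form /= scaler_sumr -big_split /=.
by apply: eq_bigr => i _; rewrite !mxE mulrDl -mulrA.
Qed.

HB.instance Definition _ (R : realType) n (a : 'I_n -> R) :=
  GRing.isLinear.Build R 'rV[R]_n R _ (lin_form a) (lin_form_is_linear a).

Section C1.
Variable R : realType.

Lemma derivable_scale n (f : 'rV[R]_n -> R) (x v : 'rV[R]_n) (k : R) : derivable f x v ->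
  is_derive x (k *: v) f (k * 'D_v f x).
Proof.
have [->|k0] := eqVneq k 0.
  by move=> _; rewrite scale0r mul0r; exact: is_derive0.
move=> /derivableP fv.
have : h^-1 *: ((f \o shift x) (h *: v) - f x) @[h --> 0^'] --> 'D_v f x.
  by have := @ex_derive _ _ _ _ _ _ _ fv.
move=> fl.
have fl2 : h^-1 *: ((f \o shift x) (h *: (k *: v)) - f x) @[h --> 0^'] -->
    k * 'D_v f x.
  have E : (fun h : R => h^-1 *: ((f \o shift x) (h *: (k *: v)) - f x)) =
    (fun h => k * ((fun h => h^-1 *: ((f \o shift x) (h *: v) - f x)) (h * k))).
    apply/funext => h /=; rewrite scalerA invfM -[RHS]/(k * (h^-1 * k^-1 * _)).
    by rewrite -mulrA mulrCA (mulrA k) divff// mul1r.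
  rewrite E; apply: cvgMr.
  suff H : (fun h : R => h * k) @ 0^' `=>` 0^' by exact: cvg_comp H fl.
  move=> A [d /= d0 Ad]; exists (d / `|k|) => /=.
    by rewrite divr_gt0// normr_gt0.
  move=> h /=; rewrite sub0r normrN => hk h0; apply: Ad.
    by rewrite /= sub0r normrN normrM -ltr_pdivlMr// normr_gt0.
  by rewrite mulf_neq0.
split; last exact: cvg_lim fl2.
by apply/cvg_ex; exists (k * 'D_v f x).
Qed.

Lemma MVT_coord n (f : 'rV[R]_n -> R) (x : 'rV[R]_n) (t : R) (i : 'I_n) :
  (forall s : R, 0 <= s <= 1 -> derivable f (x + (s * t) *: delta_mx 0 i) (delta_mx 0 i)) ->
  exists2 c : R, 0 <= c <= 1 &
    f (x + t *: delta_mx 0 i) - f x = t * partial i f (x + (c * t) *: delta_mx 0 i).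
Proof.
move=> df; have [] := @MVT_line _ _ f x (t *: delta_mx 0 i).
  move=> s /df; rewrite -scalerA => /(@derivable_scale _ _ _ _ t) H.
  exact: ex_derive.
move=> c cI ->; exists c => //.
have H := derivable_scale t (df _ cI).
by rewrite scalerA derive_val partialE.
Qed.

Definition pt (a b : R) : 'rV[R]_2 := \row_j (if j == 0 then a else b).

Lemma pt0 a b : pt a b 0 0 = a. Proof. by rewrite mxE. Qed.
Lemma pt1 a b : pt a b 0 1 = b. Proof. by rewrite mxE. Qed.

Lemma ordI2 (j : 'I_2) : j = 0 \/ j = 1.
Proof. by case: j => [[|[|]]] //= ?; [left|right]; apply: val_inj. Qed.

Lemma rV2P (u v : 'rV[R]_2) : u 0 0 = v 0 0 -> u 0 1 = v 0 1 -> u = v.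
Proof.
move=> u0 u1; apply/rowP => j.
by case: (ordI2 j) => ->.
Qed.

Lemma ptE (v : 'rV[R]_2) : v = pt (v 0 0) (v 0 1).
Proof. by apply: rV2P; rewrite ?pt0 ?pt1. Qed.

Lemma norm2_lt (v : 'rV[R]_2) e : 0 < e ->
  `|v 0 0| < e -> `|v 0 1| < e -> `|v| < e.
Proof.
move=> e0 v0 v1; apply/norm_rV_lt => // j.
by case: (ordI2 j) => ->.
Qed.

Lemma sumI2 (V : nmodType) (F : 'I_2 -> V) : \sum_i F i = F 0 + F 1.
Proof.
rewrite big_ord_recl big_ord1; congr (_ + F _).
exact: val_inj.
Qed.

(** The increment is split along the two coordinate directions, and the mean value
    theorem is applied to each part. *)
Lemma C1_differentiable (f : 'rV[R]_2 -> R) (x : 'rV[R]_2) :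
  (\forall y \near x, forall i : 'I_2, derivable f y (delta_mx 0 i)) ->
  (forall i, {for x, continuous (partial i f)}) -> differentiable f x.
Proof.
move=> df cf.
apply: (proj1 (@differentiable_epsP _ _ f x (lin_form (fun i => partial i f x)) _)) => e e0.
have e20 : 0 < e / 2 by rewrite divr_gt0.
have cf' : \forall y \near x, forall i, `|partial i f x - partial i f y| < e / 2.
  have H i : \forall y \near x, `|partial i f x - partial i f y| < e / 2.
    by move/cvgrPdist_lt: (cf i); exact.
  by apply: filterS2 (H 0) (H 1) => y H0 H1 i; case: (ordI2 i) => ->.
have [r /= r0 Hr] := (nbhs_ballP _ _).1 (@filterI _ _ _ _ _ df cf').
apply/nbhs_ballP; exists r => //= y; rewrite -ball_normE /= => xy.
have dy i : `|(y - x) 0 i| < r.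
  by rewrite (le_lt_trans (coord_le_norm _ _))// distrC.
have inB (z : 'rV[R]_2) : `|z 0 0 - x 0 0| <= `|(y - x) 0 0| ->
    `|z 0 1 - x 0 1| <= `|(y - x) 0 1| ->
    (forall i, derivable f z (delta_mx 0 i)) /\
    (forall i, `|partial i f x - partial i f z| < e / 2).
  move=> z0 z1; apply: Hr; rewrite -ball_normE /= distrC; apply: norm2_lt => //.
    by rewrite !mxE (le_lt_trans z0).
  by rewrite !mxE (le_lt_trans z1).
pose m := pt (x 0 0) (y 0 1).
have cle (c t : R) : 0 <= c <= 1 -> `|c * t| <= `|t|.
  move=> /andP[c0 c1]; rewrite normrM ler_piMl//.
  by rewrite ger0_norm.
have [|c1 c1I E1] := @MVT_coord _ f x (y 0 1 - x 0 1) 1.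
  move=> s sI; apply: (inB _ _ _).1.
    by rewrite !mxE/= mulr0 addr0 subrr normr0.
  by rewrite !mxE/= mulr1 addrAC subrr add0r cle.
have [|c2 c2I E2] := @MVT_coord _ f m (y 0 0 - x 0 0) 0.
  move=> s sI; apply: (inB _ _ _).1.
    by rewrite !mxE/= mulr1 addrAC subrr add0r cle.
  by rewrite !mxE/= mulr0 addr0.
have mE : x + (y 0 1 - x 0 1) *: delta_mx 0 1 = m.
  by apply: rV2P; rewrite !mxE/= ?mulr0 ?addr0// mulr1 addrC subrK.
have yE : m + (y 0 0 - x 0 0) *: delta_mx 0 0 = y.
  by apply: rV2P; rewrite !mxE/= ?mulr0 ?addr0// mulr1 addrC subrK.
rewrite mE in E1; rewrite yE in E2.
set z1 := x + _ in E1; set z2 := m + _ in E2.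
have [||_ /(_ 1) B1] := inB z1.
    by rewrite !mxE/= mulr0 addr0 subrr normr0.
  by rewrite !mxE/= mulr1 addrAC subrr add0r cle.
have [||_ /(_ 0) B2] := inB z2.
    by rewrite !mxE/= mulr1 addrAC subrr add0r cle.
  by rewrite !mxE/= mulr0 addr0.
have -> : f y - f x = (f y - f m) + (f m - f x) by rewrite subrKA.
rewrite E1 E2 /= /lin_form sumI2.
have -> : (y 0 0 - x 0 0) * partial 0 f z2 + (y 0 1 - x 0 1) * partial 1 f z1 -
  ((y - x) 0 0 * partial 0 f x + (y - x) 0 1 * partial 1 f x) =
  - ((y - x) 0 0 * (partial 0 f x - partial 0 f z2)) -
  ((y - x) 0 1 * (partial 1 f x - partial 1 f z1)) by rewrite !mxE; ring.
apply: le_trans (ler_normB _ _) _; rewrite normrN !normrM.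
have -> : e * `|y - x| = `|y - x| * (e / 2) + `|y - x| * (e / 2).
  by rewrite -mulrDr -splitr mulrC.
by apply: lerD; apply: ler_pM => //; (try exact: coord_le_norm); exact: ltW.
Qed.

(** The mean value theorem is applied to the difference in the direction j, and then
    to a partial derivative. The left hand side is symmetric in i and j and the
    right hand side is not, which is the content of Schwarz's theorem. *)
Lemma second_difference n (f : 'rV[R]_n -> R) (x : 'rV[R]_n) (i j : 'I_n) (s : R) :
  (forall a b : R, 0 <= a <= 1 -> 0 <= b <= 1 ->
     differentiable f (x + (a * s) *: delta_mx 0 i + (b * s) *: delta_mx 0 j) /\
     differentiable (partial i f)
       (x + (a * s) *: delta_mx 0 i + (b * s) *: delta_mx 0 j)) ->
  exists a b : R, [/\ 0 <= a <= 1, 0 <= b <= 1 &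
    f (x + s *: delta_mx 0 i + s *: delta_mx 0 j) - f (x + s *: delta_mx 0 i) -
    f (x + s *: delta_mx 0 j) + f x =
    s * (s * partial j (partial i f)
      (x + (a * s) *: delta_mx 0 i + (b * s) *: delta_mx 0 j))].
Proof.
move=> df.
pose g y := f (y + s *: delta_mx 0 j) - f y.
have I0 : ((0 : R) <= 0) && ((0 : R) <= 1) by rewrite lexx ler01.
have I1 : ((0 : R) <= 1) && ((1 : R) <= 1) by rewrite lexx ler01.
have dg a : 0 <= a <= 1 ->
  is_derive (x + (a * s) *: delta_mx 0 i) (delta_mx 0 i) g
   (partial i f (x + (a * s) *: delta_mx 0 i + s *: delta_mx 0 j) -
    partial i f (x + (a * s) *: delta_mx 0 i)).
  move=> aI; apply: is_deriveB; last first.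
    apply/derivableP/diff_derivable.
    by have [+ _] := df a 0 aI I0; rewrite mul0r scale0r addr0.
  have d1 : differentiable f (x + (a * s) *: delta_mx 0 i + s *: delta_mx 0 j).
    by have [+ _] := df a 1 aI I1; rewrite mul1r.
  have d2 : derivable f (x + (a * s) *: delta_mx 0 i + s *: delta_mx 0 j) (delta_mx 0 i).
    exact: diff_derivable.
  have E : (fun h : R => h^-1 *: (((fun y => f (y + s *: delta_mx 0 j)) \o
     shift (x + (a * s) *: delta_mx 0 i)) (h *: delta_mx 0 i) -
     f (x + (a * s) *: delta_mx 0 i + s *: delta_mx 0 j))) =
     (fun h : R => h^-1 *: ((f \o shift (x + (a * s) *: delta_mx 0 i +
       s *: delta_mx 0 j)) (h *: delta_mx 0 i) -
     f (x + (a * s) *: delta_mx 0 i + s *: delta_mx 0 j))).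
    by apply/funext => h /=; rewrite !addrA.
  by split; rewrite /derivable /derive E.
have [|a aI Ea] := @MVT_coord _ g x s i.
  by move=> t /dg ?; exact: ex_derive.
have [|b bI Eb] := @MVT_coord _ (partial i f) (x + (a * s) *: delta_mx 0 i) s j.
  by move=> t tI; apply: diff_derivable; exact: (df a t aI tI).2.
exists a, b; split=> //.
rewrite -Eb; have /= dga := dg a aI.
have -> : f (x + s *: delta_mx 0 i + s *: delta_mx 0 j) - f (x + s *: delta_mx 0 i) -
    f (x + s *: delta_mx 0 j) + f x = g (x + s *: delta_mx 0 i) - g x.
  by rewrite /g opprB addrA addrAC.
by rewrite Ea partialE derive_val.
Qed.

Lemma Schwarz n (V : set 'rV[R]_n) (f : 'rV[R]_n -> R) (i j : 'I_n) (x : 'rV[R]_n) : open V ->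
  Ck 2 V f -> V x -> partial i (partial j f) x = partial j (partial i f) x.
Proof.
move=> oV [df Hf] Vx; apply/eqP; rewrite -subr_eq0 -normr_eq0; apply/eqP.
apply/eqP; rewrite eq_le normr_ge0 andbT; apply/ler_addgt0Pr => e e0.
rewrite add0r.
have e20 : 0 < e / 2 by rewrite divr_gt0.
have cf k l : \forall y \near x,
    `|partial k (partial l f) x - partial k (partial l f) y| < e / 2.
  have : {for x, continuous (partial k (partial l f))}.
    exact: ((Hf l).2 k) x Vx.
  by move/cvgrPdist_lt; exact.
have nV : \forall y \near x, V y by exact: open_nbhs_nbhs.
have nW : \forall y \near x, V y /\ (`|partial i (partial j f) x - partial i (partial j f) y| < e / 2 /\
    `|partial j (partial i f) x - partial j (partial i f) y| < e / 2).
  by apply: filterI => //; apply: filterI; exact: cf.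
have [r /= r0 Hr] := (nbhs_ballP _ _).1 nW.
have [s s0 sr] : exists2 s, 0 < s & s + s < r.
  by exists (r / 3); [rewrite divr_gt0|lra].
have inB k l a b : 0 <= a <= 1 -> 0 <= b <= 1 ->
  ball x r (x + (a * s) *: delta_mx 0 k + (b * s) *: delta_mx 0 l).
  move=> /andP[a0 a1] /andP[b0 b1]; rewrite -ball_normE /= -addrA opprD addNKr.
  rewrite normrN; apply: le_lt_trans (ler_normD _ _) _.
  have nd (m : 'I_n) : `|delta_mx 0 m : 'rV[R]_n| <= 1.
    by apply/norm_rV_le => // l'; rewrite mxE/= normr_nat lern1 leq_b1.
  have sc c (m : 'I_n) : 0 <= c -> c <= 1 -> `|(c * s) *: (delta_mx 0 m : 'rV[R]_n)| <= s.
    move=> c0 c1; have cs0 : 0 <= c * s by rewrite mulr_ge0// ltW.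
    rewrite normrZ (ger0_norm cs0) -[leRHS]mulr1; apply: ler_pM => //.
    by rewrite ler_piMl// ltW.
  by rewrite (le_lt_trans (lerD (sc _ _ a0 a1) (sc _ _ b0 b1))).
have dP k l a b : 0 <= a <= 1 -> 0 <= b <= 1 ->
     differentiable f (x + (a * s) *: delta_mx 0 k + (b * s) *: delta_mx 0 l) /\
     differentiable (partial k f)
       (x + (a * s) *: delta_mx 0 k + (b * s) *: delta_mx 0 l).
  move=> aI bI; have [VB _] := Hr _ (inB k l a b aI bI).
  by split; [exact: df|exact: (Hf k).1].
have [a [b [aI bI E1]]] := second_difference (dP i j).
have [c [d [cI dI E2]]] := second_difference (dP j i).
have [_ [_ B1]] := Hr _ (inB i j a b aI bI).
have [_ [B2 _]] := Hr _ (inB j i c d cI dI).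
have E : partial j (partial i f) (x + (a * s) *: delta_mx 0 i + (b * s) *: delta_mx 0 j) =
  partial i (partial j f) (x + (c * s) *: delta_mx 0 j + (d * s) *: delta_mx 0 i).
  have s0' : s != 0 by rewrite gt_eqF.
  have : s * (s * partial j (partial i f)
      (x + (a * s) *: delta_mx 0 i + (b * s) *: delta_mx 0 j)) =
    s * (s * partial i (partial j f)
      (x + (c * s) *: delta_mx 0 j + (d * s) *: delta_mx 0 i)).
    apply: (etrans (esym E1)); apply: etrans E2.
    move: (s *: delta_mx 0 i) (s *: delta_mx 0 j) => u v.
    by rewrite (addrAC x v u) [in RHS](addrAC (f _)).
  by move=> /(mulfI s0') /(mulfI s0').
rewrite E in B1; set z := partial i (partial j f) (_ + _) in B1 B2.
move: z B1 B2 => z; move: (partial i _ x) (partial j _ x) => A B B1 B2.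
rewrite (splitr e) -(subrKA z); apply: le_trans (ler_normD _ _) _.
by apply: lerD; [exact: ltW|rewrite distrC ltW].
Qed.

End C1.

Section Smooth.
Variable R : realType.
Implicit Types V : set (plane R).

Lemma smooth_on_pderiv (W : normedModType R) V (f : plane R -> W) i :
  smooth_on V f -> smooth_on V (pderiv i f).
Proof.
by move=> sf s x Vx; have := sf (rcons s i) x Vx; rewrite foldr_rcons.
Qed.

(** If all iterated partial derivatives are continuous, each of them is
    differentiable by [C1_differentiable]; so iterated partial derivatives define
    the same class as the induction on k. *)
Lemma smooth_onP V (f : plane R -> R) : open V ->
  smooth_on V f <-> forall k, Ck k V f.
Proof.
move=> oV; split=> [sf k|Cf].
  elim: k f sf => [|k IH] f sf /=; first by move=> x Vx; exact: (sf [::] x Vx).1.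
  split=> [x Vx|i]; last by apply: IH; rewrite -pderivE; exact: smooth_on_pderiv.
  apply: C1_differentiable; last first.
    by move=> i; rewrite -pderivE; exact: (smooth_on_pderiv i sf [::] Vx).1.
  have : \forall y \near x, V y by exact: open_nbhs_nbhs.
  by apply: filterS => y Vy i; exact: (sf [::] y Vy).2.
suff H s k : Ck k V (foldr (@pderiv R R) f s).
  by move=> s x Vx; split=> [|i]; [exact: (H s 0)|apply: diff_derivable; exact: (H s 1).1].
by elim: s k => [|i s IH] k //=; rewrite pderivE; exact: (IH k.+1).2.
Qed.

Lemma smooth_on_near (W : normedModType R) V (f g : plane R -> W) x : open V ->
  (forall x, V x -> f x = g x) -> V x -> \near x, f x = g x.
Proof.
move=> oV fg Vx; have : \forall y \near x, V y by exact: open_nbhs_nbhs.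
by apply: filterS => y /fg.
Qed.

Lemma mx_continuous (T : topologicalType) m n (F : T -> 'M[R]_(m, n)) x :
  (forall i j, {for x, continuous (fun y => F y i j)}) -> {for x, continuous F}.
Proof.
move=> Fc; apply/cvgrPdist_lt => e e0; near=> y.
rewrite /Num.Def.normr/= mx_normrE; apply: bigmax_lt => // -[i j] _ /=.
rewrite !mxE; move: i j; near: y.
apply: filter_forall => i; apply: filter_forall => j.
by move/cvgrPdist_lt: (Fc i j); exact.
Unshelve. all: by end_near. Qed.

Section Matrix.
Variables m n : nat.

Lemma foldr_pderiv_mx V (F : plane R -> 'M[R]_(m, n)) s k j : open V ->
  (forall t x i, (size t < size s)%N -> V x ->
     derivable (foldr (@pderiv R _) F t) x (delta_mx 0 i)) ->
  forall x, V x -> foldr (@pderiv R _) F s x k j =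
    foldr (@pderiv R _) (fun x => F x k j) s x.
Proof.
move=> oV; elim: s => [|i s IH] //= dF x Vx.
have IH' := IH (fun t x i ts => dF t x i (ltn_trans ts (ltnSn _))).
rewrite {1}/pderiv derive_mx; last exact: dF.
rewrite mxE; apply: near_eq_derive.
exact: (smooth_on_near oV IH').
Qed.

Lemma smooth_on_mxP V (F : plane R -> 'M[R]_(m, n)) : open V ->
  smooth_on V F <-> forall k j, smooth_on V (fun x => F x k j).
Proof.
move=> oV; split=> [sF k j s x Vx|sF].
  have E t y : V y -> foldr (@pderiv R _) F t y k j =
      foldr (@pderiv R _) (fun x => F x k j) t y.
    by move=> Vy; apply: (foldr_pderiv_mx k j oV) => // u z i _ Vz; exact: (sF u z Vz).2.
  have N := smooth_on_near oV (E s) Vx.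
  have [cF dF] := sF s x Vx; split.
    apply: near_eq_continuous N _.
    apply: (@continuous_comp _ _ _ _ (fun M : 'M[R]_(m, n) => M k j)); first exact: cF.
    exact: coord_continuous.
  move=> i; apply: near_eq_derivable N _.
  by have /derivable_mxP/(_ k j) := dF i.
have sd t x i k j : V x ->
    derivable (foldr (@pderiv R _) (fun x => F x k j) t) x (delta_mx 0 i).
  by move=> Vx; exact: (sF k j t x Vx).2.
have dF l : forall t x i, (size t < l)%N -> V x ->
     derivable (foldr (@pderiv R _) F t) x (delta_mx 0 i).
  elim: l => // l IH t x i tn Vx; apply/derivable_mxP => a j.
  apply: near_eq_derivable (sd t x i a j Vx).
  apply: (smooth_on_near oV _ Vx) => y Vy; apply/esym.
  apply: (foldr_pderiv_mx a j oV) => // u z i' ut Vz.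
  by apply: IH => //; apply: leq_trans ut _.
have E s x k j : V x -> foldr (@pderiv R _) F s x k j =
    foldr (@pderiv R _) (fun x => F x k j) s x.
  by move=> Vx; apply: (foldr_pderiv_mx k j oV) => // t y i ts Vy; exact: dF ts Vy.
move=> s x Vx; split=> [|i]; last exact: (dF (size s).+1).
apply: mx_continuous => k j; apply: near_eq_continuous (sF k j s x Vx).1.
by apply: (smooth_on_near oV _ Vx) => y Vy; rewrite E.
Qed.

End Matrix.

Lemma smooth_on_coordP V (F : plane R -> plane R) : open V ->
  smooth_on V F <-> forall j, smooth_on V (fun x => F x 0 j).
Proof.
move=> oV; split=> [/(smooth_on_mxP _ oV) sF j|sF]; first exact: sF.
by apply/(smooth_on_mxP _ oV) => k j; rewrite (ord1 k).
Qed.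

End Smooth.
Global Opaque smooth_on.

(** * Uniform estimates on segments *)

Section Tube.
Variable R : realType.

(** Compactness of the path makes the continuity of h along it uniform in a tube
    around it. *)
Lemma tube_path n (W : set 'rV[R]_n) (h : 'rV[R]_n -> R) (c : R -> 'rV[R]_n)
    (a b e : R) : open W ->
  (forall t, a <= t <= b -> W (c t) /\ {for t, continuous c}) ->
  (forall x, W x -> {for x, continuous h}) -> 0 < e ->
  exists2 d, 0 < d & forall t y, a <= t <= b -> `|y - c t| < d ->
    W y /\ `|h y - h (c t)| < e.
Proof.
move=> oW Wc ch e0.
have /compact_near_coveringP K : compact `[a, b] by exact: segment_compact.
have H := K _ (nbhs (0 : R)) (fun d t => forall y, `|y - c t| < `|d| ->
    W y /\ `|h y - h (c t)| < e).
have /(nbhs_ballP _ _).1 [r /= r0 Hr] : \forall d \near (0 : R), `[a, b] `<=` (fun t =>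
    forall y, `|y - c t| < `|d| -> W y /\ `|h y - h (c t)| < e).
  apply: H => t; rewrite /= in_itv /= => tI.
  have [Wt ct] := Wc t tI.
  have : \forall y \near c t, W y /\ `|h (c t) - h y| < e / 2.
    apply: filterI; first exact: open_nbhs_nbhs.
    by move/cvgrPdist_lt: (ch _ Wt); apply; rewrite divr_gt0.
  move=> /(nbhs_ballP _ _).1 [r /= r0 Hr].
  have r20 : 0 < r / 2 by rewrite divr_gt0.
  have nt : \forall t' \near t, `|c t - c t'| < r / 2.
    by move/cvgrPdist_lt: ct; exact.
  have nd : \forall d \near (0 : R), `|d| < r / 2.
    apply/nbhs_ballP; exists (r / 2) => //= d.
    by rewrite -ball_normE /= sub0r normrN.
  exists ([set t' | `|c t - c t'| < r / 2], [set d : R | `|d| < r / 2]) => //.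
  move=> [t' d] /= [ct' dr] y yd.
  have B1 : ball (c t) r (c t').
    by rewrite -ball_normE /= (lt_trans ct')//; lra.
  have B2 : ball (c t) r y.
    rewrite -ball_normE /= -(subrKA (c t')) (splitr r).
    apply: le_lt_trans (ler_normD _ _) _; rewrite ltrD//.
    by rewrite distrC (lt_trans yd).
  have [W1 h1] := Hr _ B1; have [W2 h2] := Hr _ B2.
  split=> //; rewrite (splitr e) -(subrKA (h (c t))).
  by apply: le_lt_trans (ler_normD _ _) _; rewrite ltrD// distrC.
exists (r / 2); first by rewrite divr_gt0.
move=> t y tI yd; apply: (Hr (r / 2)).
- by rewrite -ball_normE /= sub0r normrN gtr0_norm; [lra|rewrite divr_gt0].
- by rewrite /= in_itv.
- by rewrite [`|r / 2|]gtr0_norm// divr_gt0.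
Qed.

Lemma pt_continuous1 s (t : R) : {for t, continuous (pt s : R -> 'rV[R]_2)}.
Proof.
apply: row_continuous => j; case: (j == 0); first exact: cst_continuous.
exact: cvg_id.
Qed.

Lemma tube (V : set (plane R)) (h : plane R -> R) (s a b e : R) : open V ->
  (forall t, a <= t <= b -> V (pt s t)) ->
  (forall x, V x -> {for x, continuous h}) -> 0 < e ->
  \forall s' \near s, forall t, a <= t <= b ->
    V (pt s' t) /\ `|h (pt s' t) - h (pt s t)| < e.
Proof.
move=> oV Vab ch e0.
have path t : a <= t <= b -> V (pt s t) /\ {for t, continuous (pt s : R -> 'rV[R]_2)}.
  by move=> tI; split; [exact: Vab|exact: pt_continuous1].
have [d d0 Hd] := tube_path oV path ch e0.
apply/nbhs_ballP; exists d => //= s'; rewrite -ball_normE /= => sd t tI.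
apply: Hd => //; apply: norm2_lt => //; rewrite !mxE /=; first by rewrite distrC.
by rewrite subrr normr0.
Qed.

(** On an interval so short that d L <= 1/2 Gronwall's estimate needs no
    exponential: at a maximum of |e| the mean value theorem gives |e| <= d (L |e| +
    eta), and half of |e| is absorbed on the left. *)
Lemma short_gronwall (e de : R -> R) (t0 d L eta : R) :
  0 <= d -> 0 <= L -> d * L <= 2^-1 -> 0 <= eta -> e t0 = 0 ->
  (forall t, `|t - t0| <= d -> is_derive t 1 e (de t)) ->
  (forall t, `|t - t0| <= d -> `|de t| <= L * `|e t| + eta) ->
  forall t, `|t - t0| <= d -> `|e t| <= 2 * d * eta.
Proof.
move=> d0 L0 dL eta0 et0 He Hde.
have I t : (`|t - t0| <= d) = (t \in `[t0 - d, t0 + d]).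
  by rewrite in_itv /= ler_distl.
have ce0 : {within `[t0 - d, t0 + d], continuous e}.
  by apply: derivable_within_continuous => t; rewrite -I => /He [].
have ce : {within `[t0 - d, t0 + d], continuous (fun t => `|e t|)}.
  move=> t; apply: (@continuous_comp _ _ _ (e : subspace _ -> R) Num.norm); first exact: ce0.
  exact: norm_continuous.
have [|c cI cM] := @EVT_max R (fun t => `|e t|) (t0 - d) (t0 + d) _ ce.
  by rewrite lerD2l; lra.
have cd : `|c - t0| <= d by rewrite I.
have bound t : `|t - t0| <= d -> `|e t| <= d * (L * `|e c| + eta).
  move=> td.
  have sub a b x : `|a - t0| <= d -> `|b - t0| <= d -> a <= x <= b -> `|x - t0| <= d.
    by rewrite !ler_norml => /andP[? ?] /andP[? ?] /andP[? ?]; apply/andP; split; lra.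
  have mvt a b : `|a - t0| <= d -> `|b - t0| <= d -> a <= b ->
      exists2 x, `|x - t0| <= d & e b - e a = de x * (b - a).
    move=> aI bI ab; have [|||x xI Ex] := @MVT_segment _ e de a b => //.
    - move=> x; rewrite in_itv /= => /andP[? ?]; apply: He.
      by apply: (sub a b) => //; rewrite !ltW.
    - apply: derivable_within_continuous => x; rewrite in_itv /= => xI.
      by have [] := He x (sub a b x aI bI xI).
    - by exists x => //; apply: (sub a b) => //; move: xI; rewrite in_itv.
  have t0d : `|t0 - t0| <= d by rewrite subrr normr0.
  have [x xd ->] : exists2 x, `|x - t0| <= d & `|e t| = `|de x| * `|t - t0|.
    have [tt|tt] := leP t0 t.
      have [x xd Ex] := mvt _ _ t0d td tt.
      by exists x => //; rewrite -normrM -Ex et0 subr0.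
    have [x xd Ex] := mvt _ _ td t0d (ltW tt).
    by exists x => //; rewrite (distrC t) -normrM -Ex et0 sub0r normrN.
  rewrite mulrC; apply: ler_pM => //.
  apply: le_trans (Hde x xd) _; rewrite lerD2r ler_wpM2l// cM// -I.
  done.
have Mb := bound c cd.
have h : `|e c| <= 2 * d * eta by have := normr_ge0 (e c); nra.
by move=> t td; apply: le_trans h; apply: cM; rewrite -I.
Qed.

End Tube.

(** * Smooth functions and vector fields *)

Section Cinf.
Variable R : realType.

Definition Cinf n (V : set 'rV[R]_n) (f : 'rV[R]_n -> R) := forall k, Ck k V f.

(** Differentiability comes with the value of the derivative, so that derivatives of
    compound expressions are found by proof search. *)
Definition has_partial n (i : 'I_n) (f : 'rV[R]_n -> R) x a :=
  differentiable f x /\ partial i f x = a.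

Section General.
Variables (n : nat) (V : set 'rV[R]_n).
Hypothesis oV : open V.
Implicit Types f g : 'rV[R]_n -> R.

Lemma Cinf_diff f x : Cinf V f -> V x -> differentiable f x.
Proof. by move=> /(_ 1) [H _]; exact: H. Qed.

Lemma Cinf_cont f x : Cinf V f -> V x -> {for x, continuous f}.
Proof. by move=> /(_ 0); exact. Qed.

Lemma Cinf_partial i f : Cinf V f -> Cinf V (partial i f).
Proof. by move=> H k; exact: (H k.+1).2. Qed.

Lemma CinfD f g : Cinf V f -> Cinf V g -> Cinf V (fun x => f x + g x).
Proof. by move=> Cf Cg k; exact: CkD. Qed.

Lemma CinfM f g : Cinf V f -> Cinf V g -> Cinf V (fun x => f x * g x).
Proof. by move=> Cf Cg k; exact: CkM. Qed.

Lemma CinfN f : Cinf V f -> Cinf V (fun x => - f x).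
Proof. by move=> Cf k; exact: CkN. Qed.

Lemma Cinf_cst a : Cinf V (fun=> a).
Proof. by move=> k; exact: Ck_cst. Qed.

Lemma Cinf_coord j : Cinf V (fun x => x 0 j).
Proof. by move=> k; exact: Ck_coord. Qed.

Lemma CinfV f : (forall x, V x -> f x != 0) -> Cinf V f ->
  Cinf V (fun x => (f x)^-1).
Proof. by move=> f0 Cf k; exact: CkV. Qed.

Lemma Cinf_ext f g : (forall x, V x -> f x = g x) -> Cinf V f -> Cinf V g.
Proof. by move=> fg Cf k; exact: Ck_ext fg (Cf k). Qed.

Lemma Cinf_sub (W : set 'rV[R]_n) f : W `<=` V -> Cinf V f -> Cinf W f.
Proof. by move=> WV Cf k; exact: Ck_sub WV (Cf k). Qed.

Lemma eq_partial i f g x : (forall x, V x -> f x = g x) -> V x ->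
  partial i f x = partial i g x.
Proof. by move=> fg Vx; apply: near_eq_partial; exact: open_near_eq Vx. Qed.

Lemma hp_eq f x i a b : has_partial i f x a -> a = b -> partial i f x = b.
Proof. by move=> [_ <-]. Qed.

Lemma hpC f x i : Cinf V f -> V x -> has_partial i f x (partial i f x).
Proof. by move=> Cf Vx; split=> //; exact: Cinf_diff Vx. Qed.

Lemma hpD f g x i a b : has_partial i f x a -> has_partial i g x b ->
  has_partial i (fun y => f y + g y) x (a + b).
Proof.
move=> [df <-] [dg <-]; split; first exact: differentiableD.
by rewrite partialD.
Qed.

Lemma hpN f x i a : has_partial i f x a -> has_partial i (fun y => - f y) x (- a).
Proof.
move=> [df <-]; split; first exact: differentiableN.
by rewrite partialN.
Qed.

Lemma hpM f g x i a b : has_partial i f x a -> has_partial i g x b ->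
  has_partial i (fun y => f y * g y) x (f x * b + g x * a).
Proof.
move=> [df <-] [dg <-]; split; first exact: differentiableM.
by rewrite partialM.
Qed.

Lemma hp_cst (x : 'rV[R]_n) i (a : R) : has_partial i (fun=> a) x 0.
Proof.
split; first exact: differentiable_cst.
by rewrite partialE derive_cst.
Qed.

End General.

End Cinf.

(** The hypotheses applied are those of the form: every member of a family is
    smooth. *)
Ltac solve_Cinf := repeat first
  [ assumption | match goal with H : forall _, _ |- _ => apply H end
  | eapply CinfD | eapply CinfM | eapply CinfN | eapply Cinf_partial
  | eapply Cinf_cst | eapply Cinf_coord ].

Ltac solve_partial := repeat first
  [ apply: hpD | apply: hpM | apply: hpN
  | apply: hp_cst
  | match goal with H : ?V ?x |- has_partial _ _ ?x _ =>
      refine (hpC (V := V) _ _ H); [solve_Cinf] end ].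

(** Comparing atoms such as derivatives up to conversion is expensive; they become
    variables before [ring] is called. *)
Ltac abstract_atoms := try unfold plane; cbv beta;
  repeat match goal with |- context [@partial ?R ?n ?i ?f ?x] =>
    generalize (@partial R n i f x) end;
  repeat match goal with |- context [@christoffel ?R ?n ?i ?j ?k ?x] =>
    generalize (@christoffel R n i j k x) end;
  repeat match goal with |- context [@ricci ?R ?n ?i ?j ?k] =>
    generalize (@ricci R n i j k) end;
  repeat match goal with |- context [@derive ?R ?V ?W ?n ?i ?j] =>
    generalize (@derive R V W n i j) end;
  repeat match goal with |- context [@fun_of_matrix ?R ?m ?n ?M ?i ?j] =>
    generalize (@fun_of_matrix R m n M i j) end.

Ltac abstract_ring := abstract_atoms; intros; ring.

Section Rows.
Variable R : realType.
Implicit Types u v : plane R.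
Lemma rowD u v j : (u + v) 0 j = u 0 j + v 0 j. Proof. by rewrite mxE. Qed.
Lemma rowN u j : (- u) 0 j = - u 0 j. Proof. by rewrite mxE. Qed.
Lemma rowB u v j : (u - v) 0 j = u 0 j - v 0 j. Proof. by rewrite !mxE. Qed.
Lemma rowZ a u j : (a *: u) 0 j = a * u 0 j. Proof. by rewrite mxE. Qed.
Lemma vec0 j : (0 : plane R) 0 j = 0. Proof. by rewrite mxE. Qed.
Lemma e00 : (delta_mx 0 0 : plane R) 0 0 = 1. Proof. by rewrite mxE. Qed.
Lemma e01 : (delta_mx 0 0 : plane R) 0 1 = 0. Proof. by rewrite mxE. Qed.
Lemma e10 : (delta_mx 0 1 : plane R) 0 0 = 0. Proof. by rewrite mxE. Qed.
Lemma e11 : (delta_mx 0 1 : plane R) 0 1 = 1. Proof. by rewrite mxE. Qed.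
Definition eE := (e00, e01, e10, e11).
Definition rowE := (rowD, rowB, rowN, rowZ, vec0).
End Rows.

(* Entries of basis vectors are rewritten, never computed by conversion. *)
Global Opaque delta_mx.

Section Fields.
Variables (R : realType) (V : set (plane R)).
Hypothesis oV : open V.

Lemma smooth_Cinf (f : plane R -> R) : smooth_on V f <-> Cinf V f.
Proof. exact: smooth_onP. Qed.

Lemma field_Cinf (X : vfield R) j : smooth_on V X -> Cinf V (fun x => X x 0 j).
Proof. by move=> /(smooth_on_coordP _ oV)/(_ j)/smooth_Cinf. Qed.

Lemma Cinf_field (X : vfield R) : (forall j, Cinf V (fun x => X x 0 j)) ->
  smooth_on V X.
Proof. by move=> H; apply/(smooth_on_coordP _ oV) => j; apply/smooth_Cinf. Qed.

Lemma smooth_cst (v : plane R) : smooth_on V (cst v).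
Proof. by apply: Cinf_field => j; exact: Cinf_cst. Qed.

Lemma smooth_coord_field i : smooth_on V (@coord_field R i).
Proof. exact: smooth_cst. Qed.

Lemma smooth_scale (f : plane R -> R) (X : vfield R) : Cinf V f -> smooth_on V X ->
  smooth_on V (fun y => f y *: X y).
Proof.
move=> Cf sX; apply: Cinf_field => j; have := field_Cinf j sX => CX.
by apply: (Cinf_ext oV _ (CinfM oV Cf CX)) => x _; rewrite mxE.
Qed.

Lemma smooth_add (X Y : vfield R) : smooth_on V X -> smooth_on V Y ->
  smooth_on V (fun y => X y + Y y).
Proof.
move=> sX sY; apply: Cinf_field => j.
apply: (Cinf_ext oV _ (CinfD oV (field_Cinf j sX) (field_Cinf j sY))) => x _.
by rewrite mxE.
Qed.

Lemma smooth_ext (X Y : vfield R) : (forall x, V x -> X x = Y x) ->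
  smooth_on V X -> smooth_on V Y.
Proof.
move=> XY sX; apply: Cinf_field => j.
by apply: (Cinf_ext oV _ (field_Cinf j sX)) => x /XY ->.
Qed.

Lemma field_diff (X : vfield R) x : smooth_on V X -> V x -> differentiable X x.
Proof.
by move=> sX Vx; apply: differentiable_row => j; exact: (Cinf_diff (field_Cinf j sX) Vx).
Qed.

Lemma deriv2E (f : plane R -> R) (x v : plane R) : differentiable f x ->
  'D_v f x = v 0 0 * partial 0 f x + v 0 1 * partial 1 f x.
Proof. by move=> df; rewrite deriv_partial// sumI2. Qed.

Lemma deriv_coord (X : vfield R) (x v : plane R) k : differentiable X x ->
  ('D_v X x : plane R) 0 k = 'D_v (fun y => X y 0 k) x.
Proof. by move=> dX; rewrite derive_mx ?mxE//; exact: diff_derivable. Qed.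

Lemma deriv_field (X : vfield R) (x v : plane R) k : smooth_on V X -> V x ->
  ('D_v X x : plane R) 0 k = v 0 0 * partial 0 (fun y => X y 0 k) x +
    v 0 1 * partial 1 (fun y => X y 0 k) x.
Proof.
move=> sX Vx; rewrite deriv_coord; last exact: field_diff.
by rewrite deriv2E//; exact: (Cinf_diff (field_Cinf k sX) Vx).
Qed.

End Fields.

Section Unfold.
Variables (R : realType) (nab : vfield R -> vfield R -> vfield R).

Lemma lie_bracket_def (X Y : vfield R) x :
  lie_bracket X Y x = 'D_(X x) Y x - 'D_(Y x) X x.
Proof. by []. Qed.

Lemma curvature_def X Y Z x : curvature nab X Y Z x =
  nab X (nab Y Z) x - nab Y (nab X Z) x - nab (lie_bracket X Y) Z x.
Proof. by []. Qed.

Lemma nabla_curvature_def W X Y Z x : nabla_curvature nab W X Y Z x =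
  nab W (curvature nab X Y Z) x - curvature nab (nab W X) Y Z x
  - curvature nab X (nab W Y) Z x - curvature nab X Y (nab W Z) x.
Proof. by []. Qed.

Lemma ricci_def Y Z x : ricci nab Y Z x =
  curvature nab (cst (delta_mx 0 0)) Y Z x 0 0 +
  curvature nab (cst (delta_mx 0 1)) Y Z x 0 1.
Proof. by rewrite /ricci /mxtrace sumI2 [in X in X + _]mxE [in X in _ + X]mxE. Qed.

Lemma nabla_ricci_def W Y Z x : nabla_ricci nab W Y Z x =
  'D_(W x) (ricci nab Y Z) x - ricci nab (nab W Y) Z x - ricci nab Y (nab W Z) x.
Proof. by []. Qed.

Lemma christoffel_def i j k x : christoffel nab i j k x =
  nab (coord_field i) (coord_field j) x 0 k.
Proof. by []. Qed.

Lemma szabo_tr_def x v : \tr (szabo_mx nab x v) =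
  nabla_curvature nab (cst v) (cst (delta_mx 0 0)) (cst v) (cst v) x 0 0 +
  nabla_curvature nab (cst v) (cst (delta_mx 0 1)) (cst v) (cst v) x 0 1.
Proof. by rewrite /szabo_mx /mxtrace sumI2 [in X in X + _]mxE [in X in _ + X]mxE. Qed.

Lemma szabo_mx_def x v i j : szabo_mx nab x v i j =
  nabla_curvature nab (cst v) (cst (delta_mx 0 i)) (cst v) (cst v) x 0 j.
Proof. by rewrite /szabo_mx [LHS]mxE. Qed.

End Unfold.

(* Tensors are handled through the equations above only: unfolding them makes
   conversion explode. *)
Global Opaque lie_bracket curvature nabla_curvature ricci nabla_ricci christoffel szabo_mx.

(** * Curvature of a torsion-free connection in coordinates *)

Section Connection.
Variables (R : realType) (V : set (plane R)) (nab : vfield R -> vfield R -> vfield R).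
Hypotheses (oV : open V) (Hn : is_connection V nab).
Local Notation G := (christoffel nab).
Local Notation e_ := (@coord_field R).
Local Notation smooth X := (smooth_on V (X : vfield R)).

Lemma G_Cinf i j k : Cinf V (G i j k).
Proof.
apply: (field_Cinf oV); apply: (connection_smooth Hn); exact: smooth_coord_field.
Qed.

(** The linearity axiom with the zero field added; that the derivative along the
    zero field vanishes is the same axiom with the factor -1. *)
Lemma nab_scalel (f : plane R -> R) X Y x : Cinf V f -> smooth X -> smooth Y ->
  V x -> nab (fun y => f y *: X y) Y x = f x *: nab X Y x.
Proof.
move=> Cf sX sY Vx; have s0 : smooth (cst 0) by exact: smooth_cst.
have Z : nab (cst 0) Y x = 0.
  have s1 : smooth_on V (fun _ : plane R => - 1 : R).
    by apply/(smooth_Cinf oV); exact: Cinf_cst.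
  have := connection_linearl Hn s1 s0 s0 sY Vx.
  rewrite (_ : (fun y : plane R => -1 *: cst 0 y + cst 0 y) = cst 0).
    by rewrite scaleN1r addNr.
  by apply/funext => y; rewrite /cst scaler0 addr0.
have := connection_linearl Hn ((smooth_Cinf oV _).2 Cf) sX s0 sY Vx.
rewrite Z addr0 => <-; congr (nab _ _ _).
by apply/funext => y; rewrite addr0.
Qed.

Lemma nabDl X X' Y x : smooth X -> smooth X' -> smooth Y -> V x ->
  nab (fun y => X y + X' y) Y x = nab X Y x + nab X' Y x.
Proof.
move=> sX sX' sY Vx.
have s1 : smooth_on V (fun _ : plane R => 1 : R).
  by apply/(smooth_Cinf oV); exact: Cinf_cst.
have := connection_linearl Hn s1 sX sX' sY Vx; rewrite scale1r => <-.
by congr (nab _ _ _); apply/funext => y; rewrite scale1r.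
Qed.

Lemma field_decomp (X : vfield R) :
  X = fun y => X y 0 0 *: e_ 0 y + X y 0 1 *: e_ 1 y.
Proof.
apply/funext => y; by rewrite {1}[X y]row_sum_delta sumI2.
Qed.

(** Decomposing both arguments along the coordinate fields shows that the connection
    is local and given by its Christoffel symbols. *)
Lemma nabE X Y x k : smooth X -> smooth Y -> V x ->
  nab X Y x 0 k =
    X x 0 0 * (partial 0 (fun y => Y y 0 k) x + Y x 0 0 * G 0 0 k x + Y x 0 1 * G 0 1 k x) +
    X x 0 1 * (partial 1 (fun y => Y y 0 k) x + Y x 0 0 * G 1 0 k x + Y x 0 1 * G 1 1 k x).
Proof.
move=> sX sY Vx.
have se i : smooth (e_ i) by exact: smooth_coord_field.
have C (Z : vfield R) j : smooth Z -> Cinf V (fun y => Z y 0 j) by exact: field_Cinf.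
have sc (Z : vfield R) i j : smooth Z -> smooth (fun y => Z y 0 j *: e_ i y).
  by move=> sZ; apply: smooth_scale; [exact: oV|exact: C|exact: se].
have L i : nab (e_ i) Y x 0 k =
    partial i (fun y => Y y 0 k) x + Y x 0 0 * G i 0 k x + Y x 0 1 * G i 1 k x.
  have sY0 j : smooth_on V (fun y => Y y 0 j) by apply/(smooth_Cinf oV); exact: C.
  have E : nab (e_ i) Y x = nab (e_ i) (fun y => Y y 0 0 *: e_ 0 y) x +
      nab (e_ i) (fun y => Y y 0 1 *: e_ 1 y) x.
    by rewrite -(connection_addr Hn (se i) (sc Y 0 0 sY) (sc Y 1 1 sY) Vx) -field_decomp.
  rewrite E (connection_leibniz Hn (sY0 0) (se i) (se 0) Vx).
  rewrite (connection_leibniz Hn (sY0 1) (se i) (se 1) Vx) !christoffel_def.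
  rewrite !rowE /coord_field /cst -!partialE.
  by case: (ordI2 k) => ->; rewrite !eE; abstract_ring.
have E : nab X Y x = nab (fun y => X y 0 0 *: e_ 0 y) Y x +
    nab (fun y => X y 0 1 *: e_ 1 y) Y x.
  by rewrite -(nabDl (sc X 0 0 sX) (sc X 1 1 sX) sY Vx) -field_decomp.
rewrite E (nab_scalel (C X 0 sX) (se 0) sY Vx) (nab_scalel (C X 1 sX) (se 1) sY Vx).
by rewrite !rowE !L.
Qed.

Lemma nab_ext X Y X' Y' x : smooth X -> smooth Y ->
  (forall x, V x -> X x = X' x) -> (forall x, V x -> Y x = Y' x) -> V x ->
  nab X Y x = nab X' Y' x.
Proof.
move=> sX sY XX YY Vx; apply/rowP => k.
have sX' := smooth_ext oV XX sX; have sY' := smooth_ext oV YY sY.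
rewrite !nabE// !XX// !YY//.
by rewrite !(eq_partial oV _ (fun x Vx => congr1 (fun v : plane R => v 0 k) (YY x Vx)) Vx).
Qed.

(** The curvature components: R(e_0, e_1) e_k = curv_coef k 0 e_0 + curv_coef k 1
    e_1. *)
Definition curv_coef k l (x : plane R) :=
  partial 0 (G 1 k l) x - partial 1 (G 0 k l) x
  + G 1 k 0 x * G 0 0 l x + G 1 k 1 x * G 0 1 l x
  - G 0 k 0 x * G 1 0 l x - G 0 k 1 x * G 1 1 l x.

Lemma lie_bracketE X Y x l : smooth X -> smooth Y -> V x ->
  lie_bracket X Y x 0 l =
   X x 0 0 * partial 0 (fun y => Y y 0 l) x + X x 0 1 * partial 1 (fun y => Y y 0 l) x
   - (Y x 0 0 * partial 0 (fun y => X y 0 l) x + Y x 0 1 * partial 1 (fun y => X y 0 l) x).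
Proof.
move=> sX sY Vx; rewrite lie_bracket_def; set A := 'D_(X x) Y x; set B := 'D_(Y x) X x.
have -> : (A - B) 0 l = A 0 l - B 0 l by rewrite !mxE.
by rewrite (deriv_field oV)// (deriv_field oV).
Qed.

Lemma smooth_lie X Y : smooth X -> smooth Y -> smooth (lie_bracket X Y).
Proof.
move=> sX sY; have E x : V x -> nab X Y x + (-1) *: nab Y X x = lie_bracket X Y x.
  by move=> Vx; rewrite scaleN1r (connection_torsion_free Hn).
apply: (smooth_ext oV E); apply: smooth_add; first exact: oV.
  exact: (connection_smooth Hn).
by apply: smooth_scale; [exact: oV|exact: Cinf_cst|exact: (connection_smooth Hn)].
Qed.

Lemma partial_nabE X Y x i k : smooth X -> smooth Y -> V x ->
  partial i (fun y => nab X Y y 0 k) x =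
    partial i (fun y => X y 0 0) x *
      (partial 0 (fun y => Y y 0 k) x + Y x 0 0 * G 0 0 k x + Y x 0 1 * G 0 1 k x) +
    X x 0 0 * (partial i (partial 0 (fun y => Y y 0 k)) x +
      partial i (fun y => Y y 0 0) x * G 0 0 k x + Y x 0 0 * partial i (G 0 0 k) x +
      partial i (fun y => Y y 0 1) x * G 0 1 k x + Y x 0 1 * partial i (G 0 1 k) x) +
    partial i (fun y => X y 0 1) x *
      (partial 1 (fun y => Y y 0 k) x + Y x 0 0 * G 1 0 k x + Y x 0 1 * G 1 1 k x) +
    X x 0 1 * (partial i (partial 1 (fun y => Y y 0 k)) x +
      partial i (fun y => Y y 0 0) x * G 1 0 k x + Y x 0 0 * partial i (G 1 0 k) x +
      partial i (fun y => Y y 0 1) x * G 1 1 k x + Y x 0 1 * partial i (G 1 1 k) x).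
Proof.
move=> sX sY Vx.
have C (W : vfield R) j : smooth W -> Cinf V (fun y => W y 0 j) by exact: field_Cinf.
have CG := G_Cinf.
have CX0 := C X 0 sX; have CX1 := C X 1 sX.
have CY0 := C Y 0 sY; have CY1 := C Y 1 sY; have CYk := C Y k sY.
rewrite (eq_partial oV i (fun y Vy => nabE k sX sY Vy) Vx).
eapply hp_eq; [solve_partial|].
abstract_ring.
Qed.

(** Tensoriality: all derivatives of X, Y and Z cancel, the second ones by Schwarz's
    theorem. *)
Lemma curvatureE X Y Z x l : smooth X -> smooth Y -> smooth Z -> V x ->
  curvature nab X Y Z x 0 l = (X x 0 0 * Y x 0 1 - X x 0 1 * Y x 0 0) *
    (Z x 0 0 * curv_coef 0 l x + Z x 0 1 * curv_coef 1 l x).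
Proof.
move=> sX sY sZ Vx.
have N A B : smooth A -> smooth B -> smooth (nab A B) by exact: connection_smooth.
have mxB (u v w : plane R) : (u - v - w) 0 l = u 0 l - v 0 l - w 0 l by rewrite !mxE.
have sch : partial 1 (partial 0 (fun y => Z y 0 l)) x =
    partial 0 (partial 1 (fun y => Z y 0 l)) x.
  by apply: Schwarz oV _ Vx; exact: (field_Cinf oV).
rewrite curvature_def mxB (nabE l sX (N _ _ sY sZ) Vx) (nabE l sY (N _ _ sX sZ) Vx).
rewrite (nabE l (smooth_lie sX sY) sZ Vx) !(lie_bracketE _ sX sY Vx).
rewrite !(partial_nabE _ _ sY sZ Vx) !(partial_nabE _ _ sX sZ Vx).
rewrite !(nabE _ sY sZ Vx) !(nabE _ sX sZ Vx) sch /curv_coef.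
abstract_ring.
Qed.

Lemma curv_coef_Cinf k l : Cinf V (curv_coef k l).
Proof. by have CG := G_Cinf; rewrite /curv_coef; solve_Cinf. Qed.

Lemma smooth_curvature X Y Z : smooth X -> smooth Y -> smooth Z ->
  smooth (curvature nab X Y Z).
Proof.
move=> sX sY sZ; apply: (Cinf_field oV) => j.
apply: (Cinf_ext oV (fun x Vx => esym (curvatureE j sX sY sZ Vx))).
have C (W : vfield R) i : smooth W -> Cinf V (fun y => W y 0 i) by exact: field_Cinf.
have CX0 := C X 0 sX; have CX1 := C X 1 sX.
have CY0 := C Y 0 sY; have CY1 := C Y 1 sY.
have CZ0 := C Z 0 sZ; have CZ1 := C Z 1 sZ.
have CK := curv_coef_Cinf.
solve_Cinf.
Qed.

Lemma ricciE Y Z x : smooth Y -> smooth Z -> V x ->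
  ricci nab Y Z x =
    Y x 0 1 * (Z x 0 0 * curv_coef 0 0 x + Z x 0 1 * curv_coef 1 0 x)
    - Y x 0 0 * (Z x 0 0 * curv_coef 0 1 x + Z x 0 1 * curv_coef 1 1 x).
Proof.
move=> sY sZ Vx; have sc w : smooth (cst w) by exact: smooth_cst.
rewrite ricci_def; apply: etrans.
  exact: (congr2 +%R (curvatureE 0 (sc (delta_mx 0 0)) sY sZ Vx)
                     (curvatureE 1 (sc (delta_mx 0 1)) sY sZ Vx)).
cbv beta delta [cst]; rewrite -> e00, e01, e10, e11.
by move: (curv_coef _ _ _) (curv_coef _ _ _) (curv_coef _ _ _) (curv_coef _ _ _) => *; abstract_ring.
Qed.

Lemma ricci_Cinf Y Z : smooth Y -> smooth Z -> Cinf V (ricci nab Y Z).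
Proof.
move=> sY sZ; apply: (Cinf_ext oV (fun x Vx => esym (ricciE sY sZ Vx))).
have C (W : vfield R) i : smooth W -> Cinf V (fun y => W y 0 i) by exact: field_Cinf.
have CY0 := C Y 0 sY; have CY1 := C Y 1 sY.
have CZ0 := C Z 0 sZ; have CZ1 := C Z 1 sZ.
have CK := curv_coef_Cinf.
solve_Cinf.
Qed.

(** R(X, Y) is alternating, hence determined in dimension two by R(e_0, e_1), whose
    four components are those of the Ricci tensor. *)
Lemma curvature_ricci X Y Z x : smooth X -> smooth Y -> smooth Z -> V x ->
  curvature nab X Y Z x = ricci nab Y Z x *: X x - ricci nab X Z x *: Y x.
Proof.
move=> sX sY sZ Vx; apply/rowP => l.
rewrite (curvatureE l sX sY sZ Vx) (ricciE sX sZ Vx) (ricciE sY sZ Vx) !rowE.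
case: (ordI2 l) => ->; move: (curv_coef 0 0 x) (curv_coef 0 1 x) => c00 c01;
  move: (curv_coef 1 0 x) (curv_coef 1 1 x) => c10 c11; abstract_ring.
Qed.

(** This is the covariant derivative of [curvature_ricci]; the derivatives of X, Y
    and Z cancel formally. *)
Lemma nabla_curvature_ricci W X Y Z x :
  smooth W -> smooth X -> smooth Y -> smooth Z -> V x ->
  nabla_curvature nab W X Y Z x =
    nabla_ricci nab W Y Z x *: X x - nabla_ricci nab W X Z x *: Y x.
Proof.
move=> sW sX sY sZ Vx.
have N A B : smooth A -> smooth B -> smooth (nab A B) by exact: connection_smooth.
have E y : V y -> curvature nab X Y Z y =
    ricci nab Y Z y *: X y + (- ricci nab X Z y) *: Y y.
  by move=> Vy; rewrite curvature_ricci// scaleNr.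
have CXZ := CinfN oV (ricci_Cinf sX sZ); have CYZ := ricci_Cinf sY sZ.
rewrite nabla_curvature_def (nab_ext sW (smooth_curvature sX sY sZ) (fun _ _ => erefl) E Vx).
have s1 := smooth_scale oV CYZ sX; have s2 := smooth_scale oV CXZ sY.
have c1 := (smooth_Cinf oV _).2 CYZ; have c2 := (smooth_Cinf oV _).2 CXZ.
rewrite (connection_addr Hn sW s1 s2 Vx) (connection_leibniz Hn c1 sW sX Vx).
rewrite (connection_leibniz Hn c2 sW sY Vx).
rewrite (curvature_ricci (N _ _ sW sX) sY sZ Vx).
rewrite (curvature_ricci sX (N _ _ sW sY) sZ Vx).
rewrite (curvature_ricci sX sY (N _ _ sW sZ) Vx).
have -> : 'D_(W x) (fun y => - ricci nab X Z y) x = - 'D_(W x) (ricci nab X Z) x.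
  rewrite deriveN//; apply: diff_derivable.
  exact: (Cinf_diff (ricci_Cinf sX sZ) Vx).
rewrite !nabla_ricci_def; apply/rowP => l; rewrite !rowE; abstract_ring.
Qed.

Definition rho (j k : 'I_2) : plane R -> R := ricci nab (e_ j) (e_ k).

(** The components (nabla_m rho)(e_j, e_k). *)
Definition nabla_rho (m j k : 'I_2) (x : plane R) :=
  partial m (rho j k) x - G m j 0 x * rho 0 k x - G m j 1 x * rho 1 k x
  - G m k 0 x * rho j 0 x - G m k 1 x * rho j 1 x.

Lemma rhoE j k x : V x -> rho j k x =
  if j == 0 then - curv_coef k 1 x else curv_coef k 0 x.
Proof.
move=> Vx; have se i : smooth (e_ i) by exact: smooth_coord_field.
rewrite /rho (ricciE (se j) (se k) Vx).
case: (ordI2 j) => ->; case: (ordI2 k) => ->; rewrite /coord_field /cst !eE /=;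
  by rewrite ?(mul0r, mul1r, mulr0, mulr1, addr0, add0r, sub0r, subr0).
Qed.

Lemma rho_Cinf j k : Cinf V (rho j k).
Proof. by apply: ricci_Cinf; exact: smooth_coord_field. Qed.

Lemma ricci_rho Y Z x : smooth Y -> smooth Z -> V x ->
  ricci nab Y Z x =
    Y x 0 0 * (Z x 0 0 * rho 0 0 x + Z x 0 1 * rho 0 1 x) +
    Y x 0 1 * (Z x 0 0 * rho 1 0 x + Z x 0 1 * rho 1 1 x).
Proof. move=> sY sZ Vx; rewrite (ricciE sY sZ Vx) !(rhoE _ _ Vx) /=.
move: (curv_coef 0 0 x) (curv_coef 0 1 x) => c00 c01.
move: (curv_coef 1 0 x) (curv_coef 1 1 x) => c10 c11; abstract_ring. Qed.

Lemma nabla_ricciE W Y Z x : smooth W -> smooth Y -> smooth Z -> V x ->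
  nabla_ricci nab W Y Z x =
    W x 0 0 *
     (Y x 0 0 * (Z x 0 0 * nabla_rho 0 0 0 x + Z x 0 1 * nabla_rho 0 0 1 x) +
      Y x 0 1 * (Z x 0 0 * nabla_rho 0 1 0 x + Z x 0 1 * nabla_rho 0 1 1 x)) +
    W x 0 1 *
     (Y x 0 0 * (Z x 0 0 * nabla_rho 1 0 0 x + Z x 0 1 * nabla_rho 1 0 1 x) +
      Y x 0 1 * (Z x 0 0 * nabla_rho 1 1 0 x + Z x 0 1 * nabla_rho 1 1 1 x)).
Proof.
move=> sW sY sZ Vx.
have N A B : smooth A -> smooth B -> smooth (nab A B) by exact: connection_smooth.
have C (U : vfield R) i : smooth U -> Cinf V (fun y => U y 0 i) by exact: field_Cinf.
have CY0 := C Y 0 sY; have CY1 := C Y 1 sY.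
have CZ0 := C Z 0 sZ; have CZ1 := C Z 1 sZ.
have CR := rho_Cinf.
have D i : partial i (ricci nab Y Z) x =
   partial i (fun y => Y y 0 0) x * (Z x 0 0 * rho 0 0 x + Z x 0 1 * rho 0 1 x) +
   Y x 0 0 * (partial i (fun y => Z y 0 0) x * rho 0 0 x + Z x 0 0 * partial i (rho 0 0) x +
     partial i (fun y => Z y 0 1) x * rho 0 1 x + Z x 0 1 * partial i (rho 0 1) x) +
   partial i (fun y => Y y 0 1) x * (Z x 0 0 * rho 1 0 x + Z x 0 1 * rho 1 1 x) +
   Y x 0 1 * (partial i (fun y => Z y 0 0) x * rho 1 0 x + Z x 0 0 * partial i (rho 1 0) x +
     partial i (fun y => Z y 0 1) x * rho 1 1 x + Z x 0 1 * partial i (rho 1 1) x).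
  rewrite (eq_partial oV i (fun y Vy => ricci_rho sY sZ Vy) Vx).
  eapply hp_eq; [solve_partial|].
  cbv beta.
  move: (rho 0 0 x) (rho 0 1 x) (rho 1 0 x) (rho 1 1 x) => r00 r01 r10 r11.
  abstract_ring.
rewrite nabla_ricci_def deriv2E; last exact: (Cinf_diff (ricci_Cinf sY sZ) Vx).
rewrite !D (ricci_rho (N _ _ sW sY) sZ Vx) (ricci_rho sY (N _ _ sW sZ) Vx).
rewrite !(nabE _ sW sY Vx) !(nabE _ sW sZ Vx) /nabla_rho.
repeat match goal with |- context [rho ?i ?j x] => generalize (rho i j x) end.
abstract_ring.
Qed.

Lemma ricci_eq0 Y Z x : smooth Y -> smooth Z -> V x -> Y x = 0 ->
  ricci nab Y Z x = 0.
Proof.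
move=> sY sZ Vx Y0.
have [Y00 Y01] : Y x 0 0 = 0 /\ Y x 0 1 = 0 by rewrite Y0 mxE mxE.
rewrite (ricci_rho sY sZ Vx).
repeat match goal with |- context [rho ?i ?j x] => generalize (rho i j x) end.
by move: (Y x 0 0) (Y x 0 1) Y00 Y01 => a b -> ->; abstract_ring.
Qed.

Lemma nabla_ricci_eq0 W Y Z x : smooth W -> smooth Y -> smooth Z -> V x -> Y x = 0 ->
  nabla_ricci nab W Y Z x = 0.
Proof.
move=> sW sY sZ Vx Y0.
have [Y00 Y01] : Y x 0 0 = 0 /\ Y x 0 1 = 0 by rewrite Y0 mxE mxE.
rewrite (nabla_ricciE sW sY sZ Vx).
repeat match goal with |- context [nabla_rho ?i ?j ?k x] =>
  generalize (nabla_rho i j k x) end.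
by move: (Y x 0 0) (Y x 0 1) Y00 Y01 => a b -> ->; abstract_ring.
Qed.

(** S(v) w = (nabla_v rho)(v, v) w - (nabla_v rho)(w, v) v by
    [nabla_curvature_ricci]; in dimension two the first term has trace 2 (nabla_v
    rho)(v, v) and the second removes one half of it. *)
Lemma szabo_trace x v : V x ->
  \tr (szabo_mx nab x v) = nabla_ricci nab (cst v) (cst v) (cst v) x.
Proof.
move=> Vx; have sc w : smooth (cst w) by exact: smooth_cst.
have A w k : nabla_curvature nab (cst v) (cst w) (cst v) (cst v) x 0 k =
    nabla_ricci nab (cst v) (cst v) (cst v) x * w 0 k -
     (v 0 0 *
       (w 0 0 * (v 0 0 * nabla_rho 0 0 0 x + v 0 1 * nabla_rho 0 0 1 x) +
        w 0 1 * (v 0 0 * nabla_rho 0 1 0 x + v 0 1 * nabla_rho 0 1 1 x)) +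
      v 0 1 *
       (w 0 0 * (v 0 0 * nabla_rho 1 0 0 x + v 0 1 * nabla_rho 1 0 1 x) +
        w 0 1 * (v 0 0 * nabla_rho 1 1 0 x + v 0 1 * nabla_rho 1 1 1 x))) * v 0 k.
  rewrite (nabla_curvature_ricci (sc v) (sc w) (sc v) (sc v) Vx) !rowE.
  by rewrite (nabla_ricciE (sc v) (sc w) (sc v) Vx).
rewrite szabo_tr_def; apply: etrans.
  exact: (congr2 +%R (A (delta_mx 0 0) 0) (A (delta_mx 0 1) 1)).
rewrite -> e00, e01, e10, e11.
rewrite (nabla_ricciE (sc v) (sc v) (sc v) Vx) /cst.
repeat match goal with |- context [nabla_rho ?i ?j ?k x] =>
  generalize (nabla_rho i j k x) end.
abstract_ring.
Qed.

Lemma szabo0 x : V x -> szabo_mx nab x 0 = 0.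
Proof.
move=> Vx; have sc w : smooth (cst w) by exact: smooth_cst.
apply/matrixP => i j; rewrite szabo_mx_def [RHS]mxE.
rewrite !(nabla_curvature_ricci (sc _) (sc _) (sc _) (sc _) Vx).
by rewrite !(nabla_ricciE (sc _) (sc _) (sc _) Vx) /cst !vec0 !mul0r !addr0 !scale0r subr0 vec0.
Qed.

(** S(0) = 0, so the Szabo condition makes the characteristic polynomial of S(v),
    hence its trace, that of the zero operator. *)
Lemma szabo_cyclic x v : V x ->
  char_poly (szabo_mx nab x v) = char_poly (szabo_mx nab x 0) ->
  nabla_ricci nab (cst v) (cst v) (cst v) x = 0.
Proof.
move=> Vx E; rewrite -(szabo_trace v Vx).
have := char_poly_trace (szabo_mx nab x v) isT.
rewrite E.
rewrite (char_poly_trace (szabo_mx nab x 0) isT).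
rewrite (szabo0 Vx).
rewrite mxtrace0 oppr0 => /esym/eqP.
by rewrite oppr_eq0 => /eqP.
Qed.

End Connection.

Ltac abstract_tensors :=
  repeat match goal with |- context [@rho ?R ?n ?i ?j ?x] => generalize (@rho R n i j x) end;
  repeat match goal with |- context [@nabla_rho ?R ?n ?i ?j ?k ?x] =>
    generalize (@nabla_rho R n i j k x) end;
  repeat match goal with |- context [@curv_coef ?R ?n ?i ?j ?x] =>
    generalize (@curv_coef R n i j x) end.

(** * Changes of coordinates *)

Section PlaneMaps.
Variable R : realType.
Implicit Types V W : set (plane R).

Lemma Cinf_comp V W (h : plane R -> R) (g : plane R -> plane R) :
  open V -> Cinf W h -> smooth_on V g -> (forall x, V x -> W (g x)) ->
  Cinf V (fun x => h (g x)).
Proof.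
move=> oV Ch sg gVW.
have E x : \row_j g x 0 j = g x by apply/rowP => j; rewrite mxE.
have H : Cinf V (fun x => h (\row_j g x 0 j)).
  move=> k; apply: (Ck_comp oV (W := W) (g := fun j x => g x 0 j)) => //.
    by move=> x Vx; rewrite E; exact: gVW.
  by move=> j; exact: (field_Cinf oV).
by apply: (Cinf_ext oV _ H) => x _; rewrite E.
Qed.

Lemma smooth_comp V W (h g : plane R -> plane R) :
  open V -> open W -> smooth_on W h -> smooth_on V g ->
  (forall x, V x -> W (g x)) -> smooth_on V (h \o g).
Proof.
move=> oV oW sh sg gVW; apply: (Cinf_field oV) => j.
exact: (Cinf_comp oV (field_Cinf oW j sh) sg gVW).
Qed.

Lemma smooth_on_sub V W (g : plane R -> plane R) : open V -> open W -> V `<=` W ->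
  smooth_on W g -> smooth_on V g.
Proof.
move=> oV oW VW sg; apply: (Cinf_field oV) => j.
exact: (Cinf_sub VW (field_Cinf oW j sg)).
Qed.

Lemma smooth_on_cont V (g : plane R -> plane R) x : open V -> smooth_on V g -> V x ->
  {for x, continuous g}.
Proof. by move=> oV sg Vx; apply: differentiable_continuous; exact: field_diff sg Vx. Qed.

Lemma deriv_vcomp (f g : plane R -> plane R) x v :
  differentiable g x -> differentiable f (g x) ->
  'D_v (f \o g) x = 'D_('D_v g x) f (g x).
Proof.
move=> dg df; rewrite (deriveE _ (differentiable_comp dg df)) (deriveE _ dg) (deriveE _ df).
exact: (congr1 (@^~ v) (diff_comp dg df)).
Qed.

(** Both maps are total; their values outside [U] and [V] are arbitrary. *)
Record diffeo (U V : set (plane R)) (f g : plane R -> plane R) : Prop := Diffeo {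
  diffeo_openl : open U;
  diffeo_openr : open V;
  diffeo_mapl : forall x, U x -> V (f x);
  diffeo_mapr : forall y, V y -> U (g y);
  diffeoK : forall x, U x -> g (f x) = x;
  diffeoKr : forall y, V y -> f (g y) = y;
  diffeo_smooth : smooth_on U f;
  diffeo_smoothr : smooth_on V g }.

Lemma diffeo_id U : open U -> diffeo U U id id.
Proof.
move=> oU; have sid : smooth_on U (id : plane R -> plane R).
  by apply: (Cinf_field oU) => j; exact: Cinf_coord.
by apply: Diffeo.
Qed.

Lemma diffeo_comp U V W f g f' g' : diffeo U V f g -> diffeo V W f' g' ->
  diffeo U W (f' \o f) (g \o g').
Proof.
move=> [oU oV fU gV gf fg sf sg] [_ oW fV gW gf' fg' sf' sg']; apply: Diffeo.
- exact: oU.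
- exact: oW.
- by move=> x /fU /fV.
- by move=> x /gW /gV.
- by move=> x Ux; rewrite /= gf'; [exact: gf|exact: fU].
- by move=> x Wx; rewrite /= fg; [exact: fg'|exact: gW].
- exact: smooth_comp sf' sf fU.
- exact: smooth_comp sg sg' gW.
Qed.

Lemma diffeo_restr U V W f g : diffeo U V f g -> open W -> W `<=` V ->
  diffeo (U `&` f @^-1` W) W f g.
Proof.
move=> [oU oV fU gV gf fg sf sg] oW WV.
have oU' : open (U `&` f @^-1` W).
  rewrite openE => x [Ux Wfx]; apply: filterI; first exact: open_nbhs_nbhs.
  by apply: (smooth_on_cont oU sf Ux); exact: open_nbhs_nbhs.
apply: Diffeo.
- exact: oU'.
- exact: oW.
- by move=> x [].
- by move=> y Wy; split; [exact/gV/WV|rewrite /preimage /= fg; [|exact: WV]].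
- by move=> x [Ux _]; exact: gf.
- by move=> y /WV; exact: fg.
- by apply: (smooth_on_sub oU' oU _ sf) => x [].
- exact: (smooth_on_sub oW oV WV sg).
Qed.

End PlaneMaps.

Section Charts.
Variables (R : realType).

Section OneChart.
Variables (M : topologicalType) (c : chart R M).

Lemma coord_cont p : dom c p -> {for p, continuous (coord c)}.
Proof.
have := @Defs.coord_continuous _ _ c.
by rewrite (continuous_open_subspace _ (@dom_open _ _ c)) => H dp; apply: H; rewrite inE.
Qed.

Lemma param_cont x : img c x -> {for x, continuous (param c)}.
Proof.
have := @param_continuous _ _ c.
by rewrite (continuous_open_subspace _ (@img_open _ _ c)) => H dp; apply: H; rewrite inE.
Qed.

Lemma paramK p : dom c p -> param c (coord c p) = p.
Proof. by move=> dp; apply: coordK; rewrite inE. Qed.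

Lemma coord_param x : img c x -> coord c (param c x) = x.
Proof. by move=> [p dp <-]; rewrite paramK. Qed.

Lemma coord_img p : dom c p -> img c (coord c p).
Proof. by move=> dp; exists p. Qed.

Lemma open_img : open (img c).
Proof. exact: img_open. Qed.

Lemma open_coord_image (W : set M) : open W -> W `<=` dom c -> open (coord c @` W).
Proof.
move=> oW Wd; rewrite openE => x [p Wp <-].
have ix : img c (coord c p) by exact/coord_img/Wd.
have n1 : nbhs (coord c p) (img c) by apply: open_nbhs_nbhs; split => //; exact: img_open.
have n2 : nbhs (coord c p) (param c @^-1` W).
  by apply: (param_cont ix); rewrite paramK//; [exact: open_nbhs_nbhs|exact: Wd].
apply: filterS (filterI n1 n2) => y [iy Wy].
by exists (param c y) => //; exact: coord_param.
Qed.

Lemma open_coord_preimage (U : set (plane R)) : open U ->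
  open (dom c `&` coord c @^-1` U).
Proof.
move=> oU; rewrite openE => p [dp Up]; apply: filterI.
  by apply: open_nbhs_nbhs; split => //; exact: dom_open.
by apply: (coord_cont dp); exact: open_nbhs_nbhs.
Qed.

End OneChart.

Lemma transitionE (M : topologicalType) (c c' : chart R M) p : dom c p ->
  transition c c' (coord c p) = coord c' p.
Proof. by move=> dp; rewrite /transition /= paramK. Qed.

Variable S : surface R.

(** Composing a chart with a diffeomorphism keeps its transitions to all other
    charts smooth, so maximality of the atlas applies. *)
Lemma chart_of_diffeo (c : chart R S) U V f g : atlas c -> diffeo U V f g ->
  U `<=` img c -> exists c' : chart R S, [/\ atlas c',
    dom c' = dom c `&` coord c @^-1` U,
    coord c' = f \o coord c & param c' = param c \o g].
Proof.
move=> ac [oU oV fU gV gf fg sf sg] Uc.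
pose d := dom c `&` coord c @^-1` U.
have od : open d by exact: open_coord_preimage.
have imgE : (f \o coord c) @` d = V.
  rewrite eqEsubset; split => [_ [p [dp Up] <-]|y Vy]; first exact: fU.
  have [p dp pE] := Uc _ (gV _ Vy).
  exists p; first by split => //; rewrite /preimage/= pE; exact: gV.
  by rewrite /= pE fg.
have oi : open ((f \o coord c) @` d) by rewrite imgE.
have K : {in d, cancel (f \o coord c) (param c \o g)}.
  move=> p; rewrite inE => -[dp Up] /=; rewrite gf// paramK//.
have cc : {within d, continuous (f \o coord c)}.
  rewrite (continuous_open_subspace _ od) => p; rewrite inE => -[dp Up].
  by apply: continuous_comp; [exact: coord_cont|exact: (smooth_on_cont oU sf Up)].
have cp : {within (f \o coord c) @` d, continuous (param c \o g)}.
  rewrite (continuous_open_subspace _ oi) imgE => y; rewrite inE => Vy.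
  apply: continuous_comp; first exact: (smooth_on_cont oV sg Vy).
  by apply: param_cont; apply: Uc; exact: gV.
pose c' := Chart od oi K cc cp.
exists c'; split => //; apply: atlas_maximal => c'' ac''.
have [s1 s2] := atlas_compatible ac ac''.
have o1 : open (coord c @` (dom c `&` dom c'')).
  by apply: open_coord_image; [apply: openI; exact: dom_open|move=> ? []].
have o2 : open (coord c'' @` (dom c `&` dom c'')).
  by apply: open_coord_image; [apply: openI; exact: dom_open|move=> ? []].
have o1' : open (coord c' @` (dom c' `&` dom c'')).
  by apply: open_coord_image; [apply: openI; exact: dom_open|move=> ? []].
have o2' : open (coord c'' @` (dom c' `&` dom c'')).
  by apply: open_coord_image; [apply: openI; exact: dom_open|move=> ? []].
split.
  have -> : transition c' c'' = transition c c'' \o g by [].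
  apply: (smooth_comp o1' o1 s1).
    apply: (smooth_on_sub o1' oV _ sg) => _ [p [[dp Up] _] <-]; exact: fU.
  by move=> _ [p [[dp Up] d''p] <-]; exists p => //=; rewrite gf.
have -> : transition c'' c' = f \o transition c'' c by [].
apply: (smooth_comp o2' oU sf).
  by apply: (smooth_on_sub o2' o2 _ s2) => _ [p [[dp _] d''p] <-]; exists p.
by move=> _ [p [[dp Up] d''p] <-]; rewrite transitionE.
Qed.

Lemma restrict_chart (c : chart R S) U : atlas c -> open U -> U `<=` img c ->
  exists c' : chart R S, [/\ atlas c', dom c' = dom c `&` coord c @^-1` U,
    coord c' = coord c & param c' = param c].
Proof.
move=> ac oU Uc; have [c' [? ? ? ?]] := chart_of_diffeo ac (diffeo_id oU) Uc.
by exists c'.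
Qed.

Lemma restrict_img (c c' : chart R S) U : U `<=` img c ->
  dom c' = dom c `&` coord c @^-1` U -> coord c' = coord c -> img c' = U.
Proof.
move=> Uc d' co; rewrite /img d' co eqEsubset; split => [_ [p [dp Up] <-]//|x Ux].
by have [p dp px] := Uc _ Ux; exists p => //; split => //; rewrite /preimage/= px.
Qed.

Lemma transition_diffeo (c c' : chart R S) : atlas c -> atlas c' -> dom c = dom c' ->
  diffeo (img c) (img c') (transition c c') (transition c' c).
Proof.
move=> ac ac' dd; have [s1 s2] := atlas_compatible ac ac'.
have e1 : coord c @` (dom c `&` dom c') = img c by rewrite -dd setIid.
have e2 : coord c' @` (dom c `&` dom c') = img c' by rewrite dd setIid.
rewrite e1 in s1; rewrite e2 in s2.
apply: Diffeo; [exact: img_open|exact: img_open|..|exact: s1|exact: s2].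
- by move=> _ [p dp <-]; rewrite transitionE//; apply: coord_img; rewrite -dd.
- by move=> _ [p dp <-]; rewrite transitionE//; apply: coord_img; rewrite dd.
- by move=> _ [p dp <-]; rewrite !transitionE// -dd.
- by move=> _ [p dp <-]; rewrite !transitionE// dd.
Qed.

End Charts.

Arguments open_img {R M} c.

(** * Invariance of the Ricci tensor *)

Section Transform.
Variables (R : realType) (S : surface R) (D : affine_connection S).

Lemma derivB_dir (f : plane R -> plane R) x u v : differentiable f x ->
  'D_(u - v) f x = 'D_u f x - 'D_v f x.
Proof. by move=> df; rewrite !(deriveE _ df) linearB. Qed.

Lemma derivZ_dir (f : plane R -> plane R) x a v : differentiable f x ->
  'D_(a *: v) f x = a *: 'D_v f x.
Proof. by move=> df; rewrite !(deriveE _ df) linearZ. Qed.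

Section Overlap.
Variables (c c' : chart R S).
Hypotheses (ac : atlas c) (ac' : atlas c').

Lemma transition_diff p : dom c p -> dom c' p ->
  differentiable (transition c c') (coord c p).
Proof.
move=> dp dp'; have [s1 _] := atlas_compatible ac ac'.
have o1 : open (coord c @` (dom c `&` dom c')).
  by apply: open_coord_image; [apply: openI; exact: dom_open|move=> ? []].
by apply: (field_diff o1 s1); exists p.
Qed.

(** The derivative of the inverse transition is a left inverse. *)
Lemma transition_inj p v : dom c p -> dom c' p ->
  'D_v (transition c c') (coord c p) = 0 -> v = 0.
Proof.
move=> dp dp' E; have d1 := transition_diff dp dp'.
have [_ s2] := atlas_compatible ac ac'.
have o1 : open (coord c @` (dom c `&` dom c')).
  by apply: open_coord_image; [apply: openI; exact: dom_open|move=> ? []].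
have o2 : open (coord c' @` (dom c `&` dom c')).
  by apply: open_coord_image; [apply: openI; exact: dom_open|move=> ? []].
have d2 : differentiable (transition c' c) (transition c c' (coord c p)).
  by rewrite transitionE//; apply: (field_diff o2 s2); exists p.
have N : \forall x \near coord c p, (transition c' c \o transition c c') x = id x.
  apply: (smooth_on_near (V := coord c @` (dom c `&` dom c'))) => //.
    by move=> _ [q [dq dq'] <-]; rewrite /= !transitionE.
  by exists p.
have := near_eq_derive v N; rewrite (deriv_vcomp v d1 d2) derive_id E => <-.
by rewrite derive0.
Qed.

Lemma same_vfieldB X X' Y Y' : same_vfield c c' X X' -> same_vfield c c' Y Y' ->
  same_vfield c c' (fun x => X x - Y x) (fun x => X' x - Y' x).
Proof.
move=> sX sY p dp dp'; rewrite derivB_dir; last exact: transition_diff.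
by rewrite sX// sY.
Qed.

Lemma same_vfield_ext X X' Y Y' : (forall x, img c x -> X x = Y x) ->
  (forall x, img c' x -> X' x = Y' x) ->
  same_vfield c c' X X' -> same_vfield c c' Y Y'.
Proof.
move=> XY XY' sX p dp dp'; rewrite -XY' -?XY; first exact: sX.
  exact: coord_img.
exact: coord_img.
Qed.

Local Notation nab := (nabla D c).
Local Notation nab' := (nabla D c').
Local Notation sm X := (smooth_on (img c) X).
Local Notation sm' X := (smooth_on (img c') X).
Let oc := open_img c.
Let oc' := open_img c'.
Let Hn := nablaP D ac.
Let Hn' := nablaP D ac'.

(** The bracket is the antisymmetrization of the covariant derivative, whose
    invariance is given. *)
Lemma same_lie X Y X' Y' : sm X -> sm Y -> sm' X' -> sm' Y' ->
  same_vfield c c' X X' -> same_vfield c c' Y Y' ->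
  same_vfield c c' (lie_bracket X Y) (lie_bracket X' Y').
Proof.
move=> sX sY sX' sY' XX YY.
apply: (@same_vfield_ext (fun x => nab X Y x - nab Y X x)
  (fun x => nab' X' Y' x - nab' Y' X' x)).
- by move=> x ix; exact: (connection_torsion_free Hn).
- by move=> x ix; exact: (connection_torsion_free Hn').
- by apply: same_vfieldB; exact: nabla_compatible.
Qed.

Lemma same_curvature X Y Z X' Y' Z' : sm X -> sm Y -> sm Z -> sm' X' -> sm' Y' -> sm' Z' ->
  same_vfield c c' X X' -> same_vfield c c' Y Y' -> same_vfield c c' Z Z' ->
  same_vfield c c' (curvature nab X Y Z) (curvature nab' X' Y' Z').
Proof.
move=> sX sY sZ sX' sY' sZ' XX YY ZZ.
have N A B : sm A -> sm B -> sm (nab A B) by exact: (connection_smooth Hn).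
have N' A B : sm' A -> sm' B -> sm' (nab' A B) by exact: (connection_smooth Hn').
apply: (@same_vfield_ext (fun x => (nab X (nab Y Z) x - nab Y (nab X Z) x) - nab (lie_bracket X Y) Z x)
  (fun x => (nab' X' (nab' Y' Z') x - nab' Y' (nab' X' Z') x) - nab' (lie_bracket X' Y') Z' x)).
- by move=> x ix; rewrite curvature_def.
- by move=> x ix; rewrite curvature_def.
have NN A B A' B' : sm A -> sm B -> sm' A' -> sm' B' ->
    same_vfield c c' A A' -> same_vfield c c' B B' ->
    same_vfield c c' (nab A B) (nab' A' B').
  by move=> *; exact: nabla_compatible.
have sL := same_lie sX sY sX' sY' XX YY.
have hL := NN _ _ _ _ (smooth_lie oc Hn sX sY) sZ (smooth_lie oc' Hn' sX' sY') sZ' sL ZZ.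
have hX := NN _ _ _ _ sX (N _ _ sY sZ) sX' (N' _ _ sY' sZ') XX (NN _ _ _ _ sY sZ sY' sZ' YY ZZ).
have hY := NN _ _ _ _ sY (N _ _ sX sZ) sY' (N' _ _ sX' sZ') YY (NN _ _ _ _ sX sZ sX' sZ' XX ZZ).
exact: same_vfieldB (same_vfieldB hX hY) hL.
Qed.

Lemma same_nabla_curvature W X Y Z W' X' Y' Z' :
  sm W -> sm X -> sm Y -> sm Z -> sm' W' -> sm' X' -> sm' Y' -> sm' Z' ->
  same_vfield c c' W W' ->
  same_vfield c c' X X' -> same_vfield c c' Y Y' -> same_vfield c c' Z Z' ->
  same_vfield c c' (nabla_curvature nab W X Y Z) (nabla_curvature nab' W' X' Y' Z').
Proof.
move=> sW sX sY sZ sW' sX' sY' sZ' WW XX YY ZZ.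
have N A B : sm A -> sm B -> sm (nab A B) by exact: (connection_smooth Hn).
have N' A B : sm' A -> sm' B -> sm' (nab' A B) by exact: (connection_smooth Hn').
have K A B C : sm A -> sm B -> sm C -> sm (curvature nab A B C).
  by move=> *; exact: (smooth_curvature oc Hn).
have K' A B C : sm' A -> sm' B -> sm' C -> sm' (curvature nab' A B C).
  by move=> *; exact: (smooth_curvature oc' Hn').
have NN A B A' B' : sm A -> sm B -> sm' A' -> sm' B' ->
    same_vfield c c' A A' -> same_vfield c c' B B' ->
    same_vfield c c' (nab A B) (nab' A' B').
  by move=> *; exact: nabla_compatible.
apply: (@same_vfield_ext (fun x => (nab W (curvature nab X Y Z) x - curvature nab (nab W X) Y Z x
  - curvature nab X (nab W Y) Z x) - curvature nab X Y (nab W Z) x)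
  (fun x => (nab' W' (curvature nab' X' Y' Z') x - curvature nab' (nab' W' X') Y' Z' x
  - curvature nab' X' (nab' W' Y') Z' x) - curvature nab' X' Y' (nab' W' Z') x)).
- by move=> x ix; rewrite nabla_curvature_def.
- by move=> x ix; rewrite nabla_curvature_def.
have WX := NN _ _ _ _ sW sX sW' sX' WW XX.
have WY := NN _ _ _ _ sW sY sW' sY' WW YY.
have WZ := NN _ _ _ _ sW sZ sW' sZ' WW ZZ.
have h1 := NN _ _ _ _ sW (K _ _ _ sX sY sZ) sW' (K' _ _ _ sX' sY' sZ') WW
  (same_curvature sX sY sZ sX' sY' sZ' XX YY ZZ).
have h2 := same_curvature (N _ _ sW sX) sY sZ (N' _ _ sW' sX') sY' sZ' WX YY ZZ.
have h3 := same_curvature sX (N _ _ sW sY) sZ sX' (N' _ _ sW' sY') sZ' XX WY ZZ.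
have h4 := same_curvature sX sY (N _ _ sW sZ) sX' sY' (N' _ _ sW' sZ') XX YY WZ.
exact: same_vfieldB (same_vfieldB (same_vfieldB h1 h2) h3) h4.
Qed.

End Overlap.

(** Recovers the coefficient of X from a X - b v when X is orthogonal to v: this
    reads rho off the curvature, with no trace to be computed in two bases. *)
Lemma coef_eq (L : plane R -> plane R) (a b a' b' : R) (v X : plane R) :
  (forall u w, L (u - w) = L u - L w) -> (forall k u, L (k *: u) = k *: L u) ->
  (forall u, L u = 0 -> u = 0) -> X = pt (- v 0 1) (v 0 0) -> v <> 0 ->
  a *: L X - b *: L v = a' *: L X - b' *: L v -> a = a'.
Proof.
move=> LB LZ Li -> v0; rewrite -!LZ -!LB => /eqP; rewrite -subr_eq0 -LB => /eqP /Li E.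
have E0 := congr1 (fun u : plane R => u 0 0) E.
have E1 := congr1 (fun u : plane R => u 0 1) E.
rewrite !(rowB, rowZ) pt0 [RHS]mxE in E0; rewrite !(rowB, rowZ) pt1 [RHS]mxE in E1.
have H : (a - a') * (v 0 0 ^+ 2 + v 0 1 ^+ 2) = 0.
  have -> : (a - a') * (v 0 0 ^+ 2 + v 0 1 ^+ 2) =
    v 0 0 * (a * v 0 0 - b * v 0 1 - (a' * v 0 0 - b' * v 0 1)) -
    v 0 1 * (a * (- v 0 1) - b * v 0 0 - (a' * (- v 0 1) - b' * v 0 0)).
    by abstract_ring.
  by rewrite E0 E1 !mulr0 subr0.
move/eqP: H; rewrite mulf_eq0 => /orP[|]; first by rewrite subr_eq0 => /eqP.
rewrite paddr_eq0 ?sqr_ge0// !sqrf_eq0 => /andP[/eqP v00 /eqP v01].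
by case: v0; apply: rV2P; rewrite ?v00 ?v01 vec0.
Qed.

Section SameDomain.
Variables (c c' : chart R S).
Hypotheses (ac : atlas c) (ac' : atlas c') (dd : dom c = dom c').
Local Notation T := (transition c c').
Local Notation T' := (transition c' c).
Local Notation nab := (nabla D c).
Local Notation nab' := (nabla D c').
Let oc := open_img c.
Let oc' := open_img c'.
Let Hn := nablaP D ac.
Let Hn' := nablaP D ac'.

Definition push (X : vfield R) : vfield R := fun y => 'D_(X (T' y)) T (T' y).

Lemma push_same X : same_vfield c c' X (push X).
Proof. by move=> p dp dp'; rewrite /push !transitionE. Qed.

Lemma push_smooth X : smooth_on (img c) X -> smooth_on (img c') (push X).
Proof.
move=> sX; have [_ _ fU gV gf fg sf sg] := transition_diffeo ac ac' dd.
apply: (Cinf_field oc') => k.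
pose h x := X x 0 0 * partial 0 (fun y => T y 0 k) x + X x 0 1 * partial 1 (fun y => T y 0 k) x.
have Ch : Cinf (img c) h.
  have CX0 := field_Cinf oc 0 sX; have CX1 := field_Cinf oc 1 sX.
  by have CT := field_Cinf oc k sf; rewrite /h; solve_Cinf.
apply: (Cinf_ext oc' _ (Cinf_comp oc' Ch sg gV)) => y iy.
by rewrite /push /h (deriv_field oc _ _ sf (gV _ iy)).
Qed.

Lemma push_at X p : dom c p -> push X (coord c' p) = 'D_(X (coord c p)) T (coord c p).
Proof. by move=> dp; apply: push_same; rewrite -?dd. Qed.

Let dT p (dp : dom c p) : differentiable T (coord c p).
Proof. by apply: transition_diff => //; rewrite -dd. Qed.

(** By [curvature_ricci] rho (v, w) is the coefficient of X in R(X, v) w for any X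
    independent of v, and the curvature is invariant. *)
Lemma ricci_push v w p : dom c p ->
  ricci nab (cst v) (cst w) (coord c p) =
  ricci nab' (cst ('D_v T (coord c p))) (cst ('D_w T (coord c p))) (coord c' p).
Proof.
move=> dp; have dp' : dom c' p by rewrite -dd.
have ip := coord_img dp; have ip' := coord_img dp'.
have sc u : smooth_on (img c) (cst u : vfield R) by exact: smooth_cst.
have sc' u : smooth_on (img c') (cst u : vfield R) by exact: smooth_cst.
have sp u := push_smooth (sc u).
have -> : ricci nab' (cst ('D_v T (coord c p))) (cst ('D_w T (coord c p))) (coord c' p) =
    ricci nab' (push (cst v)) (push (cst w)) (coord c' p).
  rewrite (ricci_rho oc' Hn' (sc' _) (sc' _) ip') (ricci_rho oc' Hn' (sp v) (sp w) ip').
  by rewrite !(push_at _ dp).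
have [->|/eqP v0] := eqVneq v 0.
  rewrite (ricci_eq0 oc Hn (sc _) (sc _) ip erefl) (ricci_eq0 oc' Hn' (sp 0) (sp w) ip')//.
  by rewrite (push_at _ dp) /cst derive0.
pose X := pt (- v 0 1) (v 0 0).
have := same_curvature ac ac' (sc X) (sc v) (sc w) (sp X) (sp v) (sp w)
  (@push_same (cst X)) (@push_same (cst v)) (@push_same (cst w)) dp dp'.
rewrite (curvature_ricci oc Hn (sc X) (sc v) (sc w) ip).
rewrite (curvature_ricci oc' Hn' (sp X) (sp v) (sp w) ip').
rewrite !(push_at _ dp) (derivB_dir _ _ (dT dp)) !(derivZ_dir _ _ (dT dp)).
move=> /esym; apply: (coef_eq (L := fun u => 'D_u T (coord c p))) v0 => //.
- by move=> u u'; rewrite (derivB_dir _ _ (dT dp)).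
- by move=> k u; rewrite (derivZ_dir _ _ (dT dp)).
- by move=> u; exact: transition_inj.
Qed.

Lemma nabla_ricci_push u v w p : dom c p ->
  nabla_ricci nab (cst u) (cst v) (cst w) (coord c p) =
  nabla_ricci nab' (cst ('D_u T (coord c p))) (cst ('D_v T (coord c p)))
    (cst ('D_w T (coord c p))) (coord c' p).
Proof.
move=> dp; have dp' : dom c' p by rewrite -dd.
have ip := coord_img dp; have ip' := coord_img dp'.
have sc u0 : smooth_on (img c) (cst u0 : vfield R) by exact: smooth_cst.
have sc' u0 : smooth_on (img c') (cst u0 : vfield R) by exact: smooth_cst.
have sp u0 := push_smooth (sc u0).
have -> : nabla_ricci nab' (cst ('D_u T (coord c p))) (cst ('D_v T (coord c p)))
    (cst ('D_w T (coord c p))) (coord c' p) =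
    nabla_ricci nab' (push (cst u)) (push (cst v)) (push (cst w)) (coord c' p).
  rewrite (nabla_ricciE oc' Hn' (sc' _) (sc' _) (sc' _) ip').
  by rewrite (nabla_ricciE oc' Hn' (sp u) (sp v) (sp w) ip') !(push_at _ dp).
have [->|/eqP v0] := eqVneq v 0.
  rewrite (nabla_ricci_eq0 oc Hn (sc _) (sc _) (sc _) ip erefl).
  rewrite (nabla_ricci_eq0 oc' Hn' (sp u) (sp 0) (sp w) ip')//.
  by rewrite (push_at _ dp) /cst derive0.
pose X := pt (- v 0 1) (v 0 0).
have := same_nabla_curvature ac ac' (sc u) (sc X) (sc v) (sc w) (sp u) (sp X) (sp v) (sp w)
  (@push_same (cst u)) (@push_same (cst X)) (@push_same (cst v)) (@push_same (cst w)) dp dp'.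
rewrite (nabla_curvature_ricci oc Hn (sc u) (sc X) (sc v) (sc w) ip).
rewrite (nabla_curvature_ricci oc' Hn' (sp u) (sp X) (sp v) (sp w) ip').
rewrite !(push_at _ dp) (derivB_dir _ _ (dT dp)) !(derivZ_dir _ _ (dT dp)).
move=> /esym; apply: (coef_eq (L := fun u => 'D_u T (coord c p))) v0 => //.
- by move=> u0 u'; rewrite (derivB_dir _ _ (dT dp)).
- by move=> k u0; rewrite (derivZ_dir _ _ (dT dp)).
- by move=> u0; exact: transition_inj.
Qed.

End SameDomain.

Section Restriction.
Variables (c c1 : chart R S).
Hypotheses (ac : atlas c) (ac1 : atlas c1) (d1 : dom c1 `<=` dom c).
Hypothesis co1 : coord c1 = coord c.

Lemma img_restrict : img c1 `<=` img c.
Proof. by move=> _ [p dp <-]; rewrite co1; exists p => //; exact: d1. Qed.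

(** The transition to the restricted chart is the identity near each point, so that
    constant fields correspond to constant fields. *)
Lemma christoffel_restrict i j k x : img c1 x ->
  christoffel (nabla D c1) i j k x = christoffel (nabla D c) i j k x.
Proof.
move=> [p dp <-].
have id_near v : 'D_v (transition c c1) (coord c p) = v.
  rewrite -[RHS](derive_id (coord c p) v); apply: near_eq_derive.
  apply: (smooth_on_near (open_img c1)); last by exists p; rewrite ?co1.
  by move=> _ [q dq <-]; rewrite co1 transitionE ?co1//; exact: d1.
have sc v : smooth_on (img c) (cst v : vfield R) by apply: smooth_cst; exact: open_img.
have sc1 v : smooth_on (img c1) (cst v : vfield R) by apply: smooth_cst; exact: open_img.
have same v : same_vfield c c1 (cst v) (cst v).
  move=> q dq dq1; rewrite /cst.
  rewrite -[LHS](derive_id (coord c q) v); apply/esym/near_eq_derive.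
  apply: (smooth_on_near (open_img c1)); last by exists q; rewrite ?co1.
  by move=> _ [q' dq' <-]; rewrite co1 transitionE ?co1//; exact: d1.
rewrite !christoffel_def.
have := @nabla_compatible _ _ D c c1 _ _ _ _ ac ac1 (sc _) (sc1 _) (sc _) (sc1 _)
  (same (delta_mx 0 i)) (same (delta_mx 0 j)) p (@d1 p dp) dp.
rewrite id_near -co1; exact: (congr1 (fun v : plane R => v 0 k)).
Qed.

Let oc1 := open_img c1.
Let Hn := nablaP D ac.
Let Hn1 := nablaP D ac1.

Lemma curv_coef_restrict k l x : img c1 x ->
  curv_coef (nabla D c1) k l x = curv_coef (nabla D c) k l x.
Proof.
move=> ix; rewrite /curv_coef.
have E i j m y : img c1 y ->
  christoffel (nabla D c1) i j m y = christoffel (nabla D c) i j m y.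
  exact: christoffel_restrict.
by rewrite !(eq_partial oc1 _ (E _ _ _) ix) !(E _ _ _ _ ix).
Qed.

Lemma rho_restrict j k x : img c1 x ->
  rho (nabla D c1) j k x = rho (nabla D c) j k x.
Proof.
move=> ix; rewrite (rhoE oc1 Hn1 _ _ ix).
rewrite (rhoE (open_img c) Hn _ _ (img_restrict ix)).
by rewrite !(curv_coef_restrict _ _ ix).
Qed.

Lemma nabla_rho_restrict m j k x : img c1 x ->
  nabla_rho (nabla D c1) m j k x = nabla_rho (nabla D c) m j k x.
Proof.
move=> ix; rewrite /nabla_rho.
have E i l y : img c1 y -> rho (nabla D c1) i l y = rho (nabla D c) i l y.
  exact: rho_restrict.
by rewrite !(eq_partial oc1 _ (E _ _) ix) !(E _ _ _ ix) !(christoffel_restrict _ _ _ ix).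
Qed.

Lemma ricci_restrict v w x : img c1 x ->
  ricci (nabla D c1) (cst v) (cst w) x = ricci (nabla D c) (cst v) (cst w) x.
Proof.
move=> ix; have s1 u : smooth_on (img c1) (cst u : vfield R) by exact: smooth_cst.
have s u : smooth_on (img c) (cst u : vfield R) by apply: smooth_cst; exact: open_img.
rewrite (ricci_rho oc1 Hn1 (s1 v) (s1 w) ix).
by rewrite (ricci_rho (open_img c) Hn (s v) (s w) (img_restrict ix)) !(rho_restrict _ _ ix).
Qed.

Lemma nabla_ricci_restrict u v w x : img c1 x ->
  nabla_ricci (nabla D c1) (cst u) (cst v) (cst w) x =
  nabla_ricci (nabla D c) (cst u) (cst v) (cst w) x.
Proof.
move=> ix; have s1 z : smooth_on (img c1) (cst z : vfield R) by exact: smooth_cst.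
have s z : smooth_on (img c) (cst z : vfield R) by apply: smooth_cst; exact: open_img.
rewrite (nabla_ricciE oc1 Hn1 (s1 u) (s1 v) (s1 w) ix).
rewrite (nabla_ricciE (open_img c) Hn (s u) (s v) (s w) (img_restrict ix)).
by rewrite !(nabla_rho_restrict _ _ _ ix).
Qed.

End Restriction.

(** Reduces the comparison of two charts to the case of equal domains, between which
    vector fields can be transported. *)
Lemma common_restriction (c c' : chart R S) p : atlas c -> atlas c' ->
  dom c p -> dom c' p -> exists c1 c1' : chart R S,
  [/\ atlas c1 /\ atlas c1', dom c1 = dom c `&` dom c' /\ dom c1' = dom c `&` dom c',
      coord c1 = coord c /\ param c1 = param c &
      coord c1' = coord c' /\ param c1' = param c'].
Proof.
move=> ac ac' dp dp'.
have o0 : open (dom c `&` dom c') by apply: openI; exact: dom_open.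
have o1 : open (coord c @` (dom c `&` dom c')).
  by apply: open_coord_image => // ? [].
have o2 : open (coord c' @` (dom c `&` dom c')).
  by apply: open_coord_image => // ? [].
have [|c1 [a1 D1 co1 pa1]] := restrict_chart ac o1.
  by move=> _ [q [dq _] <-]; exact: coord_img.
have [|c1' [a1' D1' co1' pa1']] := restrict_chart ac' o2.
  by move=> _ [q [_ dq] <-]; exact: coord_img.
exists c1, c1'; split => //; split.
- rewrite D1 eqEsubset; split => [q [dq [r [dr dr'] E]]|q [dq dq']].
    by split => //; rewrite -(paramK dq) -E paramK.
  by split => //; exists q.
- rewrite D1' eqEsubset; split => [q [dq [r [dr dr'] E]]|q [dq dq']].
    by split => //; rewrite -(paramK dq) -E paramK.
  by split => //; exists q.
Qed.

Lemma ricci_transform (c c' : chart R S) p v w : atlas c -> atlas c' ->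
  dom c p -> dom c' p ->
  ricci (nabla D c) (cst v) (cst w) (coord c p) =
  ricci (nabla D c') (cst ('D_v (transition c c') (coord c p)))
    (cst ('D_w (transition c c') (coord c p))) (coord c' p).
Proof.
move=> ac ac' dp dp'.
have [c1 [c1' [[a1 a1'] [D1 D1'] [co1 pa1] [co1' pa1']]]] :=
  common_restriction ac ac' dp dp'.
have dp1 : dom c1 p by rewrite D1.
have dp1' : dom c1' p by rewrite D1'.
have s1 : dom c1 `<=` dom c by rewrite D1 => ? [].
have s1' : dom c1' `<=` dom c' by rewrite D1' => ? [].
have tE : transition c1 c1' = transition c c' by rewrite /transition co1' pa1.
have i1 : img c1 (coord c p) by rewrite -co1; exact: coord_img.
have i1' : img c1' (coord c' p) by rewrite -co1'; exact: coord_img.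
rewrite -(ricci_restrict ac a1 s1 co1 _ _ i1).
rewrite -(ricci_restrict ac' a1' s1' co1' _ _ i1').
by rewrite -tE -co1 -co1'; apply: ricci_push => //; rewrite D1 D1'.
Qed.

Lemma nabla_ricci_transform (c c' : chart R S) p u v w : atlas c -> atlas c' ->
  dom c p -> dom c' p ->
  nabla_ricci (nabla D c) (cst u) (cst v) (cst w) (coord c p) =
  nabla_ricci (nabla D c') (cst ('D_u (transition c c') (coord c p)))
    (cst ('D_v (transition c c') (coord c p)))
    (cst ('D_w (transition c c') (coord c p))) (coord c' p).
Proof.
move=> ac ac' dp dp'.
have [c1 [c1' [[a1 a1'] [D1 D1'] [co1 pa1] [co1' pa1']]]] :=
  common_restriction ac ac' dp dp'.
have dp1 : dom c1 p by rewrite D1.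
have dp1' : dom c1' p by rewrite D1'.
have s1 : dom c1 `<=` dom c by rewrite D1 => ? [].
have s1' : dom c1' `<=` dom c' by rewrite D1' => ? [].
have tE : transition c1 c1' = transition c c' by rewrite /transition co1' pa1.
have i1 : img c1 (coord c p) by rewrite -co1; exact: coord_img.
have i1' : img c1' (coord c' p) by rewrite -co1'; exact: coord_img.
rewrite -(nabla_ricci_restrict ac a1 s1 co1 _ _ _ i1).
rewrite -(nabla_ricci_restrict ac' a1' s1' co1' _ _ _ i1').
by rewrite -tE -co1 -co1'; apply: nabla_ricci_push => //; rewrite D1 D1'.
Qed.

End Transform.

(** * Normal forms are recurrent and not locally symmetric *)

Section Pointwise.
Variables (R : realType) (V : set (plane R)) (nab : vfield R -> vfield R -> vfield R).
Hypotheses (oV : open V) (Hn : is_connection V nab).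
Local Notation G := (christoffel nab).
Local Notation e_ := (@coord_field R).

Let se i : smooth_on V (e_ i : vfield R).
Proof. exact: smooth_coord_field. Qed.

Lemma nabla_ricci_coord m j k x : V x ->
  nabla_ricci nab (e_ m) (e_ j) (e_ k) x = nabla_rho nab m j k x.
Proof.
move=> Vx; rewrite (nabla_ricciE oV Hn (se m) (se j) (se k) Vx) /coord_field /cst.
move: (nabla_rho nab) => N.
case: (ordI2 m) => ->; case: (ordI2 j) => ->; case: (ordI2 k) => ->;
  rewrite -> ?e00, ?e01, ?e10, ?e11;
  repeat match goal with |- context [N ?i ?j ?k x] => generalize (N i j k x) end;
  intros; ring.
Qed.

Lemma parallel_curvature_rho m j k x : V x ->
  nabla_curvature nab (e_ m) (e_ 0) (e_ 1) (e_ k) x = 0 -> nabla_rho nab m j k x = 0.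
Proof.
move=> Vx; rewrite (nabla_curvature_ricci oV Hn (se m) (se 0) (se 1) (se k) Vx).
rewrite !(nabla_ricci_coord _ _ _ Vx) /coord_field /cst => E.
have E0 := congr1 (fun v : plane R => v 0 0) E.
have E1 := congr1 (fun v : plane R => v 0 1) E.
move: E0 E1; cbv beta; rewrite !(rowB, rowZ) ![(0 : 'rV_2) _ _]mxE.
rewrite -> e00, e01, e10, e11; move: (nabla_rho nab) => N.
by case: (ordI2 j) => ->; move: (N m 0 k x) (N m 1 k x) => a b; lra.
Qed.

(** Skew forms are sections of a line bundle, and a nowhere vanishing section of a
    line bundle is recurrent. *)
Lemma skew_recurrent m j k x : (forall y, V y -> forall j k, rho nab j k y = - rho nab k j y) ->
  V x -> rho nab 0 1 x != 0 ->
  nabla_rho nab m j k x = nabla_rho nab m 0 1 x / rho nab 0 1 x * rho nab j k x.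
Proof.
move=> sk Vx r0.
have rjj j' y : V y -> rho nab j' j' y = 0.
  move=> Vy; have := sk y Vy j' j' => /eqP.
  by rewrite -addr_eq0 -mulr2n mulrn_eq0 => /eqP.
have pN j' k' : partial m (rho nab j' k') x = - partial m (rho nab k' j') x.
  rewrite (eq_partial oV m (fun y Vy => sk y Vy j' k') Vx).
  by apply: partialN; exact: (Cinf_diff (rho_Cinf oV Hn k' j') Vx).
have pjj j' : partial m (rho nab j' j') x = 0.
  rewrite (eq_partial (g := fun=> 0) oV m (fun y Vy => rjj j' y Vy) Vx).
  by rewrite partialE derive_cst.
have s10 : rho nab 1 0 x = - rho nab 0 1 x by exact: sk.
have p10 : partial m (rho nab 1 0) x = - partial m (rho nab 0 1) x by exact: pN.
have z0 := rjj 0 x Vx; have z1 := rjj 1 x Vx; have q0 := pjj 0; have q1 := pjj 1.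
rewrite /nabla_rho; clear sk rjj pN pjj.
move: r0 s10 p10 z0 z1 q0 q1.
case: (ordI2 j) => ->; case: (ordI2 k) => ->; abstract_tensors; abstract_atoms;
  move=> *; subst; by field.
Qed.

Section NormalForm.
Variable phi : plane R -> R.
Hypothesis Cphi : Cinf V phi.
Hypothesis Gphi : forall x, V x -> forall i j k : 'I_2, G i j k x =
       if [&& i == 0, j == 0 & k == 0] then - partial 0 phi x
       else if [&& i == 1, j == 1 & k == 1] then partial 1 phi x
       else 0.
Local Notation f := (partial 1 (partial 0 phi)).

Let G000 x : V x -> G 0 0 0 x = - partial 0 phi x.
Proof. by move=> Vx; rewrite Gphi. Qed.
Let G111 x : V x -> G 1 1 1 x = partial 1 phi x.
Proof. by move=> Vx; rewrite Gphi. Qed.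
Let Gz (i j k : 'I_2) : ~~ [&& i == 0, j == 0 & k == 0] -> ~~ [&& i == 1, j == 1 & k == 1] ->
  forall x, V x -> G i j k x = 0.
Proof. by move=> /negbTE h0 /negbTE h1 x Vx; rewrite Gphi// h0 h1. Qed.
Let pGz (i j k m : 'I_2) x : ~~ [&& i == 0, j == 0 & k == 0] -> ~~ [&& i == 1, j == 1 & k == 1] ->
  V x -> partial m (G i j k) x = 0.
Proof.
move=> h0 h1 Vx; rewrite (eq_partial (g := fun=> 0) oV m (Gz h0 h1) Vx).
by rewrite partialE derive_cst.
Qed.

Lemma normal_form_curv_coef k l x : V x ->
  curv_coef nab k l x = if k == l then f x else 0.
Proof.
move=> Vx; rewrite /curv_coef.
have C0 : Cinf V (partial 0 phi) by exact: Cinf_partial.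
have e0 := eq_partial oV 1 G000 Vx; have e1 := eq_partial oV 0 G111 Vx.
have S : partial 0 (partial 1 phi) x = f x by exact: Schwarz oV (Cphi 2) Vx.
have eN : partial 1 (fun y => - partial 0 phi y) x = - f x.
  by apply: partialN; exact: (Cinf_diff C0 Vx).
move: (G000 Vx) (G111 Vx) e0 e1 eN S.
move: (Gz (i := 0) (j := 1) (k := 0) isT isT Vx) (Gz (i := 0) (j := 1) (k := 1) isT isT Vx).
move: (Gz (i := 1) (j := 0) (k := 0) isT isT Vx) (Gz (i := 1) (j := 0) (k := 1) isT isT Vx).
move: (Gz (i := 0) (j := 0) (k := 1) isT isT Vx) (Gz (i := 1) (j := 1) (k := 0) isT isT Vx).
move: (pGz (i := 0) (j := 1) (k := 0) 1 isT isT Vx) (pGz (i := 0) (j := 1) (k := 1) 1 isT isT Vx).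
move: (pGz (i := 1) (j := 0) (k := 0) 0 isT isT Vx) (pGz (i := 1) (j := 0) (k := 1) 0 isT isT Vx).
move: (pGz (i := 0) (j := 0) (k := 1) 1 isT isT Vx) (pGz (i := 1) (j := 1) (k := 0) 0 isT isT Vx).
case: (ordI2 k) => ->; case: (ordI2 l) => -> /=; abstract_atoms; move=> *; subst; ring.
Qed.

Lemma normal_form_rho j k x : V x ->
  rho nab j k x = if j == k then 0 else if j == 0 then - f x else f x.
Proof.
move=> Vx; rewrite (rhoE oV Hn _ _ Vx) !(normal_form_curv_coef _ _ Vx).
by case: (ordI2 j) => ->; case: (ordI2 k) => ->; rewrite /= ?oppr0.
Qed.

(** The recurrence form has differential - 2 f du_0 ^ du_1, so it cannot vanish
    where f does not. *)
Lemma normal_form_not_parallel x : V x -> f x != 0 ->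
  ~ (forall m y, V y -> nabla_rho nab m 0 1 y = 0).
Proof.
move=> Vx fx0 par.
have C0 : Cinf V (partial 0 phi) by exact: Cinf_partial.
have C1 : Cinf V (partial 1 phi) by exact: Cinf_partial.
have Cf : Cinf V f by exact: Cinf_partial.
have r01 y : V y -> rho nab 0 1 y = - f y by move=> Vy; rewrite normal_form_rho.
have pf m y : V y -> partial m f y = (G m 0 0 y + G m 1 1 y) * f y.
  move=> Vy; have := par m y Vy; rewrite /nabla_rho (eq_partial oV m r01 Vy).
  rewrite partialN; last exact: (Cinf_diff Cf Vy).
  rewrite !(normal_form_rho _ _ Vy) /=.
  move: (partial m f y) (f y) => a b.
  abstract_atoms => u v w z E.
  by move: E; rewrite !mulr0 !subr0 => E; lra.
have p0 y : V y -> partial 0 f y = - partial 0 phi y * f y.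
  by move=> Vy; rewrite pf// G000// (@Gz 0 1 1)// addr0.
have p1 y : V y -> partial 1 f y = partial 1 phi y * f y.
  by move=> Vy; rewrite pf// (@Gz 1 0 0)// G111// add0r.
have := Schwarz 0 1 oV (Cf 2) Vx.
rewrite (eq_partial oV 0 p1 Vx) (eq_partial oV 1 p0 Vx).
rewrite partialM; [|exact: (Cinf_diff C1 Vx)|exact: (Cinf_diff Cf Vx)].
rewrite partialM; [|exact: (Cinf_diff (CinfN oV C0) Vx)|exact: (Cinf_diff Cf Vx)].
rewrite partialN; last exact: (Cinf_diff C0 Vx).
rewrite p0// p1// (Schwarz 0 1 oV (Cphi 2) Vx).
move: fx0; move: (f x) (partial 0 phi x) (partial 1 phi x) => a b d a0 E.
have : 2 * a ^+ 2 = 0 by lra.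
by move/eqP; rewrite mulf_eq0 pnatr_eq0 /= sqrf_eq0 (negbTE a0).
Qed.

End NormalForm.

End Pointwise.

Section Converse.
Variables (R : realType) (S : surface R) (D : affine_connection S).
Hypothesis NF : forall p : S, exists c : chart R S, [/\ atlas c, dom c p &
    exists2 phi : plane R -> R, smooth_on (img c) phi & has_normal_form D c phi].

Lemma normal_form_Cinf (c : chart R S) phi : smooth_on (img c) phi ->
  has_normal_form D c phi -> Cinf (img c) phi /\
  forall x, img c x ->
    (forall i j k : 'I_2, christoffel (nabla D c) i j k x =
       if [&& i == 0, j == 0 & k == 0] then - partial 0 phi x
       else if [&& i == 1, j == 1 & k == 1] then partial 1 phi x
       else 0) /\
    partial 1 (partial 0 phi) x != 0.
Proof.
move=> sphi H; split; first exact/(smooth_Cinf (open_img c)).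
by move=> x /H; rewrite !pderivE.
Qed.

Lemma normal_form_ricci_skew (c : chart R S) x j k : atlas c -> img c x ->
  rho (nabla D c) j k x = - rho (nabla D c) k j x.
Proof.
move=> ac [p dp <-]; have [c0 [a0 dp0 [phi sphi nf]]] := NF p.
have [Cphi nf'] := normal_form_Cinf sphi nf.
have ix := coord_img dp0.
rewrite /rho !(ricci_transform D _ _ ac a0 dp dp0).
set v := derive _ _ _; set w := derive _ _ _.
have s u : smooth_on (img c0) (cst u : vfield R) by apply: smooth_cst; exact: open_img.
rewrite !(ricci_rho (open_img c0) (nablaP D a0) (s _) (s _) ix) /cst.
have R0 := normal_form_rho (open_img c0) (nablaP D a0) Cphi (fun x ix => (nf' x ix).1).
move: (R0 0 0 _ ix) (R0 0 1 _ ix) (R0 1 0 _ ix) (R0 1 1 _ ix) => /=.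
abstract_tensors; abstract_atoms; move=> *; subst; ring.
Qed.

Lemma normal_form_ricci_neq0 (c : chart R S) x : atlas c -> img c x ->
  rho (nabla D c) 0 1 x != 0.
Proof.
move=> ac ix'; apply/negP => /eqP r0; have sk := normal_form_ricci_skew _ _ ac ix'.
have rz j k : rho (nabla D c) j k x = 0.
  have rjj j' : rho (nabla D c) j' j' x = 0.
    by have /eqP := sk j' j'; rewrite -addr_eq0 -mulr2n mulrn_eq0 => /eqP.
  have r1 : rho (nabla D c) 1 0 x = 0 by rewrite sk r0 oppr0.
  by case: (ordI2 j) => ->; case: (ordI2 k) => ->; [exact: rjj|exact: r0|exact: r1|exact: rjj].
have [p dp px] := ix'; have [c0 [a0 dp0 [phi sphi nf]]] := NF p.
have [Cphi nf'] := normal_form_Cinf sphi nf.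
have ix := coord_img dp0.
have : rho (nabla D c0) 1 0 (coord c0 p) = 0.
  rewrite /rho (ricci_transform D _ _ a0 ac dp0 dp) px.
  set v := derive _ _ _; set w := derive _ _ _.
  have s u : smooth_on (img c) (cst u : vfield R) by apply: smooth_cst; exact: open_img.
  rewrite (ricci_rho (open_img c) (nablaP D ac) (s _) (s _) ix') /cst.
  move: (rz 0 0) (rz 0 1) (rz 1 0) (rz 1 1).
  abstract_tensors; abstract_atoms; move=> *; subst; ring.
rewrite (normal_form_rho (open_img c0) (nablaP D a0) Cphi (fun x ix => (nf' x ix).1) _ _ ix) /=.
by apply/eqP; exact: (nf' _ ix).2.
Qed.

Definition recurrence_form (c : chart R S) (x : plane R) : 'cV[R]_2 :=
  \col_i (nabla_rho (nabla D c) i 0 1 x / rho (nabla D c) 0 1 x).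

Lemma recurrence_formE (c : chart R S) (W Y Z : vfield R) x : atlas c ->
  smooth_on (img c) W -> smooth_on (img c) Y -> smooth_on (img c) Z -> img c x ->
  nabla_ricci (nabla D c) W Y Z x =
  (W x *m recurrence_form c x) 0 0 * ricci (nabla D c) Y Z x.
Proof.
move=> ac sW sY sZ ix; have oc := open_img c; have Hn := nablaP D ac.
rewrite (nabla_ricciE oc Hn sW sY sZ ix) (ricci_rho oc Hn sY sZ ix).
have K m j k := skew_recurrent oc Hn m j k (fun y iy j k => normal_form_ricci_skew j k ac iy) ix
  (normal_form_ricci_neq0 ac ix).
have -> : (W x *m recurrence_form c x) 0 0 =
  W x 0 0 * (nabla_rho (nabla D c) 0 0 1 x / rho (nabla D c) 0 1 x) +
  W x 0 1 * (nabla_rho (nabla D c) 1 0 1 x / rho (nabla D c) 0 1 x).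
  by rewrite mxE sumI2 ![recurrence_form _ _ _ _]mxE.
move: (K 0 0 0) (K 0 1 0) (K 0 1 1) (K 1 0 0) (K 1 1 0) (K 1 1 1) (K 0 0 1) (K 1 0 1).
move: (_ / _) (_ / _) => a b; abstract_tensors; abstract_atoms.
by move=> *; subst; ring.
Qed.

Lemma normal_form_recurrent : recurrent D.
Proof.
unshelve eexists (@OneForm R S recurrence_form _ _).
- move=> c ac; have oc := open_img c; have Hn := nablaP D ac.
  apply/(smooth_on_mxP _ oc) => k j; apply/(smooth_Cinf oc).
  have C1 : Cinf (img c) (nabla_rho (nabla D c) k 0 1).
    have CR j' k' := rho_Cinf oc Hn j' k'; have CG i' j' k' := G_Cinf oc Hn i' j' k'.
    by rewrite /nabla_rho; solve_Cinf.
  have C2 : Cinf (img c) (fun x => (rho (nabla D c) 0 1 x)^-1).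
    apply: (CinfV oc); last exact: rho_Cinf.
    by move=> x ix; exact: normal_form_ricci_neq0.
  by apply: (Cinf_ext oc _ (CinfM oc C1 C2)) => x ix; rewrite [RHS]mxE.
- move=> c c' ac ac' p v dp dp'.
  have ix := coord_img dp; have ix' := coord_img dp'.
  have s u : smooth_on (img c) (cst u : vfield R) by apply: smooth_cst; exact: open_img.
  have s' u : smooth_on (img c') (cst u : vfield R) by apply: smooth_cst; exact: open_img.
  have r0 : ricci (nabla D c) (cst (delta_mx 0 0)) (cst (delta_mx 0 1)) (coord c p) != 0.
    exact: normal_form_ricci_neq0 ac ix.
  have := nabla_ricci_transform D v (delta_mx 0 0) (delta_mx 0 1) ac ac' dp dp'.
  rewrite (recurrence_formE ac (s _) (s _) (s _) ix).
  rewrite (recurrence_formE ac' (s' _) (s' _) (s' _) ix').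
  rewrite -(ricci_transform D _ _ ac ac' dp dp') => /(mulIf r0) E.
  by apply/matrixP => a b; rewrite (ord1 a) (ord1 b).
by move=> c ac W Y Z sW sY sZ x ix; exact: recurrence_formE.
Qed.

Lemma normal_form_not_symmetric : [set: S] !=set0 -> ~ locally_symmetric D.
Proof.
move=> [p _] sym; have [c [ac dp [phi sphi nf]]] := NF p.
have [Cphi nf'] := normal_form_Cinf sphi nf.
have ix := coord_img dp; have oc := open_img c; have Hn := nablaP D ac.
apply: (normal_form_not_parallel oc Hn Cphi (fun x ix => (nf' x ix).1) ix (nf' _ ix).2).
move=> m y iy; have s i : smooth_on (img c) (@coord_field R i) by exact: smooth_coord_field.
by apply: (parallel_curvature_rho oc Hn) => //; exact: sym.
Qed.

End Converse.

(** * Primitives *)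

Section Primitive.
Variable R : realType.

Lemma is_derive_eps (f : R -> R) s l :
  (forall eta, 0 < eta -> \forall s' \near s,
     `|f s' - f s - (s' - s) * l| <= eta * `|s' - s|) -> is_derive s 1 f l.
Proof.
move=> H.
have L : h^-1 *: ((f \o shift s) (h *: (1 : R)) - f s) @[h --> 0^'] --> l.
  apply/cvgrPdist_le => eta eta0.
  have [r /= r0 Hr] := (nbhs_ballP _ _).1 (H _ eta0).
  exists r => //= h; rewrite /= sub0r normrN => hr h0.
  have -> : h *: (1 : R) = h by exact: mulr1.
  have := Hr (h + s); rewrite -ball_normE /= addrK opprD addrCA subrr addr0 normrN.
  move=> /(_ hr); rewrite -ler_pdivrMr ?normr_gt0// -normrV ?unitfE// -normrM.
  rewrite distrC; apply: le_trans; rewrite le_eqVlt; apply/orP; left; apply/eqP.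
  congr (`|_|); rewrite mulrBl mulrAC divff// mul1r; congr (_ - _).
  exact: mulrC.
split; last exact: cvg_lim L.
by apply/cvg_ex; exists l.
Qed.

Lemma slice1 (f : 'rV[R]_2 -> R) (s t l : R) :
  is_derive t 1 (fun t => f (pt s t)) l <->
  is_derive (pt s t) (delta_mx 0 1 : 'rV[R]_2) f l.
Proof.
have E : (fun h : R => h^-1 *: (((fun t => f (pt s t)) \o shift t) (h *: 1)
     - f (pt s t))) =
   (fun h => h^-1 *: ((f \o shift (pt s t)) (h *: delta_mx 0 1) - f (pt s t))).
  apply/funext => h /=; congr (_ *: (f _ - _)).
    by apply: rV2P; rewrite rowD rowZ ?pt0 ?pt1 ?eE ?mulr0 ?add0r.
by split=> -[d1 d2]; split; move: d1 d2; rewrite /derivable /derive E.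
Qed.

Lemma slice0 (f : 'rV[R]_2 -> R) (s t l : R) :
  is_derive s 1 (fun s => f (pt s t)) l <->
  is_derive (pt s t) (delta_mx 0 0 : 'rV[R]_2) f l.
Proof.
have E : (fun h : R => h^-1 *: (((fun s => f (pt s t)) \o shift s) (h *: 1)
     - f (pt s t))) =
   (fun h => h^-1 *: ((f \o shift (pt s t)) (h *: delta_mx 0 0) - f (pt s t))).
  apply/funext => h /=; congr (_ *: (f _ - _)).
    by apply: rV2P; rewrite rowD rowZ ?pt0 ?pt1 ?eE ?mulr0 ?add0r.
by split=> -[d1 d2]; split; move: d1 d2; rewrite /derivable /derive E.
Qed.

Lemma primitive_continuous (h : R -> R) (t0 d : R) : 0 < d ->
  (forall t, {for t, continuous h}) ->
  exists2 H : R -> R, H t0 = 0 &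
    forall t, `|t - t0| <= d -> is_derive t 1 H (h t).
Proof.
move=> d0 ch.
(* The base point lies to the left of the interval, so that t0 is interior. *)
pose a := t0 - d - 1; pose u := t0 + d + 1.
have ih : (@lebesgue_measure R).-integrable `[a, u] (EFin \o h).
  apply: continuous_compact_integrable; first exact: segment_compact.
  by apply: continuous_subspaceT => t; exact: ch.
pose F x := (\int[@lebesgue_measure R]_(t in [set` `[a, x]]) (h t))%R.
exists (fun t => F t - F t0) => [|t]; first by rewrite subrr.
rewrite ler_norml => /andP[t1 t2].
have [||dF FE] := @continuous_FTC1_closed _ h a t u _ ih _ (ch t).
- by rewrite /u; lra.
- by rewrite /a; lra.
have dF' : is_derive t 1 F (h t) by split; [exact: dF|rewrite -derive1E; exact: FE].
have -> : h t = h t - 0 by rewrite subr0.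
by move: dF'; move: (F t0) => c dF'; apply: is_deriveB.
Qed.

(** Clamping the argument extends a function given on an interval to a continuous
    function on the line. *)
Lemma clamp_continuous (t0 d : R) :
  continuous (fun t : R => Num.max (t0 - d) (Num.min (t0 + d) t)).
Proof.
move=> t; apply: (@continuous_max _ _ (cst (t0 - d))); first exact: cst_continuous.
by apply: (@continuous_min _ _ (cst (t0 + d)) id); [exact: cst_continuous|exact: cvg_id].
Qed.

Lemma clampE (t0 d t : R) : `|t - t0| <= d ->
  Num.max (t0 - d) (Num.min (t0 + d) t) = t.
Proof.
rewrite ler_distl => /andP[t1 t2].
by rewrite (min_idPr t2) (max_idPr t1).
Qed.

Lemma clamp_le (t0 d t : R) : 0 <= d ->
  `|Num.max (t0 - d) (Num.min (t0 + d) t) - t0| <= d.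
Proof.
move=> d0; rewrite ler_distl le_max lexx /= ge_max ge_min lexx /= andbT.
by lra.
Qed.

Lemma bounded_derivative (e de : R -> R) (t0 d eta : R) : 0 <= d -> 0 <= eta ->
  e t0 = 0 -> (forall t, `|t - t0| <= d -> is_derive t 1 e (de t)) ->
  (forall t, `|t - t0| <= d -> `|de t| <= eta) ->
  forall t, `|t - t0| <= d -> `|e t| <= 2 * d * eta.
Proof.
move=> d0 eta0 et0 He Hde.
apply: (@short_gronwall R e de t0 d 0 eta) => //; first by rewrite mulr0.
by move=> t /Hde; rewrite mul0r add0r.
Qed.

Lemma primitive_unique (e f h : R -> R) (t0 d : R) : 0 <= d ->
  e t0 = 0 -> f t0 = 0 -> (forall t, `|t - t0| <= d -> is_derive t 1 e (h t)) ->
  (forall t, `|t - t0| <= d -> is_derive t 1 f (h t)) ->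
  forall t, `|t - t0| <= d -> e t = f t.
Proof.
move=> d0 e0 f0 de df t td; apply/eqP; rewrite -subr_eq0 -normr_le0.
have := @bounded_derivative (fun t => e t - f t) (fun=> 0) t0 d 0 d0 (lexx 0).
rewrite e0 f0 subrr mulr0 => /(_ erefl); apply => //.
  move=> u ud; rewrite -[X in is_derive _ _ _ X](subrr (h u)).
  by apply: is_deriveB; [exact: de|exact: df].
by move=> u _; rewrite normr0.
Qed.

Lemma near_dist (s s0 r : R) : `|s - s0| < r -> \forall u \near s, `|u - s0| < r.
Proof.
move=> sr; have /cvgrPdist_lt : {for s, continuous (fun u : R => `|u - s0|)}.
  apply: (@continuous_comp _ _ _ (fun u : R => u - s0) Num.norm).
    by apply: continuousB; [exact: cvg_id|exact: cst_continuous].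
  exact: norm_continuous.
move=> /(_ (r - `|s - s0|)); rewrite subr_gt0 => /(_ sr).
by apply: filterS => u; rewrite ltr_norml => /andP[]; lra.
Qed.

(** Primitives on smaller intervals agree by uniqueness. They are glued by
    evaluating at t the one on the interval that reaches halfway from t to the
    boundary. *)
Lemma primitive_open (h : R -> R) (t0 r : R) : 0 < r ->
  (forall t, `|t - t0| < r -> {for t, continuous h}) ->
  exists2 H : R -> R, H t0 = 0 &
    forall t, `|t - t0| < r -> is_derive t 1 H (h t).
Proof.
move=> r0 ch.
have [F HF] : exists F : R -> R -> R, forall d : R, 0 < d < r -> F d t0 = 0 /\
    forall t, `|t - t0| <= d -> is_derive t 1 (F d) (h t).
  suff H : forall d : R, exists H : R -> R, 0 < d < r -> H t0 = 0 /\
      forall t, `|t - t0| <= d -> is_derive t 1 H (h t).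
    by have [F HF] := boolp.choice H; exists F.
  move=> d.
  have [/andP[d0 dr]|_] := boolP (0 < d < r); last by exists h.
  pose cl t := Num.max (t0 - d) (Num.min (t0 + d) t).
  have [|H H0 HH] := @primitive_continuous (h \o cl) t0 d d0.
    move=> t; apply: continuous_comp; first exact: clamp_continuous.
    by apply: ch; apply: le_lt_trans dr; apply: clamp_le; exact: ltW.
  exists H => _; split=> // t td; have := HH t td.
  by rewrite /= /cl clampE.
pose D t := (`|t - t0| + r) / 2.
have DI t : `|t - t0| < r -> `|t - t0| < D t /\ 0 < D t < r.
  by move=> tr; have := normr_ge0 (t - t0); rewrite /D; split; [lra|apply/andP; split; lra].
exists (fun t => F (D t) t) => [|t tr].
  by have [] := HF (D t0) (DI t0 _).2; rewrite ?subrr ?normr0.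
have [tD DtI] := DI t tr.
have [H0 H1] := HF _ DtI.
have : is_derive t 1 (F (D t)) (h t) by apply: H1; exact: ltW.
have N' : \forall u \near t, F (D t) u = F (D u) u.
  have := near_dist tD.
  apply: filterS => u uD.
  have ur : `|u - t0| < r by apply: lt_trans uD _; case/andP: DtI.
  have [uDu DuI] := DI u ur.
  have [G0 G1] := HF _ DuI.
  apply: (@primitive_unique _ _ h t0 `|u - t0|) => // v vu; [apply: H1|apply: G1].
    exact: le_trans vu (ltW uD).
  exact: le_trans vu (ltW uDu).
move=> [d1 d2]; split; last by rewrite -d2; exact/esym/near_eq_derive.
exact: near_eq_derivable N' d1.
Qed.

End Primitive.

Section BoxPrimitive.
Variable R : realType.
Implicit Types s t r a b d e : R.
Implicit Types h f H : 'rV[R]_2 -> R.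

Definition box (s0 t0 r : R) : set 'rV[R]_2 :=
  [set x | `|x 0 0 - s0| < r /\ `|x 0 1 - t0| < r].

Lemma dist_continuous n (j : 'I_n) (a : R) : continuous (fun x : 'rV[R]_n => `|x 0 j - a|).
Proof.
move=> x; apply: (@continuous_comp _ _ _ (fun x : 'rV[R]_n => x 0 j - a) Num.norm);
  last exact: norm_continuous.
apply: (@continuousB _ _ _ (fun x : 'rV[R]_n => x 0 j) (cst a)).
  exact: coord_continuous.
exact: cst_continuous.
Qed.

Lemma open_box (s0 t0 r : R) : open (box s0 t0 r).
Proof.
by apply: openI; apply: (@open_comp _ _ _ [set u : R | u < r]);
  [move=> x _; exact: dist_continuous|exact: open_lt
  |move=> x _; exact: dist_continuous|exact: open_lt].
Qed.

Definition vertical_primitive (s0 t0 r : R) (H h : 'rV[R]_2 -> R) :=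
  (forall s, `|s - s0| < r -> H (pt s t0) = 0) /\
  (forall x, box s0 t0 r x -> is_derive x (delta_mx 0 1 : 'rV[R]_2) H (h x)).

Lemma box_pt (s0 t0 r : R) s t : box s0 t0 r (pt s t) <-> `|s - s0| < r /\ `|t - t0| < r.
Proof. by rewrite /box /= pt0 pt1. Qed.

Lemma vertical_primitive_slice (s0 t0 r : R) H h s t : vertical_primitive s0 t0 r H h -> `|s - s0| < r ->
  `|t - t0| < r -> is_derive t 1 (fun t => H (pt s t)) (h (pt s t)).
Proof. by move=> [_ HH] sr tr; apply/slice1/HH/box_pt. Qed.

Lemma pt_continuous0 t (s : R) : {for s, continuous (fun s => pt s t : 'rV[R]_2)}.
Proof.
apply: row_continuous => j; case: (j == 0); last exact: cst_continuous.
exact: cvg_id.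
Qed.

Lemma vertical_primitive_exists (s0 t0 r : R) h : 0 < r ->
  (forall x, box s0 t0 r x -> {for x, continuous h}) ->
  exists H, vertical_primitive s0 t0 r H h.
Proof.
move=> r0 ch.
suff /boolp.choice[F HF] : forall s, exists H : R -> R, `|s - s0| < r -> H t0 = 0 /\
    forall t, `|t - t0| < r -> is_derive t 1 H (h (pt s t)).
  exists (fun x => F (x 0 0) (x 0 1)); split=> [s sr|x].
    by rewrite pt0 pt1; exact: (HF s sr).1.
  rewrite (ptE x); move: (x 0 0) (x 0 1) => s t /box_pt[sr tr]; apply/slice1.
  have E : (fun t : R => F (pt s t 0 0) (pt s t 0 1)) = F s.
    by apply/funext => u; rewrite pt0 pt1.
  by move: ((HF s sr).2 t tr); rewrite -E.
move=> s; have [sr|_] := boolP (`|s - s0| < r); last by exists (fun=> 0).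
have [|H H0 H1] := @primitive_open R (fun t => h (pt s t)) t0 r r0; last by exists H.
move=> t tr; apply: (@continuous_comp _ _ _ (pt s) h).
  exact: pt_continuous1.
by apply/ch/box_pt.
Qed.

Lemma between (d r t0 : R) : d < r -> forall t, t0 - d <= t <= t0 + d -> `|t - t0| < r.
Proof. by move=> dr t; rewrite -ler_distl => td; exact: le_lt_trans td dr. Qed.

Lemma intermediate_radius (r a : R) : `|a| < r -> exists2 d, `|a| < d & 0 < d < r.
Proof.
move=> ar; exists ((`|a| + r) / 2); have := normr_ge0 a; first by lra.
by move=> a0; apply/andP; split; lra.
Qed.

Lemma vertical_primitive_continuous (s0 t0 r : R) H h : 
  (forall x, box s0 t0 r x -> {for x, continuous h}) -> vertical_primitive s0 t0 r H h ->
  forall x, box s0 t0 r x -> {for x, continuous H}.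
Proof.
move=> ch HH x Bx; apply/(@cvgrPdist_lt _ R^o _ (nbhs x)) => e e0.
move: Bx; rewrite (ptE x); move: (x 0 0) (x 0 1) => s t /box_pt[sr tr].
have [d td /andP[d0 dr]] := intermediate_radius tr.
have eta0 : 0 < e / (4 * d) by rewrite divr_gt0// mulr_gt0.
have T := tube (@open_box s0 t0 r) _ ch eta0.
have {}T := T s (t0 - d) (t0 + d).
have {T} : \forall s' \near s, forall u, t0 - d <= u <= t0 + d ->
    box s0 t0 r (pt s' u) /\ `|h (pt s' u) - h (pt s u)| < e / (4 * d).
  by apply: T => u /(between dr) ud; apply/box_pt.
move=> /(nbhs_ballP _ _).1 [r1 /= r10 Hr1].
have : {for t, continuous (fun u => H (pt s u))}.
  apply: differentiable_continuous; apply/derivable1_diffP.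
  by have [] := vertical_primitive_slice HH sr tr.
move=> /cvgrPdist_lt/(_ (e / 2)); rewrite divr_gt0// => /(_ isT) nH.
have [r2 /= r20 Hr2] := (nbhs_ballP _ _).1 (filterI nH (near_dist td)).
apply/nbhs_ballP; exists (Num.min r1 r2); first by rewrite /= lt_min r10.
move=> y; rewrite (ptE y) -ball_normE /=; move: (y 0 0) (y 0 1) => s' t' yb.
have b1 : `|s - s'| < r1.
  have := coord_le_norm (pt s t - pt s' t') 0; rewrite rowB !pt0 => /le_lt_trans; apply.
  by apply: lt_le_trans yb _; rewrite ge_min lexx.
have b2 : `|t - t'| < r2.
  have := coord_le_norm (pt s t - pt s' t') 1; rewrite rowB !pt1 => /le_lt_trans; apply.
  by apply: lt_le_trans yb _; rewrite ge_min lexx orbT.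
have {Hr2} [H2 t'd] : `|H (pt s t) - H (pt s t')| < e / 2 /\ `|t' - t0| < d.
  by apply: Hr2; rewrite -ball_normE.
have {}Hr1 u : t0 - d <= u <= t0 + d ->
  box s0 t0 r (pt s' u) /\ `|h (pt s' u) - h (pt s u)| < e / (4 * d).
  by apply: Hr1; rewrite -ball_normE.
have s'r : `|s' - s0| < r.
  have /Hr1[/box_pt[]//] : t0 - d <= t0 <= t0 + d by apply/andP; split; lra.
have B : `|H (pt s' t') - H (pt s t')| <= 2 * d * (e / (4 * d)).
  apply: (@bounded_derivative R (fun t => H (pt s' t) - H (pt s t))
     (fun t => h (pt s' t) - h (pt s t)) t0) => //.
  - exact: ltW.
  - exact: ltW.
  - by rewrite !HH.1// subrr.
  - move=> u ud; have ur := le_lt_trans ud dr.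
    apply: is_deriveB; exact: (vertical_primitive_slice HH).
  - by move=> u; rewrite ler_distl => /Hr1[_ /ltW].
  - exact: ltW.
have E2 : 2 * d * (e / (4 * d)) = e / 2 by field; rewrite gt_eqF.
rewrite E2 in B; rewrite (splitr e) -(subrKA (H (pt s t'))).
by apply: le_lt_trans (ler_normD _ _) _; rewrite ltr_leD// distrC.
Qed.

Lemma is_derive_partial n (f : 'rV[R]_n -> R) x i l :
  is_derive x (delta_mx 0 i : 'rV[R]_n) f l -> partial i f x = l.
Proof. by move=> [_]; rewrite partialE. Qed.

Lemma derivable_partial n (f : 'rV[R]_n -> R) x i : differentiable f x ->
  is_derive x (delta_mx 0 i : 'rV[R]_n) f (partial i f x).
Proof. by move=> df; rewrite partialE; apply/derivableP/diff_derivable. Qed.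

Lemma Ck_of_partials k (V : set 'rV[R]_2) (f : 'rV[R]_2 -> R) (p : 'I_2 -> 'rV[R]_2 -> R) :
  open V -> (forall i x, V x -> is_derive x (delta_mx 0 i : 'rV[R]_2) f (p i x)) ->
  (forall i, Ck k V (p i)) -> Ck k.+1 V f.
Proof.
move=> oV dp Cp.
have E i x : V x -> p i x = partial i f x by move=> /(dp i)/is_derive_partial.
have Cf i : Ck k V (partial i f) by apply: Ck_ext oV _ (Cp i); exact: E.
split=> // x Vx; apply: C1_differentiable; last by move=> i; exact: Ck_cont (Cf i) Vx.
have : \forall y \near x, V y by exact: open_nbhs_nbhs.
by apply: filterS => y Vy i; have [] := dp i y Vy.
Qed.

(** Differentiation under the integral sign: the error of the first-order expansion
    in s has a derivative in t that is uniformly small, by the mean value theorem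
    and [tube]. *)
Lemma vertical_primitive_partial0 (s0 t0 r : R) H h H1 : Ck 1 (box s0 t0 r) h ->
  vertical_primitive s0 t0 r H h -> vertical_primitive s0 t0 r H1 (partial 0 h) ->
  forall x, box s0 t0 r x -> is_derive x (delta_mx 0 0 : 'rV[R]_2) H (H1 x).
Proof.
move=> [dh Ch] HH HH1 x; rewrite (ptE x); move: (x 0 0) (x 0 1) => s t /box_pt[sr tr].
apply/slice0; have [d td /andP[d0 dr]] := intermediate_radius tr.
apply: is_derive_eps => e e0.
have eta0 : 0 < e / (2 * d) by rewrite divr_gt0// mulr_gt0.
have T := tube (@open_box s0 t0 r) _ (Ch 0) eta0.
have {}T := T s (t0 - d) (t0 + d).
have {T} : \forall s' \near s, forall u, t0 - d <= u <= t0 + d ->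
    box s0 t0 r (pt s' u) /\ `|partial 0 h (pt s' u) - partial 0 h (pt s u)| < e / (2 * d).
  by apply: T => u /(between dr) ud; apply/box_pt.
move=> /(nbhs_ballP _ _).1 [r1 /= r10 Hr1].
apply/nbhs_ballP; exists r1 => //= s' s'b.
have s'r : `|s' - s0| < r.
  have [|/box_pt[]//] := Hr1 s' s'b t0.
  by apply/andP; split; lra.
have B u : `|u - t0| <= d ->
  `|h (pt s' u) - h (pt s u) - (s' - s) * partial 0 h (pt s u)| <= e / (2 * d) * `|s' - s|.
  move=> ud; have ur := le_lt_trans ud dr.
  have uI : t0 - d <= u <= t0 + d by rewrite -ler_distl.
  have inB (c : R) : 0 <= c <= 1 -> ball s r1 (s + c * (s' - s)).
    move=> /andP[c0 c1]; move: s'b; rewrite -!ball_normE /= opprD addNKr normrN normrM.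
    rewrite (distrC s' s); apply: le_lt_trans; rewrite ler_piMl//.
    by rewrite ger0_norm.
  have ptc (c : R) : pt s u + (c * (s' - s)) *: delta_mx 0 0 = pt (s + c * (s' - s)) u.
    by apply: rV2P; rewrite rowD rowZ ?pt0 ?pt1 ?eE ?mulr0 ?mulr1 ?addr0.
  have [|c cI E] := @MVT_coord R 2 h (pt s u) (s' - s) 0.
    move=> c cI; rewrite ptc; apply: diff_derivable; apply: dh.
    exact: (Hr1 _ (inB c cI) u uI).1.
  have E2 : pt s u + (s' - s) *: delta_mx 0 0 = pt s' u.
    by rewrite -[s' - s]mul1r ptc mul1r addrC subrK.
  rewrite E2 in E; rewrite E ptc -mulrBr normrM mulrC ler_wpM2r//.
  exact: ltW (Hr1 _ (inB c cI) u uI).2.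
have := @bounded_derivative R
  (fun t => H (pt s' t) - H (pt s t) - (s' - s) * H1 (pt s t))
  (fun t => h (pt s' t) - h (pt s t) - (s' - s) * partial 0 h (pt s t)) t0 d
  (e / (2 * d) * `|s' - s|) (ltW d0) _ _ _ B t (ltW td).
have -> : 2 * d * (e / (2 * d) * `|s' - s|) = e * `|s' - s|.
  by field; rewrite gt_eqF.
apply.
- by rewrite mulr_ge0// ltW.
- by rewrite !HH.1// HH1.1// mulr0 !subr0.
- move=> u ud; have ur := le_lt_trans ud dr.
  have D1 := vertical_primitive_slice HH s'r ur.
  have D2 := vertical_primitive_slice HH sr ur.
  have D3 := vertical_primitive_slice HH1 sr ur.
  apply: is_deriveB; apply: is_deriveZ.
Qed.

(** Differentiating in t returns h, and differentiating in s returns the primitive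
    of a derivative of h, which the induction hypothesis covers. *)
Lemma vertical_primitive_Ck k (s0 t0 r : R) H h : 0 < r -> Ck k (box s0 t0 r) h ->
  vertical_primitive s0 t0 r H h -> Ck k (box s0 t0 r) H.
Proof.
move=> r0; elim: k H h => [|k IH] H h Ch HH; first exact: vertical_primitive_continuous HH.
have Ch0 : Ck k (box s0 t0 r) (partial 0 h) by exact: Ch.2.
have [H1 HH1] : exists H1, vertical_primitive s0 t0 r H1 (partial 0 h).
  by apply: vertical_primitive_exists => // x; exact: Ck_cont Ch0.
have C1 : Ck 1 (box s0 t0 r) h.
  by split; [exact: Ch.1|move=> i x; exact: Ck_cont (Ch.2 i)].
apply: (@Ck_of_partials k _ H (fun i => if i == 0 then H1 else h)).
- exact: open_box.
- move=> i x Bx; case: (ordI2 i) => ->.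
    exact: vertical_primitive_partial0 HH HH1 x Bx.
  exact: HH.2.
- by move=> i; case: ifP => _; [exact: IH HH1|exact: CkW].
Qed.

End BoxPrimitive.

(** * Ordinary differential equations depending on a parameter *)

Section Picard.
Variable R : realType.
Implicit Types (y z : R -> R).

Lemma geometric_small (C e : R) : 0 <= C -> 0 < e ->
  exists n, C * 2^-1 ^+ n < e.
Proof.
move=> C0 e0.
have [n Hn] : exists n : nat, C / e < n%:R.
  by exists (Num.bound (C / e)); apply: archi_boundP; rewrite divr_ge0// ltW.
exists n; have P : 0 < (2 : R) ^+ n by rewrite exprn_gt0.
rewrite exprVn ltr_pdivrMr// -ltr_pdivrMl// mulrC.
apply: lt_trans Hn _; rewrite -natrX ltr_nat.
exact: ltn_expl.
Qed.

Definition everywhere_continuous y := forall t, {for t, continuous y}.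

(** Successive approximations W n, started at 0. Each step halves the distance of
    two functions, so W n - 2 C / 2^n increases with n and stays below every W m + 2
    C / 2^m; its supremum is the solution. *)
Lemma picard (g : R -> R -> R) (t0 d L M : R) : 0 < d -> 0 <= L -> 0 <= M ->
  2 * d * L <= 2^-1 ->
  (forall y, everywhere_continuous y -> everywhere_continuous (fun t => g t (y t))) ->
  (forall t u v, `|t - t0| <= d -> `|g t u - g t v| <= L * `|u - v|) ->
  (forall t u, `|t - t0| <= d -> `|g t u| <= M) ->
  exists2 w : R -> R, w t0 = 0 &
    forall t, `|t - t0| <= d -> is_derive t 1 w (g t (w t)).
Proof.
move=> d0 L0 M0 dL gc gL gM.
pose cl t := Num.max (t0 - d) (Num.min (t0 + d) t).
have clI t : `|cl t - t0| <= d by apply: clamp_le; exact: ltW.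
have clK t : `|t - t0| <= d -> cl t = t by exact: clampE.
have : forall y, exists H : R -> R, everywhere_continuous y ->
    H t0 = 0 /\ forall t, `|t - t0| <= d -> is_derive t 1 H (g t (y t)).
  move=> y; have [cy|] := pselect (everywhere_continuous y); last by exists y.
  by have [H H0 H1] := @primitive_continuous R (fun t => g t (y t)) t0 d d0 (gc y cy); exists H.
move=> /boolp.choice[P HP].
pose Phi y := P y \o cl.
have cPhi y : everywhere_continuous y -> everywhere_continuous (Phi y).
  move=> cy t; apply: continuous_comp; first exact: clamp_continuous.
  apply: differentiable_continuous; apply/derivable1_diffP.
  by have [] := (HP y cy).2 _ (clI t).
have PhiE y t : `|t - t0| <= d -> Phi y t = P y t by move=> td; rewrite /Phi /= clK.
have contraction y z c : everywhere_continuous y -> everywhere_continuous z -> 0 <= c ->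
    (forall t, `|t - t0| <= d -> `|y t - z t| <= c) ->
    forall t, `|t - t0| <= d -> `|Phi y t - Phi z t| <= 2^-1 * c.
  move=> cy cz c0 yz t td; rewrite !PhiE//.
  have [Py0 Py] := HP y cy; have [Pz0 Pz] := HP z cz.
  have B := @bounded_derivative R (fun t => P y t - P z t)
    (fun t => g t (y t) - g t (z t)) t0 d (L * c) (ltW d0) _ _ _ _ t td.
  apply: le_trans (B _ _ _ _) _.
  - by rewrite mulr_ge0.
  - by rewrite Py0 Pz0 subrr.
  - by move=> u ud; apply: is_deriveB; [exact: Py|exact: Pz].
  - by move=> u ud; apply: le_trans (gL _ _ _ ud) _; rewrite ler_wpM2l// yz.
  - by rewrite mulrA ler_wpM2r.
have cst0 : everywhere_continuous (fun=> 0) by move=> t; exact: cst_continuous.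
pose W n := iter n Phi (fun=> 0).
have cW n : everywhere_continuous (W n) by elim: n => //= n IH; exact: cPhi.
pose C := 2 * d * M.
have C0 : 0 <= C by rewrite !mulr_ge0// ltW.
have half0 n : 0 <= C * 2^-1 ^+ n by rewrite mulr_ge0// exprn_ge0// invr_ge0.
have step n t : `|t - t0| <= d -> `|W n.+1 t - W n t| <= C * 2^-1 ^+ n.
  elim: n t => [|n IH] t td.
    rewrite expr0 mulr1 /= subr0 PhiE//; have [P0 P1] := HP _ cst0.
    apply: (@bounded_derivative R (P (fun=> 0)) (fun t => g t 0) t0 d M) => //.
    - exact: ltW.
    - by move=> u ud; exact: gM.
  rewrite exprS mulrCA.
  exact: (@contraction (W n.+1) (W n)).
have tele n k t : `|t - t0| <= d ->
    `|W (n + k)%N t - W n t| <= 2 * C * 2^-1 ^+ n * (1 - 2^-1 ^+ k).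
  move=> td; elim: k => [|k IH]; first by rewrite addn0 !subrr normr0 mulr0.
  rewrite addnS -(subrKA (W (n + k)%N t)); apply: le_trans (ler_normD _ _) _.
  apply: le_trans (lerD (step _ _ td) IH) _.
  rewrite le_eqVlt; apply/orP; left; apply/eqP.
  by rewrite exprD exprS; field.
pose E n := 2 * C * 2^-1 ^+ n.
have E0 n : 0 <= E n by rewrite /E -mulrA mulr_ge0.
have WW n m t : (n <= m)%N -> `|t - t0| <= d -> `|W m t - W n t| <= E n.
  move=> nm td; rewrite -(subnKC nm); apply: le_trans (tele _ _ _ td) _.
  by rewrite ler_piMr ?E0// lerBlDr lerDl exprn_ge0// invr_ge0.
have EW n m t : (n <= m)%N -> W m t - E m <= W m t by move=> _; rewrite lerBlDr lerDl.
pose w t := sup [set W n t - E n | n in setT].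
have bnd n m t : `|t - t0| <= d -> W n t - E n <= W m t + E m.
  move=> td; have := E0 n; have := E0 m.
  have [nm|/ltnW mn] := leqP n m.
    by have := WW _ _ _ nm td; rewrite ler_norml => /andP[]; lra.
  by have := WW _ _ _ mn td; rewrite ler_norml => /andP[]; lra.
have wW n t : `|t - t0| <= d -> `|w t - W n t| <= E n.
  move=> td; rewrite ler_distl; apply/andP; split.
    apply: ub_le_sup; last by exists n.
    by exists (W 0%N t + E 0%N) => _ [m _ <-]; exact: bnd.
  apply: ge_sup; first by exists (W 0%N t - E 0%N); exists 0%N.
  by move=> _ [m _ <-]; exact: bnd.
have small e : 0 < e -> exists n, E n < e.
  by move=> e0; apply: geometric_small => //; rewrite mulr_ge0.
pose wc := w \o cl.
have cwc : everywhere_continuous wc.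
  move=> t; apply/(@cvgrPdist_lt _ R^o _ (nbhs t)) => e e0.
  have [n En] := small (e / 3) (divr_gt0 e0 (ltr0n _ 3)).
  have : {for t, continuous (W n \o cl)}.
    by apply: continuous_comp; [exact: clamp_continuous|exact: cW].
  move=> /cvgrPdist_lt/(_ (e / 3)); rewrite divr_gt0// => /(_ isT).
  apply: filterS => u /=; have := wW n _ (clI t); have := wW n _ (clI u).
  rewrite !ler_norml !ltr_norml => /andP[? ?] /andP[? ?] /andP[? ?].
  by apply/andP; split; rewrite /wc /=; lra.
have fixed t : `|t - t0| <= d -> Phi wc t = wc t.
  move=> td; apply/eqP; rewrite -subr_eq0 -normr_le0; apply/ler_addgt0Pr => e e0.
  have [n En] := small e e0; rewrite add0r; apply: le_trans (ltW En).
  have h1 : `|Phi wc t - W n.+1 t| <= 2^-1 * E n.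
    apply: (@contraction wc (W n)) => // u ud.
    by rewrite /wc /= clK//; exact: wW.
  have h2 : `|wc t - W n.+1 t| <= E n.+1.
    by rewrite (_ : wc t = w t); [exact: (wW n.+1)|rewrite /wc /= clK].
  have h3 : E n.+1 = 2^-1 * E n by rewrite /E exprS; ring.
  rewrite -(subrKA (W n.+1 t)); apply: le_trans (ler_normD _ _) _.
  by rewrite (distrC (W _ _)); lra.
have [P0 PD] := HP wc cwc.
exists (P wc) => // t td; have := PD t td.
by rewrite -fixed// PhiE.
Qed.

End Picard.

Section ODE.
Variable R : realType.

Definition pt3 (s t w : R) : 'rV[R]_3 :=
  \row_j (if j == 0 then s else if j == 1 then t else w).

Lemma sumI3 (F : 'I_3 -> R) : \sum_i F i = F 0 + F 1 + F 2.
Proof.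
rewrite !big_ord_recl big_ord0 addr0 addrA.
by congr (F _ + F _ + F _); exact: val_inj.
Qed.

Lemma pt3E0 s t w : pt3 s t w 0 0 = s. Proof. by rewrite mxE. Qed.
Lemma pt3E1 s t w : pt3 s t w 0 1 = t. Proof. by rewrite mxE. Qed.
Lemma pt3E2 s t w : pt3 s t w 0 2 = w. Proof. by rewrite mxE. Qed.

Lemma ordI3 (j : 'I_3) : [\/ j = 0, j = 1 | j = 2].
Proof.
by case: j => [[|[|[|]]]] //= ?; [constructor 1|constructor 2|constructor 3]; exact: val_inj.
Qed.

Lemma norm3_lt (v : 'rV[R]_3) e : 0 < e ->
  `|v 0 0| < e -> `|v 0 1| < e -> `|v 0 2| < e -> `|v| < e.
Proof. by move=> e0 v0 v1 v2; apply/norm_rV_lt => // j; case: (ordI3 j) => ->. Qed.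

Lemma pt3_convex s t w s' w' c :
  pt3 s t w + c *: (pt3 s' t w' - pt3 s t w) =
  pt3 (s + c * (s' - s)) t (w + c * (w' - w)).
Proof.
apply/rowP => j; rewrite !mxE; case: (j == 0) => //; case: (j == 1) => //.
by rewrite subrr mulr0 addr0.
Qed.

Lemma pt3_MVT (G : 'rV[R]_3 -> R) s t w s' w' :
  (forall c : R, 0 <= c <= 1 -> differentiable G
     (pt3 (s + c * (s' - s)) t (w + c * (w' - w)))) ->
  exists2 c : R, 0 <= c <= 1 & G (pt3 s' t w') - G (pt3 s t w) =
    (s' - s) * partial 0 G (pt3 (s + c * (s' - s)) t (w + c * (w' - w))) +
    (w' - w) * partial 2 G (pt3 (s + c * (s' - s)) t (w + c * (w' - w))).
Proof.
move=> dG; have [|c cI] := @MVT_line R 3 G (pt3 s t w) (pt3 s' t w' - pt3 s t w).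
  by move=> c cI; rewrite pt3_convex; apply: diff_derivable; exact: dG.
rewrite [pt3 s t w + _]addrC subrK => E; exists c => //; rewrite E pt3_convex deriv_partial//; last exact: dG.
rewrite sumI3 ![(pt3 _ _ _ - _) _ _]mxE ![(- pt3 _ _ _) _ _]mxE !pt3E0 !pt3E1 !pt3E2.
by rewrite subrr mul0r addr0.
Qed.

(** The derivative in s of a solution w of w_t = G (s, t, w) has to solve the
    variational equation, which is linear. Its solution v is as smooth as w, and
    comparing the increments of w with v shows w_s = v; so w is one degree smoother
    than assumed. *)
Section Solution.
Variables (G : 'rV[R]_3 -> R) (W : set 'rV[R]_3) (s0 t0 r L d : R) (w : 'rV[R]_2 -> R).
Hypotheses (oW : open W) (CG : Cinf W G) (L0 : 0 <= L) (dr : d <= r).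
Hypothesis d0 : 0 < d.
Hypothesis GW : forall s t u, `|s - s0| <= r -> `|t - t0| <= r -> `|u| <= r ->
  [/\ W (pt3 s t u), `|partial 0 G (pt3 s t u)| <= L & `|partial 2 G (pt3 s t u)| <= L].
Hypothesis dL : 2 * d * L <= 2^-1.
Hypothesis w0 : forall s, `|s - s0| < d -> w (pt s t0) = 0.
Hypothesis wr : forall s t, `|s - s0| < d -> `|t - t0| < d -> `|w (pt s t)| <= r.
Hypothesis wD : forall s t, `|s - s0| < d -> `|t - t0| < d ->
  is_derive t 1 (fun t => w (pt s t)) (G (pt3 s t (w (pt s t)))).

Let B := box s0 t0 d.
Let lift3 (x : 'rV[R]_2) := pt3 (x 0 0) (x 0 1) (w x).

Let GWd s t u : `|s - s0| < d -> `|t - t0| < d -> `|u| <= r ->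
  [/\ W (pt3 s t u), `|partial 0 G (pt3 s t u)| <= L & `|partial 2 G (pt3 s t u)| <= L].
Proof. by move=> sd td ur; apply: GW => //; exact: le_trans (ltW _) dr. Qed.

Let increment s s' t u u' : `|s - s0| < d -> `|s' - s0| < d -> `|t - t0| < d ->
  `|u| <= r -> `|u'| <= r ->
  exists2 c : R, 0 <= c <= 1 & G (pt3 s' t u') - G (pt3 s t u) =
    (s' - s) * partial 0 G (pt3 (s + c * (s' - s)) t (u + c * (u' - u))) +
    (u' - u) * partial 2 G (pt3 (s + c * (s' - s)) t (u + c * (u' - u))).
Proof.
move=> sd s'd td ur u'r; apply: pt3_MVT => c cI.
apply: (Cinf_diff CG); have [|//||//] := @GWd (s + c * (s' - s)) t (u + c * (u' - u)).
- exact: segment_lt.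
- by rewrite -[X in `|X|]subr0; apply: segment_le => //; rewrite subr0.
Qed.

Let segment_r (c u u' : R) : 0 <= c <= 1 -> `|u| <= r -> `|u'| <= r ->
  `|u + c * (u' - u)| <= r.
Proof. by move=> cI ur u'r; rewrite -[X in `|X|]subr0; apply: segment_le => //; rewrite subr0. Qed.

Let small_radius d1 : d1 <= d -> d1 * L <= 2^-1.
Proof.
move=> d1d; apply: le_trans dL; rewrite ler_wpM2r//.
by apply: le_trans d1d _; have := d0; lra.
Qed.

(** Both solutions start at 0 and the time interval is short, so the difference of
    the parameters bounds their distance. *)
Let lipschitz s s' t : `|s - s0| < d -> `|s' - s0| < d -> `|t - t0| < d ->
  `|w (pt s' t) - w (pt s t)| <= `|s' - s|.
Proof.
move=> sd s'd td; have [d1 td1 /andP[d10 d1d]] := intermediate_radius td.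
have B1 := @short_gronwall R (fun t => w (pt s' t) - w (pt s t))
  (fun t => G (pt3 s' t (w (pt s' t))) - G (pt3 s t (w (pt s t))))
  t0 d1 L (L * `|s' - s|) (ltW d10) L0 _ _ _ _ _ t (ltW td1).
apply: le_trans (B1 _ _ _ _ _) _.
- exact/small_radius/ltW.
- by rewrite mulr_ge0.
- by rewrite !w0// subrr.
- move=> u ud; have ud' := le_lt_trans ud d1d.
  by apply: is_deriveB; exact: wD.
- move=> u ud; have ud' := le_lt_trans ud d1d.
  have [c cI ->] := increment sd s'd ud' (wr sd ud') (wr s'd ud').
  have [_ b0 b2] := GWd (segment_lt cI sd s'd) ud' (segment_r cI (wr sd ud') (wr s'd ud')).
  apply: le_trans (ler_normD _ _) _; rewrite !normrM addrC !(mulrC L).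
  by apply: lerD; apply: ler_wpM2l.
by rewrite mulrA ler_piMl// -mulrA; have := small_radius (ltW d1d); lra.
Qed.

Lemma solution_continuous x : B x -> {for x, continuous w}.
Proof.
move=> Bx; apply/(@cvgrPdist_lt _ R^o _ (nbhs x)) => e e0.
have nB : \forall y \near x, B y by apply: open_nbhs_nbhs; split=> //; exact: open_box.
move: Bx nB; rewrite (ptE x); move: (x 0 0) (x 0 1) => s t Bx nB.
have [sd td] := (box_pt _ _ _ _ _).1 Bx.
have : {for t, continuous (fun t => w (pt s t))}.
  apply: differentiable_continuous; apply/derivable1_diffP.
  by have [] := wD sd td.
move=> /(@cvgrPdist_lt _ R^o _ (nbhs t))/(_ (e / 2)); rewrite divr_gt0// => /(_ isT) nt.
have [r2 /= r20 Hr2] := (nbhs_ballP _ _).1 nt.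
have nb : \forall y \near pt s t, `|pt s t - y| < Num.min r2 (e / 2).
  apply/nbhs_ballP; exists (Num.min r2 (e / 2)) => /=; first by rewrite lt_min r20 divr_gt0.
  by move=> y; rewrite -ball_normE.
apply: filterS2 nB nb => y; rewrite (ptE y); move: (y 0 0) (y 0 1) => s' t'.
move=> /box_pt[s'd t'd] yb.
have b1 : `|s - s'| < e / 2.
  have := coord_le_norm (pt s t - pt s' t') 0; rewrite rowB !pt0 => /le_lt_trans; apply.
  by apply: lt_le_trans yb _; rewrite ge_min lexx orbT.
have b2 : `|t - t'| < r2.
  have := coord_le_norm (pt s t - pt s' t') 1; rewrite rowB !pt1 => /le_lt_trans; apply.
  by apply: lt_le_trans yb _; rewrite ge_min lexx.
have {Hr2} H2 : `|w (pt s t) - w (pt s t')| < e / 2 by apply: Hr2; rewrite -ball_normE.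
rewrite (splitr e) -(subrKA (w (pt s t'))); apply: le_lt_trans (ler_normD _ _) _.
rewrite ltrD//; apply: le_lt_trans b1; rewrite -(normrN (s - s')) opprB distrC.
exact: lipschitz.
Qed.

Let lift3_Ck k (F : 'rV[R]_3 -> R) : Cinf W F -> Ck k B w -> Ck k B (F \o lift3).
Proof.
move=> CF Cw.
apply: (@Ck_comp R 2 B (@open_box _ s0 t0 d) k 3 W F
  (fun j x => if j == 0 then x 0 0 else if j == 1 then x 0 1 else w x)) => //.
  move=> x; rewrite {1}(ptE x) => /box_pt[sd td].
  have [+ _ _] := GWd sd td (wr sd td); rewrite -ptE.
  by [].
move=> j; case: (j == 0); first exact: Ck_coord.
by case: (j == 1); [exact: Ck_coord|exact: Cw].
Qed.

Let C0w : Ck 0 B w. Proof. exact: solution_continuous. Qed.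

Let a := partial 0 G \o lift3.
Let b := partial 2 G \o lift3.

Let a_Ck k : Ck k B w -> Ck k B a.
Proof. by apply: lift3_Ck; exact: Cinf_partial. Qed.
Let b_Ck k : Ck k B w -> Ck k B b.
Proof. by apply: lift3_Ck; exact: Cinf_partial. Qed.

(** The variational equation v_t = a + b v is linear and is solved by two
    primitives: v = exp (int b) int a exp (- int b). *)
Let variation : exists v, [/\ forall s, `|s - s0| < d -> v (pt s t0) = 0,
  forall s t, `|s - s0| < d -> `|t - t0| < d ->
    is_derive t 1 (fun t => v (pt s t)) (a (pt s t) + b (pt s t) * v (pt s t)) &
  forall k, Ck k B w -> Ck k B v].
Proof.
have oB : open B by exact: open_box.
have [be Hbe] : exists be, vertical_primitive s0 t0 d be b.
  by apply: vertical_primitive_exists => // x; exact: (b_Ck C0w).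
have be_Ck k : Ck k B w -> Ck k B be.
  by move=> Cw; apply: vertical_primitive_Ck Hbe => //; exact: b_Ck.
have ab_Ck k : Ck k B w -> Ck k B (fun x => a x * expR (- be x)).
  move=> Cw; apply: CkM => //; first exact: a_Ck.
  by apply: Ck_exp => //; apply: CkN => //; exact: be_Ck.
have [J HJ] : exists J, vertical_primitive s0 t0 d J (fun x => a x * expR (- be x)).
  by apply: vertical_primitive_exists => // x; exact: (ab_Ck 0 C0w).
exists (fun x => expR (be x) * J x); split.
- by move=> s sd; rewrite HJ.1// mulr0.
- move=> s t sd td; have D1 := vertical_primitive_slice Hbe sd td; have D2 := vertical_primitive_slice HJ sd td.
  have D3 : is_derive t 1 (fun t => expR (be (pt s t))) (b (pt s t) * expR (be (pt s t))).
    rewrite mulrC.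
    exact: (@is_derive1_comp _ (@expR R) (fun t => be (pt s t)) t _ _ (is_derive_expR _) D1).
  apply: is_derive_eq.
  have := expRxMexpNx_1 (be (pt s t)); rewrite /GRing.scale /=.
  move: (expR _) (expR _) (a _) (b _) (J _) => E E' A B' J' EE.
  by rewrite mulrCA EE mulr1; congr (_ + _); ring.
- move=> k Cw; apply: CkM => //; first by apply: Ck_exp => //; exact: be_Ck.
  by apply: vertical_primitive_Ck HJ => //; exact: ab_Ck.
Qed.

Lemma solution_Cinf : Cinf B w.
Proof.
have oB : open B by exact: open_box.
have [v [v0 vD vC]] := variation.
have ws x : B x -> is_derive x (delta_mx 0 0 : 'rV[R]_2) w (v x).
  rewrite (ptE x); move: (x 0 0) (x 0 1) => s t /box_pt[sd td].
  apply/slice0; have [d1 td1 /andP[d10 d1d]] := intermediate_radius td.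
  apply: is_derive_eps => e e0.
  have eta0 : 0 < e / (4 * d1) by rewrite divr_gt0// mulr_gt0.
  have path_ok t' : t0 - d1 <= t' <= t0 + d1 ->
      W (lift3 (pt s t')) /\ {for t', continuous (fun t => lift3 (pt s t))}.
    move=> /(between d1d) t'd; split.
      by rewrite /lift3 pt0 pt1; have [] := GWd sd t'd (wr sd t'd).
    apply: row_continuous => j; case: (j == 0).
      by rewrite (_ : (fun _ => _) = cst s); [exact: cst_continuous|apply/funext => u; rewrite pt0].
    case: (j == 1).
      by rewrite (_ : (fun _ => _) = id); [exact: cvg_id|apply/funext => u; rewrite pt1].
    apply: differentiable_continuous; apply/derivable1_diffP.
    by have [] := wD sd t'd.
  have [q1 q10 Hq1] := tube_path oW path_ok (fun x => Cinf_cont (Cinf_partial 0 CG)) eta0.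
  have [q2 q20 Hq2] := tube_path oW path_ok (fun x => Cinf_cont (Cinf_partial 2 CG)) eta0.
  have ns : \forall s' \near s, `|s' - s| < Num.min q1 q2.
    apply/nbhs_ballP; exists (Num.min q1 q2) => /=; first by rewrite lt_min q10.
    by move=> u; rewrite -ball_normE /= distrC.
  apply: filterS2 ns (near_dist sd) => s' s'q s'd.
  have [q1' q2'] : `|s' - s| < q1 /\ `|s' - s| < q2.
    by move: s'q; rewrite lt_min => /andP[].
  have := @short_gronwall R (fun t => w (pt s' t) - w (pt s t) - (s' - s) * v (pt s t))
    (fun t => G (pt3 s' t (w (pt s' t))) - G (pt3 s t (w (pt s t))) -
       (s' - s) * (a (pt s t) + b (pt s t) * v (pt s t)))
    t0 d1 L (2 * (e / (4 * d1)) * `|s' - s|) (ltW d10) L0 _ _ _ _ _ t (ltW td1).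
  have -> : 2 * d1 * (2 * (e / (4 * d1)) * `|s' - s|) = e * `|s' - s|.
    by field; rewrite gt_eqF.
  apply.
  - exact/small_radius/ltW.
  - by rewrite mulr_ge0// mulr_ge0// ltW.
  - by rewrite !w0// v0// mulr0 !subr0.
  - move=> u ud; have ud' := le_lt_trans ud d1d.
    have D1 := wD s'd ud'; have D2 := wD sd ud'; have D3 := vD s u sd ud'.
    by apply: is_deriveB; apply: is_deriveZ.
  - move=> u ud; have ud' := le_lt_trans ud d1d.
    have lip := lipschitz sd s'd ud'.
    have [c cI ->] := increment sd s'd ud' (wr sd ud') (wr s'd ud').
    set xi := pt3 _ u _.
    have xiB q : `|s' - s| < q -> `|xi - lift3 (pt s u)| < q.
      move=> sq; have q0 : 0 < q by apply: le_lt_trans sq.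
      have /andP[c0 c1] := cI.
      have cx z : `|z| <= `|s' - s| -> `|c * z| < q.
        move=> zs; apply: le_lt_trans sq; apply: le_trans zs.
        by rewrite normrM ger0_norm// ler_piMl.
      rewrite /xi /lift3 pt0 pt1; apply: norm3_lt => //.
      + by rewrite !mxE /= addrC addKr cx.
      + by rewrite !mxE /= subrr normr0.
      + by rewrite !mxE /= addrC addKr cx.
    have uI : t0 - d1 <= u <= t0 + d1 by rewrite -ler_distl.
    have [_ A1] := Hq1 u xi uI (xiB _ q1').
    have [_ A2] := Hq2 u xi uI (xiB _ q2').
    have [_ _ bL] := GWd sd ud' (wr sd ud').
    have {}bL : `|b (pt s u)| <= L by rewrite /b /lift3 /= pt0 pt1.
    rewrite -[partial 0 G (lift3 _)]/(a (pt s u)) in A1.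
    rewrite -[partial 2 G (lift3 _)]/(b (pt s u)) in A2.
    move: (partial 0 G xi) (partial 2 G xi) (a (pt s u)) (b (pt s u)) (v (pt s u)) A1 A2 bL lip.
    move: (w (pt s' u)) (w (pt s u)) => w1 w2 A A' al be vv A1 A2 bL lip.
    have -> : (s' - s) * A + (w1 - w2) * A' - (s' - s) * (al + be * vv) =
      be * (w1 - w2 - (s' - s) * vv) + ((A - al) * (s' - s) + (A' - be) * (w1 - w2)) by ring.
    apply: le_trans (ler_normD _ _) _; rewrite normrM lerD ?ler_wpM2r//.
    apply: le_trans (ler_normD _ _) _; rewrite !normrM.
    have -> : 2 * (e / (4 * d1)) * `|s' - s| = e / (4 * d1) * `|s' - s| + e / (4 * d1) * `|s' - s|.
      by ring.
    by apply: lerD; apply: ler_pM => //; exact: ltW.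
have Cw k : Ck k B w.
  elim: k => [|k IH]; first exact: C0w.
  apply: (@Ck_of_partials R k B w (fun i => if i == 0 then v else G \o lift3)) => //.
    move=> i x Bx; case: (ordI2 i) => -> /=; first exact: ws.
    move: Bx; rewrite (ptE x); move: (x 0 0) (x 0 1) => s t /box_pt[sd td].
    by apply/slice1; rewrite /lift3 pt0 pt1; exact: wD.
  by move=> i; case: (i == 0); [exact: vC|exact: lift3_Ck].
exact: Cw.
Qed.

End Solution.

Lemma clamp_lipschitz (c r u v : R) : 0 <= r ->
  `|Num.max (c - r) (Num.min (c + r) u) - Num.max (c - r) (Num.min (c + r) v)| <= `|u - v|.
Proof.
move=> r0; have := ler_norm (u - v); have := ler_norm (- (u - v)); rewrite normrN.
move: `|u - v| => N h1 h2; rewrite ler_norml.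
rewrite !maxEle !minEle.
have cc : c - r <= c + r by lra.
case: (leP (c + r) u) => cu; case: (leP (c + r) v) => cv; rewrite ?cc;
  case: (leP (c - r) u) => cu'; case: (leP (c - r) v) => cv'; apply/andP; split; lra.
Qed.

(** G is cut off outside a small box, so that [picard] applies to functions on the
    whole line; the solution exists for so short a time that it stays in the box,
    where nothing was changed. *)
Lemma ode_solution (G : 'rV[R]_3 -> R) (W : set 'rV[R]_3) (s0 t0 : R) : open W ->
  Cinf W G -> W (pt3 s0 t0 0) ->
  exists2 d, 0 < d & exists w : 'rV[R]_2 -> R, [/\ Cinf (box s0 t0 d) w,
    forall s, `|s - s0| < d -> w (pt s t0) = 0 &
    forall x, box s0 t0 d x -> W (pt3 (x 0 0) (x 0 1) (w x)) /\
      partial 1 w x = G (pt3 (x 0 0) (x 0 1) (w x))].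
Proof.
move=> oW CG W0; set z0 := pt3 s0 t0 0 in W0.
have bounded_near F : Cinf W F -> \forall z \near z0, `|F z| < `|F z0| + 1.
  move=> CF; have /(@cvgrPdist_lt _ R^o _ (nbhs z0))/(_ 1 ltr01) := Cinf_cont CF W0.
  apply: filterS => z; have := ler_normD (F z0) (F z - F z0).
  by rewrite addrC subrK distrC; lra.
have nW : \forall z \near z0, W z by exact: open_nbhs_nbhs.
have N : \forall z \near z0, W z /\ `|G z| < `|G z0| + 1 /\
    `|partial 0 G z| < `|partial 0 G z0| + 1 /\ `|partial 2 G z| < `|partial 2 G z0| + 1.
  apply: filterI nW (filterI (bounded_near _ CG) _).
  exact: filterI (bounded_near _ (Cinf_partial 0 CG)) (bounded_near _ (Cinf_partial 2 CG)).
have [r1 /= r10 Hr1] := (nbhs_ballP _ _).1 N.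
pose r := r1 / 2; have r0 : 0 < r by rewrite divr_gt0.
have rr1 : r < r1 by rewrite /r; lra.
pose M := `|G z0| + 1; have M0 : 0 < M by rewrite ltr_wpDl.
pose L := `|partial 0 G z0| + `|partial 2 G z0| + 1.
have L0 : 0 < L by rewrite ltr_wpDl// addr_ge0.
pose d := Num.min r (Num.min (r / (2 * M)) (4 * L)^-1).
have d0 : 0 < d by rewrite !lt_min r0 divr_gt0 ?mulr_gt0// invr_gt0 mulr_gt0.
have dr : d <= r by rewrite /d ge_min lexx.
have dM : 2 * d * M <= r.
  have : d <= r / (2 * M) by rewrite /d !ge_min lexx orbT.
  by rewrite ler_pdivlMr ?mulr_gt0//; congr (_ <= _); ring.
have dL : 2 * d * L <= 2^-1.
  have : d <= (4 * L)^-1 by rewrite /d !ge_min lexx !orbT.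
  move=> dd; have : d * (4 * L) <= 1 by rewrite -ler_pdivlMr ?mulr_gt0// mul1r.
  by lra.
have GW s t u : `|s - s0| <= r -> `|t - t0| <= r -> `|u| <= r ->
   [/\ W (pt3 s t u), `|partial 0 G (pt3 s t u)| <= L & `|partial 2 G (pt3 s t u)| <= L]
   /\ `|G (pt3 s t u)| <= M.
  move=> sr tr ur.
  have [|HW [HG [H0 H2]]] := Hr1 (pt3 s t u).
    rewrite -ball_normE /= distrC; apply: norm3_lt => //.
    - by rewrite !mxE /=; exact: le_lt_trans sr _.
    - by rewrite !mxE /=; exact: le_lt_trans tr _.
    - by rewrite !mxE /= subr0; exact: le_lt_trans ur _.
  split; last exact: ltW.
  split; [exact: HW|apply: le_trans (ltW H0) _|apply: le_trans (ltW H2) _].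
    by rewrite /L lerD2r lerDl normr_ge0.
  by rewrite /L lerD2r lerDr normr_ge0.
pose cl t := Num.max (t0 - d) (Num.min (t0 + d) t).
pose cr u := Num.max (0 - r) (Num.min (0 + r) u).
have clI t : `|cl t - t0| <= r by apply: le_trans dr; apply: clamp_le; exact: ltW.
have crI u : `|cr u| <= r by rewrite -[cr u]subr0; apply: clamp_le; exact: ltW.
have solve s : `|s - s0| < d -> exists w : R -> R, w t0 = 0 /\
    forall t, `|t - t0| < d -> `|w t| <= r /\ is_derive t 1 w (G (pt3 s t (w t))).
  move=> sd; have sr : `|s - s0| <= r by apply: le_trans (ltW sd) dr.
  have [||||||w w0 Dw] := @picard R (fun t u => G (pt3 s (cl t) (cr u))) t0 d L M d0.
  - exact: ltW.
  - exact: ltW.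
  - exact: dL.
  - move=> y cy t; apply: (@continuous_comp _ _ _ (fun t => pt3 s (cl t) (cr (y t))) G).
      apply: row_continuous => j; case: (j == 0); first exact: cst_continuous.
      case: (j == 1); first exact: clamp_continuous.
      by apply: (@continuous_comp _ _ _ y cr); [exact: cy|exact: clamp_continuous].
    by apply: (Cinf_cont CG); have [[]] := GW s (cl t) (cr (y t)) sr (clI t) (crI _).
  - move=> t u v _.
    have seg c : 0 <= c <= 1 -> `|cr v + c * (cr u - cr v)| <= r.
      move=> cI; rewrite -[X in `|X|]subr0.
      by apply: segment_le => //; rewrite subr0; exact: crI.
    have sc c : s + c * (s - s) = s by rewrite subrr mulr0 addr0.
    have [c cI|c cI] := @pt3_MVT G s (cl t) (cr v) s (cr u).
      by rewrite sc; apply: (Cinf_diff CG); have [[]] := GW s (cl t) _ sr (clI t) (seg c cI).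
    rewrite subrr mul0r add0r mulr0 addr0 => ->.
    have [[_ _ b2] _] := GW s (cl t) _ sr (clI t) (seg c cI).
    rewrite normrM mulrC; apply: ler_pM => //.
    by apply: clamp_lipschitz; exact: ltW.
  - by move=> t u _; exact: (GW s (cl t) (cr u) sr (clI t) (crI u)).2.
  have wr t : `|t - t0| <= d -> `|w t| <= r.
    move=> td; apply: le_trans dM.
    apply: (@bounded_derivative R w (fun t => G (pt3 s (cl t) (cr (w t))))) td => //.
    - exact: ltW.
    - exact: ltW.
    - by move=> u _; exact: (GW s (cl u) (cr _) sr (clI u) (crI _)).2.
  exists w; split=> // t td; split; first exact/wr/ltW.
  have := Dw t (ltW td); rewrite /cl clampE ?ltW// /cr clampE// subr0.
  exact/wr/ltW.
have [w Hw] : exists w : R -> R -> R, forall s, `|s - s0| < d -> w s t0 = 0 /\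
    forall t, `|t - t0| < d -> `|w s t| <= r /\ is_derive t 1 (w s) (G (pt3 s t (w s t))).
  suff /boolp.choice[w Hw] : forall s, exists w : R -> R, `|s - s0| < d -> w t0 = 0 /\
      forall t, `|t - t0| < d -> `|w t| <= r /\ is_derive t 1 w (G (pt3 s t (w t))).
    by exists w.
  move=> s; have [/solve[w Hw]|_] := boolP (`|s - s0| < d); first by exists w.
  by exists (fun=> 0).
pose w2 (x : 'rV[R]_2) := w (x 0 0) (x 0 1).
have w2E s t : w2 (pt s t) = w s t by rewrite /w2 pt0 pt1.
have w2E' s : (fun t => w2 (pt s t)) = w s by apply/funext => t; exact: w2E.
have S0 s : `|s - s0| < d -> w2 (pt s t0) = 0 by move=> sd; rewrite w2E (Hw s sd).1.
have Sr s t : `|s - s0| < d -> `|t - t0| < d -> `|w2 (pt s t)| <= r.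
  by move=> sd td; rewrite w2E ((Hw s sd).2 t td).1.
have SD s t : `|s - s0| < d -> `|t - t0| < d ->
  is_derive t 1 (fun t => w2 (pt s t)) (G (pt3 s t (w2 (pt s t)))).
  by move=> sd td; rewrite w2E' w2E; exact: ((Hw s sd).2 t td).2.
exists d => //; exists w2; split=> //.
  have GW1 s t u (sr : `|s - s0| <= r) (tr : `|t - t0| <= r) (ur : `|u| <= r) :=
    (GW s t u sr tr ur).1.
  exact: (solution_Cinf oW CG (ltW L0) dr d0 GW1 dL S0 Sr SD).
move=> x; rewrite (ptE x); move: (x 0 0) (x 0 1) => s t /box_pt[sd td].
have sr : `|s - s0| <= r by apply: le_trans (ltW sd) dr.
have tr : `|t - t0| <= r by apply: le_trans (ltW td) dr.
rewrite pt0 pt1; split; first by have [[]] := GW s t _ sr tr (Sr s t sd td).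
by apply: is_derive_partial; apply/slice1; exact: SD.
Qed.

End ODE.

(** * Coordinates adapted to two direction fields *)

Section Shear.
Variable R : realType.

Lemma diffeo_sym (U V : set (plane R)) f g : diffeo U V f g -> diffeo V U g f.
Proof. by case. Qed.

Lemma diffeo_restrl (U V W : set (plane R)) f g : diffeo U V f g -> open W -> W `<=` U ->
  diffeo W (V `&` g @^-1` W) f g.
Proof. by move=> d oW WU; apply: diffeo_sym; apply: diffeo_restr WU => //; exact: diffeo_sym. Qed.

(** An increment formula whose coefficients have limits at the point is a
    first-order expansion. *)
Lemma differentiable_of_increment (f : plane R -> R) (x : plane R) (m : 'I_2 -> R)
    (q : 'I_2 -> plane R -> R) :
  (forall eta, 0 < eta -> \forall y \near x, forall i, `|q i y - m i| <= eta) ->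
  (\forall y \near x, f y - f x = (y 0 0 - x 0 0) * q 0 y + (y 0 1 - x 0 1) * q 1 y) ->
  differentiable f x /\ forall i, partial i f x = m i.
Proof.
move=> Hq Hf.
have [df dE] : differentiable f x /\ ('d f x = lin_form m :> (_ -> _)).
  apply: differentiable_epsP => e e0; have e20 : 0 < e / 2 by rewrite divr_gt0.
  apply: filterS2 Hf (Hq _ e20) => y -> qy.
  have -> : (y 0 0 - x 0 0) * q 0 y + (y 0 1 - x 0 1) * q 1 y - lin_form m (y - x) =
    (y - x) 0 0 * (q 0 y - m 0) + (y - x) 0 1 * (q 1 y - m 1).
    rewrite /lin_form sumI2 !rowB; ring.
  apply: le_trans (ler_normD _ _) _; rewrite !normrM.
  have -> : e * `|y - x| = `|y - x| * (e / 2) + `|y - x| * (e / 2).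
    by rewrite -mulrDr -splitr mulrC.
  by apply: lerD; apply: ler_pM => //; exact: coord_le_norm.
split=> // i; rewrite partialE deriveE// dE /lin_form sumI2.
by case: (ordI2 i) => ->; rewrite -> ?e00, ?e01, ?e10, ?e11; ring.
Qed.

Lemma near_coord (y : plane R) (i : 'I_2) (P : R -> Prop) :
  (\forall u \near y 0 i, P u) -> \forall z \near y, P ((z : plane R) 0 i).
Proof. exact: (@coord_continuous R 1 2 0 i y). Qed.

Definition shear (F : plane R -> R) (x : plane R) : plane R := pt (x 0 0) (F x).

Lemma box_near (V : set (plane R)) s0 t0 : open V -> V (pt s0 t0) ->
  exists2 r, 0 < r & box s0 t0 r `<=` V.
Proof.
move=> oV Vx; have : \forall y \near pt s0 t0, V y by exact: open_nbhs_nbhs.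
move=> N; have [r /= r0 Hr] := (nbhs_ballP _ _).1 N.
exists r => // x [x0 x1]; apply: Hr; rewrite -ball_normE /= distrC.
by apply: norm2_lt => //; rewrite rowB ?pt0 ?pt1.
Qed.

Lemma MVT_plane (V : set (plane R)) (F : plane R -> R) (s0 t0 r : R) (x y : plane R) :
  Cinf V F -> box s0 t0 r `<=` V -> box s0 t0 r x -> box s0 t0 r y ->
  exists2 c : R, 0 <= c <= 1 & box s0 t0 r (x + c *: (y - x)) /\
    F y - F x = (y 0 0 - x 0 0) * partial 0 F (x + c *: (y - x)) +
      (y 0 1 - x 0 1) * partial 1 F (x + c *: (y - x)).
Proof.
move=> CF BV Bx By.
have conv (c : R) : 0 <= c <= 1 -> box s0 t0 r (x + c *: (y - x)).
  move=> cI; move: Bx By => -[x0 x1] [y0 y1].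
  by split; rewrite rowD rowZ rowB; exact: segment_lt.
have dF (c : R) : 0 <= c <= 1 -> differentiable F (x + c *: (y - x)).
  by move=> cI; apply: (Cinf_diff CF); exact/BV/conv.
have [c cI|c cI] := @MVT_line R 2 F x (y - x); first exact/diff_derivable/dF.
rewrite [x + (y - x)]addrC subrK => E; exists c => //; split; first exact: conv.
by rewrite E deriv2E ?rowB//; exact: dF.
Qed.

(** F is increasing on vertical segments, where the intermediate value theorem
    inverts it. The mean value theorem turns into an increment formula for the
    inverse, which gives its partial derivatives - F_x / F_y and 1 / F_y, and its
    smoothness by induction. *)
Lemma shear_diffeo (V : set (plane R)) (F : plane R -> R) (x0 : plane R) : open V ->
  Cinf V F -> V x0 -> 0 < partial 1 F x0 ->
  exists U U' g, [/\ diffeo U U' (shear F) g, U x0, U `<=` V,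
    (forall y, U' y -> g y 0 0 = y 0 0) & forall x, U x -> 0 < partial 1 F x].
Proof.
rewrite (ptE x0); move: (x0 0 0) (x0 0 1) => s0 t0 oV CF Vx0 F10.
pose V' := V `&` (partial 1 F @^-1` [set u | 0 < u]).
have oV' : open V'.
  rewrite openE => y [Vy py]; apply: filterI; first exact: open_nbhs_nbhs.
  apply: (Cinf_cont (Cinf_partial 1 CF) Vy).
  by apply: open_nbhs_nbhs; split=> //; exact: open_gt.
have [r r0 Br] : exists2 r, 0 < r & box s0 t0 r `<=` V' by apply: box_near.
have BV : box s0 t0 r `<=` V by move=> y /Br[].
have Fpos y : box s0 t0 r y -> 0 < partial 1 F y by move=> /Br[].
pose e := r / 2; have e0 : 0 < e by rewrite divr_gt0.
have er : e < r by rewrite /e; lra.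
pose U := box s0 t0 e.
have UB : U `<=` box s0 t0 r.
  by move=> y [y0 y1]; split; [exact: lt_trans er|exact: lt_trans er].
pose lo a := F (pt a (t0 - e)); pose hi a := F (pt a (t0 + e)).
pose U' : set (plane R) := [set y | `|y 0 0 - s0| < e /\ lo (y 0 0) < y 0 1 < hi (y 0 0)].
have mono a t t' : `|a - s0| < r -> `|t - t0| < r -> `|t' - t0| < r ->
    t < t' -> F (pt a t) < F (pt a t').
  move=> ar tr t'r tt'.
  have [||c cI [Bc]] := MVT_plane (x := pt a t) (y := pt a t') CF BV.
  - exact/box_pt.
  - exact/box_pt.
  rewrite !pt0 !pt1 subrr mul0r add0r => E; rewrite -subr_gt0 E mulr_gt0 ?subr_gt0//.
  exact: Fpos.
have tlo : `|t0 - e - t0| < r by rewrite addrAC subrr add0r normrN gtr0_norm.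
have thi : `|t0 + e - t0| < r by rewrite addrAC subrr add0r gtr0_norm.
have ivt (y : plane R) : exists t, U' y -> `|t - t0| < e /\ F (pt (y 0 0) t) = y 0 1.
  have [[y0 /andP[ylo yhi]]|] := pselect (U' y); last by exists 0.
  have yr := lt_trans y0 er.
  have [|||t] := @IVT R (fun t => F (pt (y 0 0) t)) (t0 - e) (t0 + e) (y 0 1).
  - by lra.
  - apply: derivable_within_continuous => t; rewrite in_itv /= -ler_distl => te.
    have Bt : box s0 t0 r (pt (y 0 0) t) by apply/box_pt; split=> //; exact: le_lt_trans te er.
    have [] // := (slice1 F (y 0 0) t _).2 (derivable_partial 1 (Cinf_diff CF (BV _ Bt))).
  - have lh : lo (y 0 0) < hi (y 0 0) by exact: lt_trans ylo yhi.
    by rewrite (min_idPl _) ?(max_idPr _) ?ltW//; apply/andP; split; exact: ltW.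
  rewrite in_itv /= => /andP[t1 t2] Et; exists t => _; split=> //.
  rewrite ltr_distl; apply/andP; split; rewrite lt_neqAle ?t1 ?t2 andbT; apply/eqP => E.
    by move: ylo; rewrite -Et -E ltxx.
  by move: yhi; rewrite -Et E ltxx.
have [tau Htau] := boolp.choice ivt.
pose g (y : plane R) : plane R := pt (y 0 0) (tau y).
have shU x : U x -> U' (shear F x).
  rewrite (ptE x); move: (x 0 0) (x 0 1) => s t /box_pt[se te].
  rewrite /U' /shear /= !pt0 !pt1; split=> //.
  move: te; rewrite ltr_distl => /andP[t1 t2].
  have sr := lt_trans se er; have tr : `|t - t0| < r by rewrite ltr_distl; apply/andP; split; lra.
  by apply/andP; split; apply: mono.
have gU y : U' y -> U (g y).
  by move=> U'y; apply/box_pt; split; [exact: U'y.1|exact: (Htau y U'y).1].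
have gK y : U' y -> shear F (g y) = y.
  by move=> U'y; rewrite /shear /g pt0 (Htau y U'y).2 -ptE.
have inj a t t' : `|a - s0| < r -> `|t - t0| < r -> `|t' - t0| < r ->
    F (pt a t) = F (pt a t') -> t = t'.
  move=> ar tr t'r E; have [tt|tt|//] := ltgtP t t'.
    by have := mono a t t' ar tr t'r tt; rewrite E ltxx.
  by have := mono a t' t ar t'r tr tt; rewrite E ltxx.
have shK x : U x -> g (shear F x) = x.
  move=> Ux; have U'x := shU x Ux; have [t1 t2] := Htau _ U'x.
  rewrite {1}/g {1}/shear pt0; rewrite [in RHS](ptE x); congr pt.
  have [x0e x1e] := UB _ Ux.
  apply: (inj (x 0 0)) => //; first exact: lt_trans t1 er.
  by move: t2; rewrite {1 3}/shear pt0 pt1 -ptE.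
have ctr a t : `|a - s0| < r -> `|t - t0| < r -> {for a, continuous (fun a => F (pt a t))}.
  move=> ar tr; apply: (@continuous_comp _ _ _ (fun a => pt a t) F).
    exact: pt_continuous0.
  by apply: (Cinf_cont CF); apply/BV/box_pt.
(* The next two facts give continuity of tau, as F increases in t. *)
have near_lo (y : plane R) t : `|y 0 0 - s0| < r -> `|t - t0| < r -> F (pt (y 0 0) t) < y 0 1 ->
    \forall z \near y, F (pt ((z : plane R) 0 0) t) < z 0 1.
  move=> yr tr lt; pose m := (F (pt (y 0 0) t) + y 0 1) / 2.
  have n1 : \forall u \near y 0 0, F (pt u t) < m.
    by apply: (cvgr_lt _ (ctr _ t yr tr)); rewrite /m; lra.
  have n2 : \forall u \near y 0 1, m < u.
    by apply: (cvgr_gt _ (@cvg_id _ (nbhs (y 0 1)))); rewrite /m; lra.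
  by apply: filterS2 (near_coord (i := 0) n1) (near_coord (i := 1) n2) => z; exact: lt_trans.
have near_hi (y : plane R) t : `|y 0 0 - s0| < r -> `|t - t0| < r -> y 0 1 < F (pt (y 0 0) t) ->
    \forall z \near y, (z : plane R) 0 1 < F (pt (z 0 0) t).
  move=> yr tr lt; pose m := (F (pt (y 0 0) t) + y 0 1) / 2.
  have n1 : \forall u \near y 0 0, m < F (pt u t).
    by apply: (cvgr_gt _ (ctr _ t yr tr)); rewrite /m; lra.
  have n2 : \forall u \near y 0 1, u < m.
    by apply: (cvgr_lt _ (@cvg_id _ (nbhs (y 0 1)))); rewrite /m; lra.
  by apply: filterS2 (near_coord (i := 0) n1) (near_coord (i := 1) n2) => z h1 h2; exact: lt_trans h2 h1.
have oU' : open U'.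
  rewrite openE => y [ye /andP[ylo yhi]]; have yr := lt_trans ye er.
  apply: filterI; first exact: (near_coord (i := 0) (near_dist ye)).
  by apply: filterS2 (near_lo y _ yr tlo ylo) (near_hi y _ yr thi yhi) => z h1 h2; apply/andP.
have tau_cont y : U' y -> forall eta, 0 < eta -> \forall z \near y, `|tau z - tau y| < eta.
  move=> U'y eta eta0; have [te Et] := Htau y U'y.
  have [ye _] := U'y; have yr := lt_trans ye er.
  pose d := Num.min eta (e - `|tau y - t0|).
  have d0 : 0 < d by rewrite lt_min eta0 subr_gt0.
  have dr t : `|t - tau y| <= d -> `|t - t0| < r.
    move=> td; have : d <= e - `|tau y - t0| by rewrite ge_min lexx orbT.
    have := ler_normD (t - tau y) (tau y - t0); rewrite subrKA; lra.
  have d1 : `|tau y - d - tau y| <= d by rewrite addrAC subrr add0r normrN gtr0_norm.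
  have d2 : `|tau y + d - tau y| <= d by rewrite addrAC subrr add0r gtr0_norm.
  have tr : `|tau y - t0| < r by apply: dr; rewrite subrr normr0 ltW.
  have lo' : F (pt (y 0 0) (tau y - d)) < y 0 1.
    by rewrite -Et; apply: mono => //; [exact: dr|lra].
  have hi' : y 0 1 < F (pt (y 0 0) (tau y + d)).
    by rewrite -Et; apply: mono => //; [exact: dr|lra].
  have nU : \forall z \near y, U' z by exact: open_nbhs_nbhs.
  apply: filterS3 nU (near_lo y _ yr (dr _ d1) lo') (near_hi y _ yr (dr _ d2) hi').
  move=> z U'z h1 h2; have [tze Etz] := Htau z U'z.
  have zr := lt_trans U'z.1 er; have tzr := lt_trans tze er.
  have de : d <= eta by rewrite ge_min lexx.
  rewrite ltr_distl; apply/andP; split; rewrite ltNge; apply/negP => tt.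
    have : F (pt (z 0 0) (tau z)) <= F (pt (z 0 0) (tau y - d)).
      have [->//|ne] := eqVneq (tau z) (tau y - d).
      by apply/ltW/mono => //; [exact: dr|rewrite lt_neqAle ne; lra].
    by rewrite Etz; lra.
  have : F (pt (z 0 0) (tau y + d)) <= F (pt (z 0 0) (tau z)).
    have [->//|ne] := eqVneq (tau y + d) (tau z).
    by apply/ltW/mono => //; [exact: dr|rewrite lt_neqAle ne; lra].
  by rewrite Etz; lra.
pose m (i : 'I_2) (x : plane R) := if i == 0 then - (partial 0 F x / partial 1 F x)
  else (partial 1 F x)^-1.
have oB : open (box s0 t0 r) by exact: open_box.
have Cm i : Cinf (box s0 t0 r) (m i).
  have C1 : Cinf (box s0 t0 r) (fun x => (partial 1 F x)^-1).
    apply: CinfV => //; first by move=> x /Fpos; exact: lt0r_neq0.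
    exact: Cinf_sub BV (Cinf_partial 1 CF).
  case: (ordI2 i) => -> //; apply: CinfN => //; apply: CinfM => //.
  exact: Cinf_sub BV (Cinf_partial 0 CF).
have dtau y : U' y -> differentiable tau y /\ forall i, partial i tau y = m i (g y).
  move=> U'y; have Bgy := UB _ (gU y U'y).
  have /boolp.choice[xi Hxi] : forall z, exists xi : plane R, U' z ->
      [/\ box s0 t0 r xi, `|xi - g y| <= `|g z - g y| &
      tau z - tau y = (z 0 0 - y 0 0) * m 0 xi + (z 0 1 - y 0 1) * m 1 xi].
    move=> z; have [U'z|] := pselect (U' z); last by exists 0.
    have Bgz := UB _ (gU z U'z).
    have [c cI [Bc E]] := MVT_plane CF BV Bgy Bgz.
    have /andP[c0 c1] := cI.
    exists (g y + c *: (g z - g y)) => _; split=> //.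
      by rewrite [X in `|X|]addrAC subrr add0r normrZ ger0_norm// ler_piMl.
    move: E (Fpos _ Bc); rewrite /m /=; set q := g y + _.
    rewrite {1 2}/g (Htau z U'z).2 (Htau y U'y).2 {1 2 3 4}/g !pt0 !pt1.
    move: (partial 0 F q) (partial 1 F q) => A B E B0.
    have BN : B != 0 by exact: lt0r_neq0.
    by rewrite E; field.
  apply: (@differentiable_of_increment tau y (fun i => m i (g y)) (fun i z => m i (xi z))).
    move=> eta eta0.
    have N i : \forall x \near g y, `|m i (g y) - m i x| < eta.
      by have /(@cvgrPdist_lt _ R^o _ (nbhs (g y))) := Cinf_cont (Cm i) Bgy; exact.
    have [d /= d0 Hd] := (nbhs_ballP _ _).1 (N 0).
    have [d' /= d'0 Hd'] := (nbhs_ballP _ _).1 (N 1).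
    have dd : 0 < Num.min d d' by rewrite lt_min d0.
    have nU : \forall z \near y, U' z by exact: open_nbhs_nbhs.
    have n1 : \forall z \near y, `|(z : plane R) 0 0 - y 0 0| < Num.min d d'.
      by apply: (@near_coord y 0 (fun u => `|u - y 0 0| < Num.min d d')); apply: near_dist; rewrite subrr normr0.
    apply: filterS3 nU n1 (tau_cont y U'y _ dd) => z U'z z0 zt i.
    have [_ xz _] := Hxi z U'z.
    have : `|xi z - g y| < Num.min d d'.
      by apply: le_lt_trans xz _; apply: norm2_lt => //; rewrite rowB /g ?pt0 ?pt1.
    rewrite lt_min => /andP[xd xd'].
    rewrite distrC ltW//; case: (ordI2 i) => ->.
      by apply: Hd; rewrite -ball_normE /= distrC.
    by apply: Hd'; rewrite -ball_normE /= distrC.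
  have nU : \forall z \near y, U' z by exact: open_nbhs_nbhs.
  by apply: filterS nU => z U'z; have [] := Hxi z U'z.
have Ctau : Cinf U' tau.
  elim=> [|k IH].
    by move=> y U'y; apply: differentiable_continuous; exact: (dtau y U'y).1.
  split=> [y U'y|i]; first exact: (dtau y U'y).1.
  have : Ck k U' (fun y => m i (\row_j (if j == 0 then y 0 0 else tau y))).
    apply: (@Ck_comp R 2 U' oU' k 2 (box s0 t0 r) (m i) (fun j y => if j == 0 then y 0 0 else tau y)).
    - by move=> y U'y; exact: (UB _ (gU y U'y)).
    - exact: Cm.
    - by move=> j; case: (j == 0); [exact: Ck_coord|exact: IH].
  by apply: Ck_ext => // y U'y; rewrite (dtau y U'y).2.
have oU : open U by exact: open_box.
exists U, U', g; split.
- apply: Diffeo => //.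
    apply: (Cinf_field oU) => j; have E (x : plane R) : (if j == 0 then x 0 0 else F x) = shear F x 0 j.
      by rewrite mxE.
    apply: (Cinf_ext oU (fun x _ => E x)); case: (j == 0); first exact: Cinf_coord.
    by apply: Cinf_sub CF => x /UB /BV.
  apply: (Cinf_field oU') => j; have E (x : plane R) : (if j == 0 then x 0 0 else tau x) = g x 0 j.
    by rewrite mxE.
  by apply: (Cinf_ext oU' (fun x _ => E x)); case: (j == 0); [exact: Cinf_coord|exact: Ctau].
- by apply/box_pt; rewrite !subrr normr0.
- by move=> x /UB /BV.
- by move=> y _; rewrite /g pt0.
- by move=> x /UB /Fpos.
Qed.

End Shear.

Section Adapted.
Variable R : realType.

Lemma partial0_initial (w : plane R -> R) s0 t0 d (s c : R) :
  (forall s, `|s - s0| < d -> w (pt s t0) = c) -> `|s - s0| < d ->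
  partial 0 w (pt s t0) = 0.
Proof.
move=> w0 sd; apply: is_derive_partial; apply/slice0.
have D0 := @is_derive_cst _ _ _ (c : R) s (1 : R).
have N : \forall u \near s, (cst c : R -> R) u = w (pt u t0).
  by apply: filterS (near_dist sd) => u ud; rewrite w0.
case: D0 => D1 D2; split; first exact: near_eq_derivable N D1.
by rewrite -D2; exact/esym/near_eq_derive.
Qed.

Lemma partial_plane_comp (V W : set (plane R)) (h : plane R -> R) (g : plane R -> plane R) i x :
  open V -> open W -> Cinf W h -> smooth_on V g -> V x -> W (g x) ->
  partial i (fun y => h (g y)) x =
    partial i (fun y => g y 0 0) x * partial 0 h (g x) +
    partial i (fun y => g y 0 1) x * partial 1 h (g x).
Proof.
move=> oV oW Ch sg Vx Wgx.
have E (y : plane R) : \row_j g y 0 j = g y by apply/rowP => j; rewrite mxE.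
have -> : (fun y => h (g y)) = (fun y => h (\row_j g y 0 j)) by apply/funext => y; rewrite E.
rewrite (@partial_comp R 2 2 h (fun j y => g y 0 j)) ?E ?sumI2//; first exact: Cinf_diff Ch Wgx.
by move=> j; exact: (Cinf_diff (field_Cinf oV j sg) Vx).
Qed.

Definition swap (x : plane R) : plane R := pt (x 0 1) (x 0 0).

Lemma swapK : involutive swap.
Proof. by move=> x; rewrite /swap !pt0 !pt1 -ptE. Qed.

Lemma smooth_swap V : open V -> smooth_on V swap.
Proof.
move=> oV; apply: (Cinf_field oV) => j.
have E (x : plane R) : (if j == 0 then x 0 1 else x 0 0) = swap x 0 j by rewrite mxE.
by apply: (Cinf_ext oV (fun x _ => E x)); case: (j == 0); exact: Cinf_coord.
Qed.

Lemma diffeo_swap (V : set (plane R)) : open V -> diffeo V (swap @^-1` V) swap swap.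
Proof.
move=> oV; have oV' : open (swap @^-1` V).
  apply: open_comp => // x _; apply: (smooth_on_cont openT) => //.
  exact: smooth_swap openT.
apply: Diffeo => //.
- by move=> x Vx; rewrite /preimage /= swapK.
- by move=> x _; exact: swapK.
- by move=> x _; exact: swapK.
- exact: smooth_swap.
- exact: smooth_swap.
Qed.

(** The solutions y = F (x, s) of y' = p (x, y), labelled by their initial values s,
    form a shear. Its inverse expresses the label s as a function of (x, y), which
    is constant along the curves of slope p. *)
Lemma first_integral (V : set (plane R)) (p : plane R -> R) (x0 : plane R) : open V ->
  Cinf V p -> V x0 -> exists U U' sig g, [/\ diffeo U U' (shear sig) g, U x0, U `<=` V,
    Cinf U sig & forall x, U x ->
      partial 0 sig x + p x * partial 1 sig x = 0 /\ 0 < partial 1 sig x].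
Proof.
rewrite (ptE x0); move: (x0 0 0) (x0 0 1) => a0 b0 oV Cp Vx0.
pose k (j : 'I_2) (z : 'rV[R]_3) := if j == 0 then z 0 1 else z 0 0 + z 0 2.
pose W : set 'rV[R]_3 := [set z | V (\row_j k j z)].
have Ck_k l j : Ck l setT (k j).
  rewrite /k; case: (j == 0); first exact: Ck_coord.
  by apply: (CkD openT); exact: Ck_coord.
have oW : open W.
  apply: (@open_comp _ _ (fun z => \row_j k j z)) => // z _.
  by apply: row_continuous => j; exact: (Ck_k 0).
have CG : Cinf W (fun z => p (\row_j k j z)).
  move=> l; apply: (@Ck_comp R 3 W oW l 2 V p k) => //.
  by move=> j; apply: Ck_sub (Ck_k l j).
have ptk s t w : \row_j k j (pt3 s t w) = pt t (s + w).
  by apply: rV2P; rewrite mxE /k /= ?pt3E0 ?pt3E1 ?pt3E2 ?pt0 ?pt1.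
have [|d d0 [w [Cw w0 Hw]]] := @ode_solution R _ W b0 a0 oW CG.
  by rewrite /W /= ptk addr0.
pose B := swap @^-1` (box b0 a0 d).
have oB : open B := diffeo_openr (diffeo_swap (open_box (s0:=b0) (t0:=a0) (r:=d))).
pose F (x : plane R) : R := x 0 1 + w (swap x).
have Cw' : Cinf B (fun x => w (swap x)).
  by apply: (Cinf_comp oB Cw (smooth_swap oB)) => x.
have CF : Cinf B F by apply: (CinfD oB); [exact: Cinf_coord|exact: Cw'].
have pw i x : B x -> partial i (fun x => w (swap x)) x =
    if i == 0 then partial 1 w (swap x) else partial 0 w (swap x).
  move=> Bx; have E0 : (fun y => swap y 0 0) = fun y => y 0 1 by apply/funext => y; rewrite pt0.
  have E1 : (fun y => swap y 0 1) = fun y => y 0 0 by apply/funext => y; rewrite pt1.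
  rewrite (partial_plane_comp i oB _ Cw (smooth_swap oB) Bx Bx); last exact: open_box.
  rewrite E0 E1 !partial_coord.
  by case: (ordI2 i) => -> /=; rewrite ?mul0r ?mul1r ?add0r ?addr0.
have F0 x : B x -> V (shear F x) /\ partial 0 F x = p (shear F x).
  move=> Bx; have [Wx Ex] := Hw _ Bx; move: Wx Ex; rewrite /W /= ptk /swap !pt0 !pt1 => Wx Ex.
  split; first exact: Wx.
  rewrite /F partialD; [|exact: differentiable_coord|exact: Cinf_diff Cw' Bx].
  by rewrite partial_coord add0r pw//= Ex.
have Bx0 : B (pt a0 b0) by rewrite /B /preimage /= /swap pt0 pt1; apply/box_pt; rewrite !subrr normr0.
have F1 : partial 1 F (pt a0 b0) = 1.
  rewrite /F partialD; [|exact: differentiable_coord|exact: Cinf_diff Cw' Bx0].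
  rewrite partial_coord eqxx pw//= /swap pt0 pt1.
  by rewrite (partial0_initial w0) ?addr0// subrr normr0.
have [|U [U' [g [df Ux0 UB gE Fp]]]] := @shear_diffeo R B F (pt a0 b0) oB CF Bx0.
  by rewrite F1.
pose sig y := g y 0 1.
have oU := diffeo_openl df; have oU' := diffeo_openr df.
have sF := diffeo_smooth df.
have Csig : Cinf U' sig by exact: (field_Cinf oU' 1 (diffeo_smoothr df)).
have gs y : U' y -> g y = shear sig y.
  by move=> U'y; rewrite (ptE (g y)) gE.
have shx0 : shear F (pt a0 b0) = pt a0 b0.
  rewrite /shear /F /swap !pt0 !pt1 w0 ?addr0//.
  by rewrite subrr normr0.
have dg : diffeo U' U (shear sig) (shear F).
  have [h1 h2 h3 h4 h5 h6 h7 h8] := df; apply: (Diffeo oU' oU _ h3 _ _ _ h7).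
  - by move=> y U'y; rewrite -gs; [exact: h4|].
  - by move=> y U'y; rewrite -gs; [exact: h6|].
  - by move=> x Ux; rewrite -gs; [exact: h5|exact: h3].
  - exact: (smooth_ext oU' gs h8).
exists U', U, sig, (shear F); split => //.
- by rewrite -shx0; exact: (diffeo_mapl df).
- move=> y U'y; rewrite -(diffeoKr df U'y); apply: (F0 _ _).1.
  by apply: UB; exact: (diffeo_mapr df).
move=> y U'y; pose x := g y; have Ux : U x by exact: (diffeo_mapr df).
have Bx : B x by exact: UB.
have yE : y = shear F x by rewrite /x (diffeoKr df).
have E i : partial i (fun x => sig (shear F x)) x = (1 == i)%:R.
  rewrite -(@partial_coord R 2 i 1 x); apply: (eq_partial oU) Ux => z Uz.
  by rewrite /sig (diffeoK df Uz).
have P i : partial i (fun x => sig (shear F x)) x =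
   (0 == i)%:R * partial 0 sig y + partial i F x * partial 1 sig y.
  rewrite (partial_plane_comp i oU oU' Csig sF Ux); last by rewrite -yE.
  rewrite -yE; congr (_ * _ + _ * _).
    rewrite -(@partial_coord R 2 i 0 x); congr (partial i _ x).
    by apply/funext => z; rewrite pt0.
  by congr (partial i _ x); apply/funext => z; rewrite pt1.
have := E 0; have := E 1; rewrite !P /= mul0r add0r mul1r => E1 E0.
rewrite yE -(F0 x Bx).2 -yE; split => //.
by rewrite -(pmulr_rgt0 _ (Fp x Ux)) E1 ltr01.
Qed.

(** First integrals s0 and s1 of the two slopes are the new coordinates. The map
    (s1, s0) is the shear by s1 followed by a swap and by a shear in the new
    variables, whose vertical derivative is (q - p) times that of s0, hence
    positive. *)
Lemma adapted_coordinates (V : set (plane R)) (p q : plane R -> R) (x0 : plane R) : open V ->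
  Cinf V p -> Cinf V q -> V x0 -> p x0 < q x0 ->
  exists U U' f g, [/\ diffeo U U' f g, U x0, U `<=` V & forall x, U x ->
    ('D_(pt 1 (p x)) f x : plane R) 0 1 = 0 /\ ('D_(pt 1 (q x)) f x : plane R) 0 0 = 0].
Proof.
move=> oV Cp Cq Vx0 pq.
have [U0 [U0' [s0 [g0 [d0 U0x0 U0V Cs0 Hs0]]]]] := first_integral oV Cp Vx0.
have [U1 [U1' [s1 [g1 [d1 U1x0 U1V Cs1 Hs1]]]]] := first_integral oV Cq Vx0.
pose W := U0 `&` U1.
have oW : open W by apply: openI; [exact: diffeo_openl d0|exact: diffeo_openl d1].
have WU1 : W `<=` U1 by move=> x [].
have WU0 : W `<=` U0 by move=> x [].
have dA := diffeo_restrl d1 oW WU1.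
set A' := U1' `&` _ in dA.
have oA' : open A' := diffeo_openr dA.
have dB := diffeo_comp dA (diffeo_swap oA').
set B := swap @^-1` A' in dB.
have oB : open B := diffeo_openr dB.
set T := swap \o shear s1 in dB; set T' := g1 \o swap in dB.
pose F y := s0 (T' y).
have CF : Cinf B F.
  apply: (Cinf_comp oB (Cinf_sub WU0 Cs0) (diffeo_smoothr dB)).
  exact: diffeo_mapr dB.
have Wx0 : W x0 by [].
have BTx0 : B (T x0) by exact: (diffeo_mapl dB).
have T0 y : T y 0 0 = s1 y by rewrite /T /= /swap pt0 /shear pt1.
have T1 y : T y 0 1 = y 0 0 by rewrite /T /= /swap pt1 /shear pt0.
have FT x : W x -> F (T x) = s0 x by move=> Wx; rewrite /F (diffeoK dB Wx).
have PF i x : W x -> partial i s0 x =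
    partial i s1 x * partial 0 F (T x) + (0 == i)%:R * partial 1 F (T x).
  move=> Wx; rewrite -(eq_partial oW i FT Wx).
  rewrite (partial_plane_comp i oW oB CF (diffeo_smooth dB) Wx (diffeo_mapl dB Wx)).
  have -> : (fun y => T y 0 0) = s1 by apply/funext => y; exact: T0.
  have -> : (fun y => T y 0 1) = (fun y => y 0 0) by apply/funext => y; exact: T1.
  by rewrite partial_coord.
have F1 : 0 < partial 1 F (T x0).
  have [h0 h0'] := Hs0 x0 U0x0; have [h1 h1'] := Hs1 x0 U1x0.
  have := PF 0 x0 Wx0; have := PF 1 x0 Wx0; rewrite /= mul0r addr0 mul1r.
  move: (partial 0 F _) (partial 1 F _) h0 h0' h1 h1' pq.
  move: (partial 0 s0 _) (partial 1 s0 _) (partial 0 s1 _) (partial 1 s1 _) (p x0) (q x0).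
  move=> a b c d u v X Y h0 h0' h1 h1' uv E1 E0.
  have -> : Y = b * (v - u).
    have -> : Y = a - c * X by rewrite E0 addrC addKr.
    have -> : a = - (u * b) by lra.
    have -> : c = - (v * d) by lra.
    by rewrite E1; ring.
  by rewrite mulr_gt0// subr_gt0.
have [K [K' [h [dS KT KB _ _]]]] := shear_diffeo oB CF BTx0 F1.
have oK := diffeo_openl dS.
have dC := diffeo_comp (diffeo_restr dB oK KB) dS.
set U := W `&` _ in dC.
exists U, K', (shear F \o T), (T' \o h); split.
- exact: dC.
- by split.
- by move=> x [/WU0 /U0V].
move=> x Ux; have [Wx _] := Ux; have oU := diffeo_openl dC.
have E0 y : (shear F \o T) y 0 0 = s1 y by rewrite /= /shear pt0 T0.
have E1 y : U y -> (shear F \o T) y 0 1 = s0 y by move=> [Wy _]; rewrite /= /shear pt1 FT.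
have dirs i (r : R) (s : plane R -> R) :
    (forall y, U y -> (shear F \o T) y 0 i = s y) -> partial 0 s x + r * partial 1 s x = 0 ->
    ('D_(pt 1 r) (shear F \o T) x : plane R) 0 i = 0.
  move=> E <-; apply: etrans (deriv_field oU (pt 1 r) i (diffeo_smooth dC) Ux) _.
  by rewrite pt0 pt1 mul1r !(eq_partial oU _ E Ux).
split; apply: dirs; [exact: E1|exact: (Hs0 x (WU0 x Wx)).1|by move=> y _; exact: E0|].
exact: (Hs1 x (WU1 x Wx)).1.
Qed.

End Adapted.

(** * Parallel line fields *)

Section Slopes.
Variable R : realType.

Lemma Cinf_pt n (W : set 'rV[R]_n) (V : set (plane R)) h a b : open W -> Cinf V h ->
  Cinf W a -> Cinf W b -> (forall z, W z -> V (pt (a z) (b z))) ->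
  Cinf W (fun z => h (pt (a z) (b z))).
Proof.
move=> oW Ch Ca Cb WV k.
apply: (@Ck_comp R n W oW k 2 V h (fun j z => if j == 0 then a z else b z)) => //.
by move=> j; case: (j == 0); [exact: Ca|exact: Cb].
Qed.

Lemma open_pt n (W : set 'rV[R]_n) (V : set (plane R)) a b : open W -> open V ->
  Cinf W a -> Cinf W b -> open (W `&` [set z | V (pt (a z) (b z))]).
Proof.
move=> oW oV Ca Cb; rewrite openE => z [Wz Vz]; apply: filterI; first exact: open_nbhs_nbhs.
have : {for z, continuous (fun z => pt (a z) (b z))}.
  by apply: row_continuous => j; case: (j == 0); [exact: Cinf_cont Ca Wz|exact: Cinf_cont Cb Wz].
by apply; exact: open_nbhs_nbhs.
Qed.

(** The integrating factor exp (- int b) turns the equation e_t = b e into the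
    statement that a function is constant on vertical lines. *)
Lemma linear_ode_zero (e b : plane R -> R) (s0 t0 r : R) : 0 < r ->
  Cinf (box s0 t0 r) e -> Cinf (box s0 t0 r) b ->
  (forall x, box s0 t0 r x -> partial 1 e x = b x * e x) ->
  (forall s, `|s - s0| < r -> e (pt s t0) = 0) ->
  forall x, box s0 t0 r x -> e x = 0.
Proof.
move=> r0 Ce Cb Ee e0 x Bx; have oB := open_box (s0 := s0) (t0 := t0) (r := r).
have [be Hbe] : exists be, vertical_primitive s0 t0 r be b by apply: vertical_primitive_exists => // y; exact: Cinf_cont.
have Cbe : Cinf (box s0 t0 r) be by move=> k; exact: vertical_primitive_Ck Hbe.
pose h y := e y * expR (- be y).
have CE : Cinf (box s0 t0 r) (fun y => expR (- be y)).
  by move=> k; apply: Ck_exp => //; exact: CinfN.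
have Ch : Cinf (box s0 t0 r) h by exact: CinfM.
have h1 y : box s0 t0 r y -> partial 1 h y = 0.
  move=> By; rewrite /h partialM; [|exact: Cinf_diff Ce By|exact: Cinf_diff CE By].
  rewrite partial_exp; last exact: (Cinf_diff (CinfN oB Cbe) By).
  rewrite partialN; last exact: Cinf_diff Cbe By.
  rewrite Ee// (is_derive_partial (Hbe.2 y By)).
  by move: (expR _) => E; ring.
suff : h x = 0 by rewrite /h => /eqP; rewrite mulf_eq0 (gt_eqF (expR_gt0 _)) orbF => /eqP.
move: Bx; rewrite (ptE x); move: (x 0 0) (x 0 1) => s t /box_pt[sr tr].
have [d td /andP[d0 dr]] := intermediate_radius tr.
apply/eqP; rewrite -normr_le0.
have := @bounded_derivative R (fun t => h (pt s t)) (fun=> 0) t0 d 0 (ltW d0) (lexx 0).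
rewrite mulr0 => H; apply: H (ltW td).
- by rewrite /h e0// mul0r.
- move=> u ud; apply/slice1.
  have Bu : box s0 t0 r (pt s u) by apply/box_pt; split=> //; exact: le_lt_trans dr.
  by rewrite -(h1 _ Bu); exact: derivable_partial (Cinf_diff Ch Bu).
- by move=> u _; rewrite normr0.
Qed.

(** A primitive of g in the second variable is corrected by a function of the first
    variable alone. *)
Lemma poincare (s0 t0 r : R) (f g : plane R -> R) : 0 < r ->
  Cinf (box s0 t0 r) f -> Cinf (box s0 t0 r) g ->
  (forall x, box s0 t0 r x -> partial 1 f x = partial 0 g x) ->
  exists phi, Cinf (box s0 t0 r) phi /\ forall x, box s0 t0 r x ->
    partial 0 phi x = f x /\ partial 1 phi x = g x.
Proof.
move=> r0 Cf Cg fg; have oB s t := open_box (s0 := s) (t0 := t) (r := r).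
have dd (u : R) : `|u - u| < r by rewrite subrr normr0.
pose f0 (x : plane R) := f (pt (x 0 1) t0).
have Cf0 : Cinf (box t0 s0 r) f0.
  apply: (Cinf_pt (oB _ _) Cf); [exact: Cinf_coord|exact: Cinf_cst|].
  by move=> z [_ z1]; apply/box_pt.
have [Q HQ] : exists Q, vertical_primitive t0 s0 r Q f0 by apply: vertical_primitive_exists => // y; exact: Cinf_cont.
have CQ : Cinf (box t0 s0 r) Q by move=> k; exact: vertical_primitive_Ck HQ.
have [P HP] : exists P, vertical_primitive s0 t0 r P g by apply: vertical_primitive_exists => // y; exact: Cinf_cont.
have CP : Cinf (box s0 t0 r) P by move=> k; exact: vertical_primitive_Ck HP.
pose psi (x : plane R) := Q (pt t0 (x 0 0)).
have Cpsi : Cinf (box s0 t0 r) psi.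
  apply: (Cinf_pt (oB _ _) CQ); [exact: Cinf_cst|exact: Cinf_coord|].
  by move=> z [z0 _]; apply/box_pt.
have psi0 x : box s0 t0 r x -> partial 0 psi x = f (pt (x 0 0) t0).
  rewrite (ptE x); move: (x 0 0) (x 0 1) => s t /box_pt[sr tr]; rewrite pt0.
  apply: is_derive_partial; apply/slice0.
  have -> : (fun s => psi (pt s t)) = (fun s => Q (pt t0 s)).
    by apply/funext => u; rewrite /psi pt0.
  by have := vertical_primitive_slice HQ (dd t0) sr; rewrite /f0 pt1.
have psi1 x : partial 1 psi x = 0.
  rewrite (ptE x); move: (x 0 0) (x 0 1) => s t; apply: is_derive_partial; apply/slice1.
  have -> : (fun t => psi (pt s t)) = cst (psi (pt s t)).
    by apply/funext => u; rewrite /psi !pt0.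
  exact: is_derive_cst.
have P1 x : box s0 t0 r x -> partial 1 P x = g x.
  by move=> Bx; exact: is_derive_partial (HP.2 x Bx).
(* This difference does not depend on t, as f_t = g_s, and vanishes at t0. *)
have P0 x : box s0 t0 r x -> partial 0 P x - (f x - f (pt (x 0 0) t0)) = 0.
  move=> Bx; pose F (x : plane R) := f (pt (x 0 0) t0).
  have CF : Cinf (box s0 t0 r) F.
    apply: (Cinf_pt (oB _ _) Cf); [exact: Cinf_coord|exact: Cinf_cst|].
    by move=> z [z0 _]; apply/box_pt.
  have F1 y : partial 1 F y = 0.
    rewrite (ptE y); move: (y 0 0) (y 0 1) => s t; apply: is_derive_partial; apply/slice1.
    have -> : (fun t => F (pt s t)) = cst (F (pt s t)).
      by apply/funext => u; rewrite /F !pt0.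
    exact: is_derive_cst.
  have CP0 := Cinf_partial 0 CP.
  apply: (linear_ode_zero (e := fun x => partial 0 P x - (f x - F x)) (b := fun=> 0) r0) Bx.
  - apply: CinfD => //; apply: CinfN => //; apply: CinfD => //; exact: CinfN.
  - exact: Cinf_cst.
  - move=> y By; have oB' := oB s0 t0.
    have -> : partial 1 (fun x => partial 0 P x - (f x - F x)) y =
       partial 1 (partial 0 P) y - (partial 1 f y - partial 1 F y).
      by eapply hp_eq; [solve_partial|].
    rewrite (Schwarz 1 0 oB' (CP 2) By) (eq_partial oB' 0 P1 By) fg// F1.
    by rewrite subr0 subrr mul0r.
  - move=> s sr; rewrite /F pt0 subrr subr0; exact: (partial0_initial HP.1 sr).
exists (fun x => psi x + P x); split; first exact: CinfD.
move=> x Bx; rewrite !partialD; try exact: Cinf_diff Bx.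
rewrite psi0// psi1 P1// add0r; split=> //.
by have := P0 x Bx; move: (partial 0 P x) => a; lra.
Qed.

Section Parallel.
Variables (V : set (plane R)) (nab : vfield R -> vfield R -> vfield R).
Hypotheses (oV : open V) (Hn : is_connection V nab).
Local Notation G := (christoffel nab).

(** The field e_0 + p e_1 spans a parallel line field iff d_i p = slope_rhs i x p
    for both i. *)
Definition slope_rhs i (x : plane R) (p : R) :=
  - G i 0 1 x + p * (G i 0 0 x + - G i 1 1 x) + p * p * G i 1 0 x.

Hypotheses (K01 : forall x, V x -> curv_coef nab 0 1 x = 0)
  (K10 : forall x, V x -> curv_coef nab 1 0 x = 0)
  (K00 : forall x, V x -> curv_coef nab 0 0 x = curv_coef nab 1 1 x).

Lemma slope_rhs_Cinf n (W : set 'rV[R]_n) i a b q : open W -> Cinf W a -> Cinf W b ->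
  Cinf W q -> (forall z, W z -> V (pt (a z) (b z))) ->
  Cinf W (fun z => slope_rhs i (pt (a z) (b z)) (q z)).
Proof.
move=> oW Ca Cb Cq WV; have CG i' j k := Cinf_pt oW (G_Cinf oV Hn i' j k) Ca Cb WV.
rewrite /slope_rhs; apply: (CinfD oW); last by apply: CinfM => //; exact: CinfM.
apply: (CinfD oW); first exact: CinfN.
by apply: CinfM => //; apply: CinfD => //; exact: CinfN.
Qed.

(** By the symmetry of second derivatives the defect of the horizontal equation
    satisfies a linear equation along vertical lines; the inhomogeneous term is the
    action of the curvature on directions, which vanishes for a multiple of the
    identity. *)
Lemma slope_propagate (s0 t0 d : R) (p : plane R -> R) (B := box s0 t0 d) : 0 < d ->
  B `<=` V -> Cinf B p -> (forall x, B x -> partial 1 p x = slope_rhs 1 x (p x)) ->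
  (forall s, `|s - s0| < d -> partial 0 p (pt s t0) = slope_rhs 0 (pt s t0) (p (pt s t0))) ->
  forall x, B x -> partial 0 p x = slope_rhs 0 x (p x).
Proof.
move=> d0 BV Cp E1 E00.
have oB : open B by exact: open_box.
have CA i : Cinf B (fun x => slope_rhs i x (p x)).
  have E (x : plane R) : slope_rhs i (pt (x 0 0) (x 0 1)) (p x) = slope_rhs i x (p x).
    by rewrite -ptE.
  apply: (Cinf_ext oB (fun x _ => E x)).
  apply: (slope_rhs_Cinf i oB); [exact: Cinf_coord|exact: Cinf_coord|exact: Cp|].
  by move=> z /BV; rewrite -ptE.
have CG i j k : Cinf B (G i j k) := Cinf_sub BV (G_Cinf oV Hn i j k).
move=> x Bx; apply/eqP; rewrite -subr_eq0; apply/eqP; move: x Bx.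
apply: (linear_ode_zero (e := fun x => partial 0 p x + - slope_rhs 0 x (p x))
    (b := fun x => (G 1 0 0 x + - G 1 1 1 x) + (p x + p x) * G 1 1 0 x) d0).
  - by apply: CinfD => //; [exact: Cinf_partial|exact: CinfN].
  - by solve_Cinf.
  - move=> y By.
    rewrite partialD;
      [|exact: Cinf_diff (Cinf_partial 0 Cp) By|exact: Cinf_diff (CinfN oB (CA 0)) By].
    rewrite partialN; last exact: Cinf_diff (CA 0) By.
    rewrite (Schwarz 1 0 oB (Cp 2) By) (eq_partial oB 0 E1 By).
    have -> : partial 0 (fun x => slope_rhs 1 x (p x)) y =
      - partial 0 (G 1 0 1) y + (p y * (partial 0 (G 1 0 0) y + - partial 0 (G 1 1 1) y)
       + (G 1 0 0 y + - G 1 1 1 y) * partial 0 p y)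
      + (p y * p y * partial 0 (G 1 1 0) y + G 1 1 0 y * (p y * partial 0 p y + p y * partial 0 p y)).
      by rewrite /slope_rhs; eapply hp_eq; [solve_partial|].
    have -> : partial 1 (fun x => slope_rhs 0 x (p x)) y =
      - partial 1 (G 0 0 1) y + (p y * (partial 1 (G 0 0 0) y + - partial 1 (G 0 1 1) y)
       + (G 0 0 0 y + - G 0 1 1 y) * partial 1 p y)
      + (p y * p y * partial 1 (G 0 1 0) y + G 0 1 0 y * (p y * partial 1 p y + p y * partial 1 p y)).
      by rewrite /slope_rhs; eapply hp_eq; [solve_partial|].
    rewrite E1//; apply/eqP; rewrite -subr_eq0; apply/eqP.
    transitivity (- curv_coef nab 0 1 y + p y * (curv_coef nab 0 0 y - curv_coef nab 1 1 y) +
      p y * p y * curv_coef nab 1 0 y).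
      by rewrite /curv_coef /slope_rhs; abstract_atoms; move: (p y) => *; ring.
    rewrite (K01 (BV _ By)) (K10 (BV _ By)) (K00 (BV _ By)) subrr.
    by rewrite !mulr0 oppr0 !addr0.
  - by move=> s sd; rewrite E00// subrr.
Qed.

(** The system is solved along one horizontal line, and from there along the
    vertical lines that meet it. *)
Lemma slope_exists (x0 : plane R) (q : R) : V x0 -> exists U p, [/\ open U, U x0,
  U `<=` V & Cinf U p /\ p x0 = q /\ forall x, U x -> forall i, partial i p x = slope_rhs i x (p x)].
Proof.
rewrite (ptE x0); move: (x0 0 0) (x0 0 1) => s0 t0 Vx0.
have dd (r u : R) : 0 < r -> `|u - u| < r by rewrite subrr normr0.
pose W1 : set 'rV[R]_3 := setT `&` [set z | V (pt (z 0 1) t0)].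
have oW1 : open W1.
  by apply: (open_pt openT oV); [exact: Cinf_coord|exact: Cinf_cst].
have CG1 : Cinf W1 (fun z => slope_rhs 0 (pt (z 0 1) t0) (q + z 0 2)).
  apply: (slope_rhs_Cinf 0 oW1); [exact: Cinf_coord|exact: Cinf_cst| |by move=> z []].
  by apply: (CinfD oW1); [exact: Cinf_cst|exact: Cinf_coord].
have [|d1 d10 [w1 [Cw1 w10 Hw1]]] := ode_solution (s0 := s0) (t0 := s0) oW1 CG1.
  by split=> //=; rewrite pt3E1.
pose p0 s := q + w1 (pt s0 s).
have p0E s : `|s - s0| < d1 -> is_derive s 1 p0 (slope_rhs 0 (pt s t0) (p0 s)).
  move=> sd; have Bs : box s0 s0 d1 (pt s0 s) by apply/box_pt; split=> //; exact: dd.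
  have [_] := Hw1 _ Bs; rewrite !pt3E1 pt3E2 pt1 => E.
  have D := (slice1 w1 s0 s _).2 (derivable_partial 1 (Cinf_diff Cw1 Bs)).
  rewrite E in D; rewrite -[X in is_derive _ _ _ X]add0r.
  by apply: is_deriveD.
pose W2 : set 'rV[R]_3 := (setT `&` [set z | V (pt (z 0 0) (z 0 1))]) `&`
  [set z | box s0 s0 d1 (pt s0 (z 0 0))].
have oW2' : open (setT `&` [set z : 'rV[R]_3 | V (pt (z 0 0) (z 0 1))]).
  by apply: (open_pt openT oV); exact: Cinf_coord.
have oW2 : open W2.
  by apply: (open_pt oW2' (open_box (s0:=_) (t0:=_) (r:=_))); [exact: Cinf_cst|exact: Cinf_coord].
have Cp0 n (W : set 'rV[R]_n) i : open W -> (forall z, W z -> box s0 s0 d1 (pt s0 (z 0 i))) ->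
    Cinf W (fun z => p0 (z 0 i)).
  move=> oW WB; apply: (CinfD oW); first exact: Cinf_cst.
  by apply: (Cinf_pt oW Cw1); [exact: Cinf_cst|exact: Cinf_coord|].
have CG2 : Cinf W2 (fun z => slope_rhs 1 (pt (z 0 0) (z 0 1)) (p0 (z 0 0) + z 0 2)).
  apply: (slope_rhs_Cinf 1 oW2); [exact: Cinf_coord|exact: Cinf_coord| |by move=> z [[]]].
  by apply: (CinfD oW2); [apply: (Cp0 _ _ 0 oW2) => z []|exact: Cinf_coord].
have [|d d0 [w [Cw w0 Hw]]] := ode_solution (s0 := s0) (t0 := t0) oW2 CG2.
  by split; [split=> //=; rewrite pt3E0 pt3E1|rewrite /= pt3E0; apply/box_pt; split; exact: dd].
pose B := box s0 t0 d; have oB : open B by exact: open_box.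
pose p (x : plane R) := p0 (x 0 0) + w x.
have BW x : B x -> V x /\ box s0 s0 d1 (pt s0 (x 0 0)).
  by move=> /Hw[[[_ +] +] _]; rewrite /= !pt3E0 pt3E1 -ptE.
have BV : B `<=` V by move=> x /BW[].
have CP0 : Cinf B (fun x => p0 (x 0 0)) by apply: (Cp0 _ _ 0 oB) => x /BW[].
have Cp : Cinf B p by exact: CinfD.
have P00 x : B x -> partial 0 (fun x => p0 (x 0 0)) x = slope_rhs 0 (pt (x 0 0) t0) (p0 (x 0 0)).
  move=> Bx; have [_] := BW x Bx; rewrite (ptE x); move: (x 0 0) (x 0 1) => s t.
  rewrite !pt0 => /box_pt[_ sd].
  apply: is_derive_partial; apply/slice0.
  have -> : (fun s => p0 (pt s t 0 0)) = p0 by apply/funext => u; rewrite pt0.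
  exact: p0E.
have P01 (x : plane R) : partial 1 (fun x => p0 (x 0 0)) x = 0.
  rewrite (ptE x); move: (x 0 0) (x 0 1) => s t; apply: is_derive_partial; apply/slice1.
  have -> : (fun t => p0 (pt s t 0 0)) = cst (p0 s).
    by apply/funext => u; rewrite pt0.
  exact: is_derive_cst.
have E1 x : B x -> partial 1 p x = slope_rhs 1 x (p x).
  move=> Bx; rewrite /p partialD; [|exact: Cinf_diff CP0 Bx|exact: Cinf_diff Cw Bx].
  by rewrite P01 add0r (Hw x Bx).2 !pt3E0 pt3E1 pt3E2 -ptE.
have E00 s : `|s - s0| < d -> partial 0 p (pt s t0) = slope_rhs 0 (pt s t0) (p (pt s t0)).
  move=> sd; have Bs : B (pt s t0) by apply/box_pt; split=> //; exact: dd.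
  rewrite /p partialD; [|exact: Cinf_diff CP0 Bs|exact: Cinf_diff Cw Bs].
  by rewrite P00// (partial0_initial w0 sd) addr0 pt0 w0// addr0.
exists B, p; split=> //; first by apply/box_pt; split; exact: dd.
split; first exact: Cp.
split; first by rewrite /p /p0 pt0 w0 ?dd// w10 ?dd// !addr0.
move=> x Bx i; case: (ordI2 i) => ->; last exact: E1.
exact: (slope_propagate d0 BV Cp).
Qed.

End Parallel.

End Slopes.

(** * Normal form of a connection with skew Ricci tensor *)

Section Directions.
Variables (R : realType) (V : set (plane R)) (nab : vfield R -> vfield R -> vfield R).
Hypotheses (oV : open V) (Hn : is_connection V nab).
Local Notation G := (christoffel nab).
Local Notation e_ := (@coord_field R).

Lemma skew_curv_coef : (forall x, V x -> forall j k, rho nab j k x = - rho nab k j x) ->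
  forall x, V x -> [/\ curv_coef nab 0 1 x = 0, curv_coef nab 1 0 x = 0 &
    curv_coef nab 0 0 x = curv_coef nab 1 1 x].
Proof.
move=> sk x Vx; have H j k := sk x Vx j k.
move: (H 0 0) (H 1 1) (H 0 1); rewrite !(rhoE oV Hn _ _ Vx) /=.
move: (curv_coef _ _ _ _) (curv_coef _ _ _ _) (curv_coef _ _ _ _) (curv_coef _ _ _ _).
by move=> a b c d h1 h2 h3; split; lra.
Qed.

Lemma christoffel_sym i j k x : V x -> G i j k x = G j i k x.
Proof.
move=> Vx; have se m : smooth_on V (e_ m : vfield R) by exact: smooth_coord_field.
apply/eqP; rewrite -subr_eq0 !christoffel_def -rowB.
rewrite (connection_torsion_free Hn (se i) (se j) Vx) lie_bracket_def /coord_field.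
by rewrite !derive_cst subrr vec0.
Qed.

Lemma parallel_field (p : plane R -> R) (X : vfield R) x : Cinf V p ->
  (forall x, V x -> forall i, partial i p x = slope_rhs nab i x (p x)) ->
  smooth_on V X -> V x -> nab X (fun y => pt 1 (p y)) x =
    (X x 0 0 * (G 0 0 0 x + p x * G 0 1 0 x) + X x 0 1 * (G 1 0 0 x + p x * G 1 1 0 x))
      *: pt 1 (p x).
Proof.
move=> Cp Ep sX Vx; pose L y : plane R := pt 1 (p y).
have L0 : (fun y => L y 0 0) = fun=> 1 by apply/funext => y; rewrite pt0.
have L1 : (fun y => L y 0 1) = p by apply/funext => y; rewrite pt1.
have sL : smooth_on V (L : vfield R).
  apply: (Cinf_field oV) => j; case: (ordI2 j) => ->; first by rewrite L0; exact: Cinf_cst.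
  by rewrite L1.
have c0 i : partial i (fun=> 1) x = 0 by rewrite partialE derive_cst.
apply: rV2P; rewrite (nabE oV Hn _ sX sL Vx) rowZ ?L0 ?L1 /L ?pt0 ?pt1 ?c0 ?Ep//.
  by abstract_atoms; move: (p x) => *; ring.
by rewrite /slope_rhs; abstract_atoms; move: (p x) => *; ring.
Qed.

(** Since e_a is proportional to L, its covariant derivatives are proportional to it
    as well. *)
Lemma direction_christoffel (L : vfield R) (a b i : 'I_2) x : a != b -> smooth_on V L ->
  (forall y, V y -> L y 0 b = 0) -> V x -> L x <> 0 -> nab (e_ i) L x 0 b = 0 ->
  G i a b x = 0.
Proof.
move=> ab sL Lb Vx Lx; have se m : smooth_on V (e_ m : vfield R) by exact: smooth_coord_field.
have La : L x 0 a != 0.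
  apply/eqP => La; apply: Lx; have Lbx := Lb x Vx.
  move: ab La Lbx; case: (ordI2 a) => ->; case: (ordI2 b) => -> // _ h1 h2;
    by apply: rV2P; rewrite vec0.
rewrite (nabE oV Hn b (se i) sL Vx).
have z m : partial m (fun y => L y 0 b) x = 0.
  by rewrite (eq_partial (g := fun=> 0) oV m Lb Vx) partialE derive_cst.
rewrite !z !add0r => E; apply: (mulfI La); rewrite mulr0 -{}E.
have Lbx := Lb x Vx; rewrite /coord_field /cst.
move: ab La Lbx; case: (ordI2 a) => ->; case: (ordI2 b) => -> // _ _ h2;
  case: (ordI2 i) => ->; rewrite -> ?e00, ?e01, ?e10, ?e11; rewrite h2;
  by rewrite ?mul0r ?mul1r ?add0r ?addr0.
Qed.

End Directions.

Section ForwardCharts.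
Variables (R : realType) (S : surface R) (D : affine_connection S).

Lemma same_sym (c c' : chart R S) X X' : atlas c -> atlas c' ->
  same_vfield c c' X X' -> same_vfield c' c X' X.
Proof.
move=> ac ac' XX p dp' dp; rewrite (XX p dp dp').
have d1 := transition_diff ac ac' dp dp'; have d2 := transition_diff ac' ac dp' dp.
have E : transition c c' (coord c p) = coord c' p by exact: transitionE.
rewrite -E in d2 *; rewrite -deriv_vcomp//.
have o1 : open (coord c @` (dom c `&` dom c')).
  by apply: open_coord_image; [apply: openI; exact: dom_open|move=> ? []].
rewrite -[LHS](derive_id (coord c p) (X (coord c p))); apply: near_eq_derive.
apply: (smooth_on_near o1); last by exists p.
by move=> _ [q [dq dq'] <-]; rewrite /= transitionE// transitionE.
Qed.

(** Being proportional to one's covariant derivatives does not depend on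
    coordinates. *)
Lemma recurrent_push (c c' : chart R S) (L : vfield R) (mu : vfield R -> plane R -> R)
    (X : vfield R) p (ac : atlas c) (ac' : atlas c') (dd : dom c = dom c') :
  smooth_on (img c) L -> (forall X x, smooth_on (img c) X -> img c x ->
    nabla D c X L x = mu X x *: L x) ->
  smooth_on (img c') X -> dom c' p ->
  exists m, nabla D c' X (push c c' L) (coord c' p) = m *: push c c' L (coord c' p).
Proof.
move=> sL HL sX dp'; have dp : dom c p by rewrite dd.
have dd' := esym dd.
have sX1 := push_smooth ac' ac dd' sX; set X1 := push c' c X in sX1.
have XX : same_vfield c c' X1 X.
  by apply: (same_sym ac' ac); exact: push_same.
have := @nabla_compatible R S D c c' X1 X L (push c c' L) ac ac' sX1 sX sL
  (push_smooth ac ac' dd sL) XX (push_same L) p dp dp'.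
rewrite (HL _ _ sX1 (coord_img dp)) => ->.
rewrite derivZ_dir; last exact: transition_diff.
by exists (mu X1 (coord c p)); rewrite push_at.
Qed.

(** In coordinates adapted to two parallel line fields every covariant derivative of
    a coordinate field is proportional to it. By symmetry of the Christoffel symbols
    only G 0 0 0 and G 1 1 1 survive, and skewness of rho says that the form - G 0 0
    0 du_0 + G 1 1 1 du_1 is closed; phi is its potential, and d_1 d_0 phi = rho
    (e_1, e_0). *)
Lemma skew_ricci_normal_form :
  (forall (c : chart R S), atlas c -> forall x, img c x -> forall j k,
    rho (nabla D c) j k x = - rho (nabla D c) k j x) ->
  (forall (c : chart R S), atlas c -> forall x, img c x -> rho (nabla D c) 0 1 x != 0) ->
  forall p : S, exists c : chart R S, [/\ atlas c, dom c p &
    exists2 phi : plane R -> R, smooth_on (img c) phi & has_normal_form D c phi].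
Proof.
move=> sk nz P; have [c ac dP] := atlas_cover P.
have oc := open_img c; have Hn := nablaP D ac.
have K x ix := skew_curv_coef oc Hn (sk c ac) (x := x) ix.
have K01 x (ix : img c x) : curv_coef (nabla D c) 0 1 x = 0 by have [] := K x ix.
have K10 x (ix : img c x) : curv_coef (nabla D c) 1 0 x = 0 by have [] := K x ix.
have K00 x (ix : img c x) : curv_coef (nabla D c) 0 0 x = curv_coef (nabla D c) 1 1 x.
  by have [] := K x ix.
have i0 := coord_img dP; set x0 := coord c P in i0.
have [U0 [p0 [oU0 U0x U0c [Cp0 [p0x Ep0]]]]] := slope_exists oc Hn K01 K10 K00 0 i0.
have [U1 [p1 [oU1 U1x U1c [Cp1 [p1x Ep1]]]]] := slope_exists oc Hn K01 K10 K00 1 i0.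
pose V := U0 `&` U1.
have oV : open V by exact: openI.
have VU0 : V `<=` U0 by move=> x [].
have VU1 : V `<=` U1 by move=> x [].
have [|U [U' [f [g [dfg Ux0 UV Hdir]]]]] := adapted_coordinates oV (Cinf_sub VU0 Cp0)
  (Cinf_sub VU1 Cp1) (conj U0x U1x).
  by rewrite p0x p1x ltr01.
have fx : U' (f x0) by exact: (diffeo_mapl dfg).
move: fx; rewrite (ptE (f x0)) => fx.
have [r r0 Br] := box_near (diffeo_openr dfg) fx.
set s0 := f x0 0 0 in Br; set t0 := f x0 0 1 in Br.
have oB := open_box (s0 := s0) (t0 := t0) (r := r).
have dB := diffeo_restr dfg oB Br; set Ub := U `&` _ in dB.
have Ubc : Ub `<=` img c by move=> x [/UV/VU0/U0c].
have oUb : open Ub := diffeo_openl dB.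
have Ubx0 : Ub x0.
  by split=> //; rewrite /preimage /= (ptE (f x0)); apply/box_pt; rewrite !subrr normr0.
have [c' [ac' D' co' pa']] := chart_of_diffeo ac dB Ubc.
have [c1 [ac1 D1 co1 pa1]] := restrict_chart ac oUb Ubc.
have I1 : img c1 = Ub := restrict_img Ubc D1 co1.
have dd : dom c1 = dom c' by rewrite D1 D'.
have I' : img c' = box s0 t0 r.
  rewrite eqEsubset; split=> [_ [q + <-]|y By].
    by rewrite D' => -[dq Uq]; rewrite co' /=; exact: (diffeo_mapl dB).
  have Ugy := diffeo_mapr dB By; have [q dq qE] := Ubc _ Ugy.
  exists q; first by rewrite D'; split=> //; rewrite /preimage /= qE.
  by rewrite co' /= qE (diffeoKr dB).
have d1c : dom c1 `<=` dom c by rewrite D1 => q [].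
have oc1 := open_img c1; have Hn1 := nablaP D ac1.
have oc' := open_img c'; have Hn' := nablaP D ac'.
have Tf x : img c1 x -> transition c1 c' x = f x.
  by move=> [q dq <-]; rewrite transitionE// co' co1.
(* In the new coordinates e_0 + p e_1 is a multiple of a coordinate field. *)
have main (p : plane R -> R) (a b : 'I_2) : a != b -> Cinf V p ->
    (forall x, V x -> forall i, partial i p x = slope_rhs (nabla D c) i x (p x)) ->
    (forall x, U x -> ('D_(pt 1 (p x)) f x : plane R) 0 b = 0) ->
    forall i y, img c' y -> christoffel (nabla D c') i a b y = 0.
  move=> ab CpV Ep Hb i.
  have UbV : Ub `<=` V by move=> x [/UV].
  have Cp : Cinf (img c1) p by rewrite I1; exact: Cinf_sub UbV CpV.
  have Ep1' x : img c1 x -> forall i, partial i p x = slope_rhs (nabla D c1) i x (p x).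
    move=> ix j; rewrite /slope_rhs !(christoffel_restrict D ac ac1 d1c co1 _ _ _ ix)//.
    by apply: Ep; apply: UbV; rewrite -I1.
  pose L y : plane R := pt 1 (p y).
  have sL : smooth_on (img c1) (L : vfield R).
    apply: (Cinf_field oc1) => j; case: (ordI2 j) => ->.
      by apply: (Cinf_ext oc1 _ (Cinf_cst _ (1 : R))) => x _; rewrite pt0.
    by apply: (Cinf_ext oc1 _ Cp) => x _; rewrite pt1.
  have Lb y : img c' y -> push c1 c' L y 0 b = 0.
    move=> [q dq <-]; have dq1 : dom c1 q by rewrite dd.
    have iq := coord_img dq1; rewrite push_at//.
    have -> : 'D_(L (coord c1 q)) (transition c1 c') (coord c1 q) =
        'D_(L (coord c1 q)) f (coord c1 q).
      by apply: near_eq_derive; exact: (smooth_on_near oc1 Tf iq).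
    by apply: Hb; move: iq; rewrite I1 => -[].
  move=> y [q dq <-]; have dq1 : dom c1 q by rewrite dd.
  apply: (direction_christoffel oc' Hn' ab (push_smooth ac1 ac' dd sL) Lb (coord_img dq)).
    rewrite push_at// => /(transition_inj ac1 ac' dq1 dq)/(congr1 (fun v : plane R => v 0 0)).
    by rewrite vec0 /L pt0 => /eqP; rewrite oner_eq0.
  have [m ->] := recurrent_push ac1 ac' dd sL
    (fun X x sX ix => parallel_field oc1 Hn1 Cp Ep1' sX ix)
    (smooth_coord_field oc' i : smooth_on _ (@coord_field R i : vfield R)) dq.
  by rewrite rowZ Lb ?mulr0//; exact: coord_img.
have Z01 i y (iy : img c' y) : christoffel (nabla D c') i 0 1 y = 0.
  apply: (main p0) => //; first exact: Cinf_sub Cp0.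
    by move=> x /VU0; exact: Ep0.
  by move=> x /Hdir[].
have Z10 i y (iy : img c' y) : christoffel (nabla D c') i 1 0 y = 0.
  apply: (main p1) => //; first exact: Cinf_sub Cp1.
    by move=> x /VU1; exact: Ep1.
  by move=> x /Hdir[].
have Z y (iy : img c' y) i j k : ~~ [&& i == 0, j == 0 & k == 0] ->
    ~~ [&& i == 1, j == 1 & k == 1] -> christoffel (nabla D c') i j k y = 0.
  case: (ordI2 i) => ->; case: (ordI2 j) => ->; case: (ordI2 k) => -> //= _ _;
    by rewrite ?Z01 ?Z10// (christoffel_sym oc' Hn' _ _ _ iy) ?Z01 ?Z10.
have CG i j k := G_Cinf oc' Hn' i j k.
have pZ y (iy : img c' y) m i j k : ~~ [&& i == 0, j == 0 & k == 0] ->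
    ~~ [&& i == 1, j == 1 & k == 1] -> partial m (christoffel (nabla D c') i j k) y = 0.
  move=> h0 h1; rewrite (eq_partial (g := fun=> 0) oc' m (fun y iy => Z y iy i j k h0 h1) iy).
  by rewrite partialE derive_cst.
have K' y (iy : img c' y) : curv_coef (nabla D c') 0 0 y =
      - partial 1 (christoffel (nabla D c') 0 0 0) y /\
    curv_coef (nabla D c') 1 1 y = partial 0 (christoffel (nabla D c') 1 1 1) y.
  rewrite /curv_coef !(Z y iy 0 1) // !(Z y iy 1 0) // !(Z y iy 0 0 1) // !(Z y iy 1 1 0) //.
  rewrite (pZ y iy 0 1 0 0) // (pZ y iy 1 0 1 1) //.
  by split; abstract_ring.
have KK y (iy : img c' y) : partial 1 (fun z => - christoffel (nabla D c') 0 0 0 z) y =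
    partial 0 (christoffel (nabla D c') 1 1 1) y.
  have [_ _] := skew_curv_coef oc' Hn' (sk c' ac') iy; have [-> ->] := K' y iy => <-.
  by rewrite partialN//; exact: Cinf_diff (CG _ _ _) iy.
have [phi [Cphi Hphi]] : exists phi, Cinf (img c') phi /\ forall y, img c' y ->
    partial 0 phi y = - christoffel (nabla D c') 0 0 0 y /\
    partial 1 phi y = christoffel (nabla D c') 1 1 1 y.
  move: KK CG oc'; rewrite I' => KK CG oc'.
  by apply: (poincare r0 _ (CG 1 1 1) KK); apply: CinfN => //; exact: CG.
exists c'; split=> //; first by rewrite D'.
exists phi; first exact/(smooth_Cinf oc').
move=> y iy; have [h0 h1] := Hphi y iy; rewrite !pderivE; split.
  move=> i j k; case: ifPn => [/and3P[/eqP-> /eqP-> /eqP->]|n0]; first by rewrite h0 opprK.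
  case: ifPn => [/and3P[/eqP-> /eqP-> /eqP->]|n1]; first by rewrite h1.
  exact: Z.
rewrite (eq_partial oc' 1 (fun y iy => (Hphi y iy).1) iy) KK// -(K' y iy).2.
by have := nz c' ac' y iy; rewrite (rhoE oc' Hn' _ _ iy) /= oppr_eq0.
Qed.

End ForwardCharts.

(** * Zeros of recurrent tensors *)

Section LocalUniqueness.
Variable R : realType.

Lemma bounded_near (I : finType) (V : set (plane R)) (F : I -> plane R -> R) x0 :
  (forall i, Cinf V (F i)) -> V x0 ->
  exists2 M, 0 <= M & \forall y \near x0, forall i, `|F i y| <= M.
Proof.
move=> CF Vx0; exists (\sum_i (`|F i x0| + 1)).
  by apply: sumr_ge0 => i _; rewrite addr_ge0.
have H i : \forall y \near x0, `|F i y| <= \sum_i (`|F i x0| + 1); last exact: filter_forall H.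
have /(@cvgrPdist_lt _ R^o _ (nbhs x0))/(_ 1 ltr01) := Cinf_cont (CF i) Vx0.
apply: filterS => y Fy; rewrite (bigD1 i)//= ler_wpDr//.
  by apply: sumr_ge0 => j _; rewrite addr_ge0.
have := ler_normD (F i x0) (F i y - F i x0).
by rewrite addrC subrK distrC; lra.
Qed.

(** A tensor whose covariant derivative is proportional to itself satisfies a linear
    differential system along each segment. The sum E of the squares of its
    components then satisfies |E'| <= L E, with L small on short segments. *)
Lemma tensor_vanish (V : set (plane R)) (al : 'I_2 -> plane R -> R)
    (G : 'I_2 -> 'I_2 -> 'I_2 -> plane R -> R) (T : 'I_2 -> 'I_2 -> plane R -> R) x0 :
  open V -> (forall m, Cinf V (al m)) -> (forall i j k, Cinf V (G i j k)) ->
  (forall j k, Cinf V (T j k)) ->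
  (forall m j k x, V x -> partial m (T j k) x = al m x * T j k x + G m j 0 x * T 0 k x +
     G m j 1 x * T 1 k x + G m k 0 x * T j 0 x + G m k 1 x * T j 1 x) ->
  V x0 -> (forall j k, T j k x0 = 0) -> \forall y \near x0, forall j k, T j k y = 0.
Proof.
move=> oV Cal CG CT ET Vx0 T0.
have [M1 M10 B1] := bounded_near Cal Vx0.
have [M2 M20 B2] := @bounded_near _ V
  (fun ijk : 'I_2 * 'I_2 * 'I_2 => G ijk.1.1 ijk.1.2 ijk.2) x0 (fun i => CG _ _ _) Vx0.
pose M := M1 + M2 + 1; have M0 : 0 < M by rewrite /M; lra.
have nV : \forall y \near x0, V y by exact: open_nbhs_nbhs.
have [r /= r0 Hr] := (nbhs_ballP _ _).1 (filterI nV (filterI B1 B2)).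
pose de := Num.min r (160 * M)^-1.
have de0 : 0 < de by rewrite lt_min r0 invr_gt0 mulr_gt0.
have deM : 80 * M * de <= 2^-1.
  have : de <= (160 * M)^-1 by rewrite /de ge_min lexx orbT.
  move=> dd; have : de * (160 * M) <= 1 by rewrite -ler_pdivlMr ?mulr_gt0// mul1r.
  by lra.
pose E y := T 0 0 y * T 0 0 y + T 0 1 y * T 0 1 y + T 1 0 y * T 1 0 y + T 1 1 y * T 1 1 y.
have CE : Cinf V E by rewrite /E; solve_Cinf.
pose N y := `|T 0 0 y| + `|T 0 1 y| + `|T 1 0 y| + `|T 1 1 y|.
have TN j k y : `|T j k y| <= N y.
  rewrite /N; have := normr_ge0 (T 0 0 y); have := normr_ge0 (T 0 1 y).
  have := normr_ge0 (T 1 0 y); have := normr_ge0 (T 1 1 y).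
  by case: (ordI2 j) => ->; case: (ordI2 k) => ->; lra.
have N0 y : 0 <= N y by rewrite /N !addr_ge0.
have NE y : N y * N y <= 4 * E y.
  rewrite /N /E -!expr2 -(real_normK (num_real (T 0 0 y))) -(real_normK (num_real (T 0 1 y))).
  rewrite -(real_normK (num_real (T 1 0 y))) -(real_normK (num_real (T 1 1 y))).
  move: `|T 0 0 y| `|T 0 1 y| `|T 1 0 y| `|T 1 1 y| => a b c d.
  have := sqr_ge0 (a - b); have := sqr_ge0 (a - c); have := sqr_ge0 (a - d).
  have := sqr_ge0 (b - c); have := sqr_ge0 (b - d); have := sqr_ge0 (c - d).
  by nra.
have BT y : ball x0 r y -> forall m j k, `|partial m (T j k) y| <= 5 * M * N y.
  move=> /Hr[Vy [b1 b2]] m j k; rewrite ET//.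
  have term (u : R) j' k' : `|u| <= M -> `|u * T j' k' y| <= M * N y.
    by move=> uM; rewrite normrM; apply: ler_pM.
  have h1 m' : `|al m' y| <= M by apply: le_trans (b1 m') _; rewrite /M; lra.
  have h2 i' j' k' : `|G i' j' k' y| <= M.
    by apply: le_trans (b2 (i', j', k')) _; rewrite /M; lra.
  have -> : 5 * M * N y = M * N y + M * N y + M * N y + M * N y + M * N y by ring.
  by do 4 (apply: le_trans (ler_normD _ _) _; apply: lerD; last exact: term); exact: term.
apply/nbhs_ballP; exists de => //= y; rewrite -ball_normE /= => xy.
pose v := y - x0; have vd i : `|v 0 i| <= de.
  by apply: le_trans (coord_le_norm _ _) _; rewrite /v distrC ltW.
have inB (t : R) : `|t - 0| <= 1 -> ball x0 r (x0 + t *: v).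
  rewrite subr0 => t1; rewrite -ball_normE /= opprD addNKr normrN normrZ.
  apply: le_lt_trans (_ : `|v| < r); first by rewrite ler_piMl.
  by rewrite /v distrC (lt_le_trans xy)// /de ge_min lexx.
have pE m z : V z -> partial m E z = 2 * (T 0 0 z * partial m (T 0 0) z +
   T 0 1 z * partial m (T 0 1) z + T 1 0 z * partial m (T 1 0) z + T 1 1 z * partial m (T 1 1) z).
  move=> Vz; rewrite /E; eapply hp_eq; [solve_partial|].
  by abstract_atoms; move: (T 0 0 z) (T 0 1 z) (T 1 0 z) (T 1 1 z) => *; ring.
have pEb m z : ball x0 r z -> `|partial m E z| <= 40 * M * E z.
  move=> Bz; have [Vz _] := Hr _ Bz; rewrite pE// normrM ger0_norm//.
  have term j k : `|T j k z * partial m (T j k) z| <= `|T j k z| * (5 * M * N z).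
    by rewrite normrM; apply: ler_pM => //; exact: BT.
  have -> : 40 * M * E z = 2 * (5 * M * (4 * E z)) by ring.
  apply: ler_wpM2l => //; apply: le_trans (_ : N z * (5 * M * N z) <= _).
    move: term; rewrite {2}/N; move: (5 * M * N z) => B term; rewrite !mulrDl.
    by do 3 (apply: le_trans (ler_normD _ _) _; apply: lerD; last exact: term); exact: term.
  by rewrite mulrCA ler_wpM2l ?NE// mulr_ge0// ltW.
have EN z : 0 <= E z by have := NE z; have := N0 z; nra.
have E1 : `|E (x0 + 1 *: v)| <= 2 * 1 * 0.
  apply: (@short_gronwall R (fun t => E (x0 + t *: v)) (fun t => 'D_v E (x0 + t *: v))
    0 1 (80 * M * de) 0) => //.
  - by rewrite mulr_ge0 ?mulr_ge0// ltW.
  - by rewrite mul1r.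
  - by rewrite scale0r addr0 /E !T0 !mulr0 !addr0.
  - move=> t t1; apply: derive_lineE; apply: diff_derivable.
    by apply: (Cinf_diff CE); exact: (Hr _ (inB t t1)).1.
  - move=> t t1; have Bt := inB t t1; have [Vt _] := Hr _ Bt.
    rewrite deriv2E; last exact: Cinf_diff CE Vt.
    rewrite addr0 (ger0_norm (EN _)); apply: le_trans (ler_normD _ _) _.
    rewrite !normrM; have := pEb 0 _ Bt; have := pEb 1 _ Bt; have := vd 0; have := vd 1.
    have := EN (x0 + t *: v); move: (E _) (partial 0 E _) (partial 1 E _) => e a b e0.
    move=> v1 v0 b1 a1.
    have -> : 80 * M * de * e = de * (40 * M * e) + de * (40 * M * e) by ring.
    by apply: lerD; apply: ler_pM.
  - by rewrite subr0 normr1.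
have yE : x0 + 1 *: v = y by rewrite scale1r /v addrC subrK.
move: E1; rewrite yE mulr0 normr_le0 => /eqP E1 j k.
have := NE y; rewrite E1 mulr0 => NN.
have Ny : N y = 0 by have := N0 y; nra.
by apply/eqP; rewrite -normr_le0 -Ny.
Qed.

End LocalUniqueness.

Section Connected.
Variable T : topologicalType.

Lemma connected_clopen (P : set T) : connected [set: T] -> open P -> open (~` P) ->
  P !=set0 -> forall x, P x.
Proof.
move=> cT oP oNP P0 x.
have -> : P = [set: T]; last by [].
apply: cT => //; first by exists P; rewrite ?setTI.
by exists P; rewrite ?setTI// -openC.
Qed.

End Connected.

(** * Recurrent Szabo surfaces have a skew Ricci tensor *)

Section Forward.
Variables (R : realType) (S : surface R) (D : affine_connection S).

Let sc (c : chart R S) v : smooth_on (img c) (cst v : vfield R).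
Proof. by apply: smooth_cst; exact: open_img. Qed.

Let scoord (c : chart R S) i : smooth_on (img c) (@coord_field R i : vfield R).
Proof. by apply: smooth_coord_field; exact: open_img. Qed.

(** For sg = 0 this is the Ricci tensor and for sg = 1 twice its symmetric part, so
    that both are treated at once. *)
Definition ricci_combination (sg : R) (c : chart R S) (j k : 'I_2) (x : plane R) : R :=
  rho (nabla D c) j k x + sg * rho (nabla D c) k j x.

Definition ricci_vanishes (sg : R) (p : S) := forall c : chart R S, atlas c -> dom c p ->
  forall j k, ricci_combination sg c j k (coord c p) = 0.

Lemma ricci_combination_transform sg (c c' : chart R S) p j k : atlas c -> atlas c' -> dom c p ->
  dom c' p -> (forall j k, ricci_combination sg c j k (coord c p) = 0) ->
  ricci_combination sg c' j k (coord c' p) = 0.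
Proof.
move=> ac ac' dp dp' z.
have E v w : ricci (nabla D c) (cst v) (cst w) (coord c p) +
    sg * ricci (nabla D c) (cst w) (cst v) (coord c p) = 0.
  rewrite !(ricci_rho (open_img c) (nablaP D ac) (@sc c _) (@sc c _) (coord_img dp)) /cst.
  move: (z 0 0) (z 0 1) (z 1 0) (z 1 1); rewrite /ricci_combination.
  move: (rho _ 0 0 _) (rho _ 0 1 _) (rho _ 1 0 _) (rho _ 1 1 _) => r00 r01 r10 r11.
  move: (v 0 0) (v 0 1) (w 0 0) (w 0 1) => a b a' b' h1 h2 h3 h4.
  transitivity (a * a' * (r00 + sg * r00) + a * b' * (r01 + sg * r10) +
    b * a' * (r10 + sg * r01) + b * b' * (r11 + sg * r11)); first by ring.
  by rewrite h1 h2 h3 h4 !mulr0 !addr0.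
rewrite /ricci_combination /rho.
rewrite !(ricci_transform D _ _ ac' ac dp' dp).
exact: E.
Qed.

Lemma ricci_combination_Cinf sg (c : chart R S) j k : atlas c -> Cinf (img c) (ricci_combination sg c j k).
Proof.
move=> ac; have oc := open_img c; have CR j' k' := rho_Cinf oc (nablaP D ac) j' k'.
by apply: (CinfD oc) => //; apply: (CinfM oc) => //; exact: Cinf_cst.
Qed.

Hypothesis alpha : one_form S.
Hypothesis rec : forall c, atlas c -> forall W Y Z : vfield R,
    smooth_on (img c) W -> smooth_on (img c) Y -> smooth_on (img c) Z ->
    forall x, img c x ->
      nabla_ricci (nabla D c) W Y Z x =
      (W x *m Defs.form alpha c x) 0 0 * ricci (nabla D c) Y Z x.

Let al (c : chart R S) (m : 'I_2) x := Defs.form alpha c x m 0.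

Let al_Cinf c m : atlas c -> Cinf (img c) (al c m).
Proof.
move=> ac; have oc := open_img c.
by have /(smooth_on_mxP _ oc)/(_ m 0)/(smooth_Cinf oc) := form_smooth alpha ac.
Qed.

Let alE (c : chart R S) (v : plane R) x : (v *m Defs.form alpha c x) 0 0 =
  v 0 0 * al c 0 x + v 0 1 * al c 1 x.
Proof. by rewrite mxE sumI2. Qed.

Lemma recurrent_rho c m j k x : atlas c -> img c x ->
  nabla_rho (nabla D c) m j k x = al c m x * rho (nabla D c) j k x.
Proof.
move=> ac ix; have oc := open_img c; have Hn := nablaP D ac.
rewrite -(nabla_ricci_coord oc Hn m j k ix).
rewrite (rec ac (@scoord c m) (@scoord c j) (@scoord c k) ix) alE /rho /coord_field /cst.
by case: (ordI2 m) => ->; rewrite -> ?e00, ?e01, ?e10, ?e11; rewrite ?mul1r ?mul0r ?addr0 ?add0r.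
Qed.

(** The zero set is open by [tensor_vanish] and closed by continuity. *)
Lemma ricci_vanishes_dichotomy sg : connected [set: S] ->
  (exists p, ricci_vanishes sg p) -> forall p, ricci_vanishes sg p.
Proof.
move=> cS; apply: connected_clopen => //.
  rewrite openE => p Zp; have [c ac dp] := atlas_cover p.
  have oc := open_img c; have Hn := nablaP D ac; have ix := coord_img dp.
  have CG i j k := G_Cinf oc Hn i j k; have CR j k := rho_Cinf oc Hn j k.
  have Z : \forall y \near coord c p, forall j k, ricci_combination sg c j k y = 0.
    apply: (@tensor_vanish R (img c) (al c) (christoffel (nabla D c)) (ricci_combination sg c)) => //.
    - by move=> m; exact: al_Cinf.
    - by move=> j k; exact: ricci_combination_Cinf.
    - move=> m j k x ixx.
      have H j' k' : partial m (rho (nabla D c) j' k') x = al c m x * rho (nabla D c) j' k' x +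
          christoffel (nabla D c) m j' 0 x * rho (nabla D c) 0 k' x +
          christoffel (nabla D c) m j' 1 x * rho (nabla D c) 1 k' x +
          christoffel (nabla D c) m k' 0 x * rho (nabla D c) j' 0 x +
          christoffel (nabla D c) m k' 1 x * rho (nabla D c) j' 1 x.
        have := recurrent_rho m j' k' ac ixx; rewrite /nabla_rho => <-.
        by abstract_tensors; abstract_atoms; move=> *; ring.
      have -> : partial m (ricci_combination sg c j k) x = partial m (rho (nabla D c) j k) x +
          sg * partial m (rho (nabla D c) k j) x.
        rewrite /ricci_combination; eapply hp_eq; [solve_partial|].
        by abstract_tensors; abstract_atoms; move=> *; ring.
      rewrite !H /ricci_combination; abstract_tensors; abstract_atoms.
      by move: (al c m x) => *; ring.
    - by move=> j k; exact: Zp.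
  have n1 : \forall q \near p, dom c q by apply: open_nbhs_nbhs; split=> //; exact: dom_open.
  have n2 := coord_cont dp Z.
  apply: filterS2 n1 n2 => q dq Zq c' ac' dq' j k.
  exact: (ricci_combination_transform _ _ ac ac' dq dq').
rewrite openE => p nZ; have [c ac dp] := atlas_cover p.
have [j [k njk]] : exists j k, ricci_combination sg c j k (coord c p) != 0.
  apply: contrapT => H; apply: nZ => c' ac' dp' j k.
  apply: (ricci_combination_transform _ _ ac ac' dp dp') => j' k'.
  by apply/eqP; apply: contrapT => /negP h; apply: H; exists j', k'.
have n1 : \forall q \near p, dom c q by apply: open_nbhs_nbhs; split=> //; exact: dom_open.
have Z : \forall y \near coord c p, ricci_combination sg c j k y != 0.
  have cf := Cinf_cont (ricci_combination_Cinf sg j k ac) (coord_img dp).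
  exact: (cvgr_neq0 (V := R^o) _ cf njk).
have n2 := coord_cont dp Z.
apply: filterS2 n1 n2 => q dq Zq /(_ c ac dq j k) E.
by move: Zq; rewrite /preimage /= E eqxx.
Qed.

(** By [nabla_curvature_ricci]. *)
Lemma parallel_locally_symmetric :
  (forall c, atlas c -> forall m j k x, img c x -> nabla_rho (nabla D c) m j k x = 0) ->
  locally_symmetric D.
Proof.
move=> par c ac W X Y Z sW sX sY sZ x ix; have oc := open_img c; have Hn := nablaP D ac.
rewrite (nabla_curvature_ricci oc Hn sW sX sY sZ ix).
rewrite (nabla_ricciE oc Hn sW sY sZ ix) (nabla_ricciE oc Hn sW sX sZ ix).
by rewrite !par// !(mulr0, addr0) !scale0r subrr.
Qed.

Hypotheses (cS : connected [set: S]) (nls : ~ locally_symmetric D) (szabo : affine_szabo D).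

(** A Ricci tensor that vanishes at one point vanishes identically, and the
    curvature with it. *)
Lemma ricci_nowhere_zero p : ~ ricci_vanishes 0 p.
Proof.
move=> Zp; apply: nls; apply: parallel_locally_symmetric => c ac m j k x ix.
have Z := ricci_vanishes_dichotomy cS (ex_intro _ p Zp).
rewrite recurrent_rho//; have [q dq qx] := ix.
by have := Z q c ac dq j k; rewrite /ricci_combination mul0r addr0 qx => ->; rewrite mulr0.
Qed.

(** The four directions (1, 0), (0, 1), (1, 1) and (1, -1) determine the
    coefficients of a binary cubic form. *)
Lemma cubic_zero (a b A B C : R) : (forall x y : R,
    (x * a + y * b) * (x * (x * A + y * B) + y * (x * B + y * C)) = 0) ->
  A = 0 /\ B = 0 /\ C = 0 \/ a = 0 /\ b = 0.
Proof.
move=> H; have h0 := H 1 0; have h1 := H 0 1; have h2 := H 1 1; have h3 := H 1 (-1).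
have aA : a * A = 0 by lra.
have bC : b * C = 0 by lra.
have e1 : a * B + a * B + b * A = 0 by lra.
have e2 : a * C + (b * B + b * B) = 0 by lra.
have [a0|a0] := eqVneq a 0; have [b0|b0] := eqVneq b 0; first by right.
- left; have C0 : C = 0 by apply: (mulfI b0); rewrite mulr0.
  have A0 : A = 0 by apply: (mulfI b0); rewrite mulr0; move: e1; rewrite a0; lra.
  have B0 : B = 0 by apply: (mulfI b0); rewrite mulr0; move: e2; rewrite C0; lra.
  by [].
- left; have A0 : A = 0 by apply: (mulfI a0); rewrite mulr0.
  have B0 : B = 0 by apply: (mulfI a0); rewrite mulr0; move: e1; rewrite A0; lra.
  have C0 : C = 0 by apply: (mulfI a0); rewrite mulr0; move: e2; rewrite B0; lra.
  by [].
left; have A0 : A = 0 by apply: (mulfI a0); rewrite mulr0.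
have C0 : C = 0 by apply: (mulfI b0); rewrite mulr0.
by split=> //; split=> //; apply: (mulfI a0); rewrite mulr0; move: e1; rewrite A0; lra.
Qed.

(** Otherwise the symmetric part of rho has no zero, and alpha(v) rho(v, v) = 0 for
    all v forces alpha = 0; then the curvature is parallel. *)
Lemma szabo_ricci_skew p : ricci_vanishes 1 p.
Proof.
move: p; apply: (ricci_vanishes_dichotomy cS); apply: contrapT => nZ; apply: nls.
apply: parallel_locally_symmetric => c ac m j k x ix; have [q dq qx] := ix.
have oc := open_img c; have Hn := nablaP D ac.
rewrite recurrent_rho//.
suff -> : al c m x = 0 by rewrite mul0r.
have cyc v : nabla_ricci (nabla D c) (cst v) (cst v) (cst v) x = 0.
  by apply: (szabo_cyclic oc Hn ix); rewrite -qx; exact: szabo.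
have [||[a0 b0]] := @cubic_zero (al c 0 x) (al c 1 x) (2 * rho (nabla D c) 0 0 x)
  (rho (nabla D c) 0 1 x + rho (nabla D c) 1 0 x) (2 * rho (nabla D c) 1 1 x).
- move=> s t; have := cyc (pt s t); rewrite (rec ac (@sc c _) (@sc c _) (@sc c _) ix) alE.
  rewrite (ricci_rho oc Hn (@sc c _) (@sc c _) ix) /cst !pt0 !pt1.
  move: (rho _ 0 0 x) (rho _ 0 1 x) (rho _ 1 0 x) (rho _ 1 1 x) (al c 0 x) (al c 1 x).
  move=> r00 r01 r10 r11 a b E.
  apply: etrans (_ : 2 * ((s * a + t * b) *
    (s * (s * r00 + t * r01) + t * (s * r10 + t * r11))) = 0); first by ring.
  by rewrite E mulr0.
- move=> [h0 [h1 h2]]; exfalso; apply: nZ; exists q => c' ac' dq' j' k'.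
  apply: (ricci_combination_transform _ _ ac ac' dq dq'); rewrite qx => j1 k1; rewrite /ricci_combination mul1r.
  move: h0 h1 h2; case: (ordI2 j1) => ->; case: (ordI2 k1) => ->;
  move: (rho _ 0 0 x) (rho _ 0 1 x) (rho _ 1 0 x) (rho _ 1 1 x) => *; lra.
by case: (ordI2 m) => ->.
Qed.

Lemma szabo_recurrent_normal_form : forall p : S, exists c : chart R S, [/\ atlas c, dom c p &
    exists2 phi : plane R -> R, smooth_on (img c) phi & has_normal_form D c phi].
Proof.
have sk (c : chart R S) : atlas c -> forall x, img c x -> forall j k,
    rho (nabla D c) j k x = - rho (nabla D c) k j x.
  move=> ac _ [q dq <-] j k; apply/eqP; rewrite -addr_eq0; apply/eqP.
  by have := szabo_ricci_skew ac dq j k; rewrite /ricci_combination mul1r.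
apply: skew_ricci_normal_form => // c ac x ix; apply/eqP => r01.
have [q dq qx] := ix; apply: (@ricci_nowhere_zero q) => c' ac' dq' j k.
apply: (ricci_combination_transform _ _ ac ac' dq dq') => j' k'.
rewrite /ricci_combination mul0r addr0 qx.
have rjj i : rho (nabla D c) i i x = 0 by have := sk c ac x ix i i; lra.
have r10 : rho (nabla D c) 1 0 x = 0 by rewrite sk// r01 oppr0.
by case: (ordI2 j') => ->; case: (ordI2 k') => ->;
  [exact: rjj|exact: r01|exact: r10|exact: rjj].
Qed.

End Forward.

Theorem theorem3p7 (R : realType) (S : surface R) (D : affine_connection S)
    (S_nonempty : [set: S] !=set0) (S_connected : connected [set: S])
    (D_szabo : affine_szabo D) :
  recurrent D /\ ~ locally_symmetric D <->
  forall p : S, exists c : chart R S, [/\ atlas c, dom c p &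
    exists2 phi : plane R -> R, smooth_on (img c) phi & has_normal_form D c phi].
Proof.
split=> [[[alpha rec] nls]|NF].
  exact: szabo_recurrent_normal_form rec S_connected nls D_szabo.
by split; [exact: normal_form_recurrent|exact: normal_form_not_symmetric].
Qed.
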